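(* Fix $0<x_{\min}<x_{\max}$. There exist constants $c_{x_{\max},x_{\min}}>0$ and $C_{x_{\max},x_{\min}}>0$, depending only on $x_{\max}$ and $x_{\min}$, such that for all positive integers $m,n,L,k$ with $k\le n/2$ and $k\log(en/k)\le m$, and all $\sigma_z\ge0$, $$c_{x_{\max},x_{\min}}\frac{k}{nL}\ \le\ R_2(\mathcal S_k^{\rm bdd},m,n,\sigma_z)\ \le\ C_{x_{\max},x_{\min}}\left(\frac{k}{nL}+\frac{\sigma_z^2k\log(n/k)}{mn}\right),$$ where $A_1,\dots,A_L$ are independent $m\times n$ random matrices with i.i.d. $N(0,1)$ entries. In particular, if in addition $\sigma_z^2L\log(n/k)\le m$, then the upper and lower bounds have the same order $\frac{k}{nL}$ (up to constants depending only on $x_{\max},x_{\min}$).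
   Context: Model: $\boldsymbol x_o\in\mathbb R^n$ is an unknown vector and $X_o=\mathrm{diag}(\boldsymbol x_o)$. One observes $\boldsymbol y_l=A_lX_o\boldsymbol w_l+\boldsymbol z_l\in\mathbb R^m$ for $l=1,\dots,L$, where $\boldsymbol w_1,\dots,\boldsymbol w_L$ are i.i.d. $N(0,I_n)$, $\boldsymbol z_1,\dots,\boldsymbol z_L$ are i.i.d. $N(0,\sigma_z^2I_m)$, and the families $(A_l)$, $(\boldsymbol w_l)$, $(\boldsymbol z_l)$ are mutually independent. The matrices $A_1,\dots,A_L$ are known to the estimator. Minimax risk: $R_2(\mathcal C,m,n,\sigma_z)=\inf_{\hat{\boldsymbol x}}\sup_{\boldsymbol x_o\in\mathcal C}\mathbb E\left[\|\hat{\boldsymbol x}-\boldsymbol x_o\|_2^2/n\right]$, where the infimum is over all measurable estimators $\hat{\boldsymbol x}$ that are functions of $\boldsymbol y_1,\dots,\boldsymbol y_L$ and $A_1,\dots,A_L$, and the expectation is over all the randomness (including the $A_l$). The dependence on $L$ is suppressed in the notation. Sparse class: $\mathcal S_k^{\rm bdd}=\{\boldsymbol x\in\mathbb R^n:\ \|\boldsymbol x\|_0\le k,\ \text{and for each } i \text{ either } x_i=0 \text{ or } x_{\min}\le x_i\le x_{\max}\}$, where $\|\boldsymbol x\|_0$ is the number of nonzero entries. *)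

(* Defs.v *)
From HB Require Import structures.
From mathcomp Require Import all_boot all_order all_algebra.
From mathcomp Require Import all_classical all_reals all_analysis.

Set Implicit Arguments.
Unset Strict Implicit.
Unset Printing Implicit Defensive.

Import Order.TTheory GRing.Theory Num.Theory.
Import numFieldNormedType.Exports.

Local Open Scope classical_set_scope.
Local Open Scope ring_scope.

Section iid.
Context d (T : measurableType d) (R : realType).

Definition tuple_cons n (x : T * n.-tuple T) : n.+1.-tuple T :=
  [tuple of x.1 :: x.2].

Lemma measurable_tuple_cons n : measurable_fun setT (@tuple_cons n).
Proof. exact: measurable_cons. Qed.

HB.instance Definition _ n :=
  isMeasurableFun.Build _ _ _ _ (@tuple_cons n) (@measurable_tuple_cons n).

(* Joint law of n independent T-valued random elements of law P, i.e. the
   n-fold product measure of P; iid_rect below is its characteristic property. *)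
Fixpoint iid (P : probability T R) (n : nat) : probability (n.-tuple T) R :=
  match n return probability (n.-tuple T) R with
  | 0 => \d_[tuple]
  | n'.+1 => distribution (P \x iid P n')%E (@tuple_cons n')
  end.

Lemma iid_rect (P : probability T R) n (B : 'I_n -> set T) :
  (forall i, measurable (B i)) ->
  iid P n [set t | forall i, B i (tnth t i)] = (\prod_(i < n) P (B i))%E.
Proof.
elim: n B => [|n IHn] B mB.
  rewrite big_ord0 /= diracE mem_set// => -[]//.
rewrite big_ord_recl -IHn; last by move=> i; exact: mB.
rewrite /= /distribution /pushforward -product_measure1E//; last first.
  rewrite [X in measurable X](_ : _ =
    \bigcap_(i in [set: 'I_n]) ((@tnth n T ^~ i) @^-1` B (lift ord0 i))).
    apply: fin_bigcap_measurable => // i _; rewrite -[X in measurable X]setTI.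
    exact: measurable_tnth.
  by apply/seteqP; split => [t Bt i _|t Bt i]; exact: Bt.
congr (_ _); apply/seteqP; split => -[x t] /=.
  move=> Bxt; split => [|i]; first by have := Bxt ord0; rewrite tnth0.
  by have := Bxt (lift ord0 i); rewrite tnthS.
move=> [Bx Bt] i; case: (unliftP ord0 i) => [j|] ->; last by rewrite tnth0.
by rewrite tnthS.
Qed.

End iid.

Section normal_law.
Variable R : realType.

Definition idTR : measurableTypeR R -> R := idfun.

HB.instance Definition _ :=
  @isMeasurableFun.Build _ _ _ _ idTR (@measurable_id _ _ setT).

(* The law N(m, s^2). normal_prob m 0 is a junk value (uniform on [0, 1]), so
   the degenerate case s = 0 is the Dirac mass at m. normal_prob lives on
   measurableTypeR R, which has the Borel sets of R under another display; idTR
   transports it to the canonical measurable structure of R. *)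
Definition normal_law (m s : R) : probability R R :=
  if s == 0 then \d_m : probability R R
  else distribution (normal_prob m s : probability (measurableTypeR R) R) idTR
         : probability R R.

Lemma normal_lawE (m s : R) : s != 0 ->
  normal_law m s = normal_prob m s :> (set R -> \bar R).
Proof. by rewrite /normal_law => /negbTE ->. Qed.

End normal_law.

Section model.
Variable R : realType.

(* Vectors and matrices are carried by (nested) tuples, which have the product
   sigma-algebra; col_of and mx_of give the corresponding matrices. *)
Definition col_of n (t : n.-tuple R) : 'cV[R]_n := \col_i tnth t i.

Definition mx_of m n (t : m.-tuple (n.-tuple R)) : 'M[R]_(m, n) :=
  \matrix_(i, j) tnth (tnth t i) j.

Definition gauss_vec (n : nat) (s : R) : probability (n.-tuple R) R :=
  iid (normal_law 0 s) n.

Definition gauss_mx (m n : nat) : probability (m.-tuple (n.-tuple R)) R :=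
  iid (gauss_vec n 1) m.

(* Joint law of (A_1, .., A_L), (w_1, .., w_L), (z_1, .., z_L). *)
Definition model_law (L m n : nat) (sz : R) : probability
    (L.-tuple (m.-tuple (n.-tuple R)) *
     (L.-tuple (n.-tuple R) * L.-tuple (m.-tuple R)))%type R :=
  (iid (gauss_mx m n) L \x (iid (gauss_vec n 1) L \x iid (gauss_vec m sz) L))%E.

Definition observation L m n (xo : 'cV[R]_n)
    (A : L.-tuple (m.-tuple (n.-tuple R))) (w : L.-tuple (n.-tuple R))
    (z : L.-tuple (m.-tuple R)) : L.-tuple (m.-tuple R) :=
  [tuple [tuple (mx_of (tnth A l) *m diag_mx xo^T *m col_of (tnth w l)
                 + col_of (tnth z l)) i ord0 | i < m] | l < L].

Definition estimator (L m n : nat) :=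
  {mfun (L.-tuple (m.-tuple R) * L.-tuple (m.-tuple (n.-tuple R)))%type
     >-> n.-tuple R}.

(* The norm of 'cV[R]_n in the library is the sup norm. *)
Definition sqnorm2 n (x : 'cV[R]_n) : R := \sum_i x i ord0 ^+ 2.

Definition mse L m n (sz : R) (xhat : estimator L m n) (xo : 'cV[R]_n) : \bar R :=
  'E_(model_law L m n sz)[fun '(A, (w, z)) =>
     sqnorm2 (col_of (xhat (observation xo A w z, A)) - xo) / n%:R].

Definition minimax_risk (L : nat) n (C : set 'cV[R]_n) (m : nat) (sz : R) : \bar R :=
  ereal_inf [set ereal_sup [set mse sz xhat xo | xo in C]
            | xhat in [set: estimator L m n]].

Definition l0norm n (x : 'cV[R]_n) : nat := #|[set i | x i ord0 != 0]%SET|.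

Definition sparse_bdd n (k : nat) (xmin xmax : R) : set 'cV[R]_n :=
  [set x : 'cV[R]_n | (l0norm x <= k)%N /\
    forall i, x i ord0 = 0 \/ xmin <= x i ord0 <= xmax].

End model.

(* Main.v *)
From HB Require Import structures.
Require Import Defs.
From mathcomp Require Import all_boot all_order all_algebra.
From mathcomp Require Import all_classical all_reals all_analysis.
From mathcomp Require Import measurable_realfun ring lra.

(** Estimating a coordinate amounts to estimating a scale: x_i is seen only
through the Gaussian variables x_i w_{l,i}, so L samples determine x_i^2 up to an
error of variance 1/L, and no better. The k coordinates of the support thus cost
k/L in total, which is the rate k/(nL) after normalization.

Upper bound. Let a_{l,i} be the i-th column of A_l. The statistic
(a_{l,i}.y_l)^2 - |y_l|^2 has mean N x_i^2 with N of order m^2, and variance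
O(m^4) as soon as |x|^2 + sz^2 = O(m) [stat_moment_bounds]. Its average over l
gives x_i^2, hence x_i >= xmin, with mean squared error O(1/L). Used at all
coordinates this would cost n/L, so the same statistic, truncated where |y_l|^2
is abnormally large, first decides whether x_i vanishes. If it does, a_{l,i} is
independent of y_l: given y_l, the product a_{l,i}.y_l is exactly
N(0, |y_l|^2), and the truncated statistic has exponential moments at the scale
m W, where W = k xmax^2 + sz^2 [trunc_stat_mgf]. Chernoff's bound makes a false
detection as rare as exp(- c L ln(en/k)), because W ln(en/k) = O(m); this is
where k ln(en/k) <= m enters. The n zero coordinates then add O(k/L). When L is
below a constant or sz^2 ln(n/k) exceeds m, the announced bound is of order k/n
and the zero estimator reaches it [minimax_upper].

Lower bound. Let the first k coordinates take the values xmin and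
xmin (1 + h)^(1/2) with h of order L^(-1/2). Dividing x_i by r has the same
effect on the observations as dividing w_{l,i} by r for all l, that is, as
reweighting the law of w by a likelihood ratio of L Gaussian variables, whatever
the matrices and the noise. For this h its second moment stays bounded
[ratio_sq], so that no estimator has risk below a constant times h^2, of order
1/L, at both values [two_point]. Averaging over the cube of all choices yields a vertex with total
risk of order k/L [flip_average, minimax_lower].

If moreover sz^2 L ln(n/k) <= m, the noise term of the upper bound is at most
k/(nL). *)

Set Implicit Arguments.
Unset Strict Implicit.
Unset Printing Implicit Defensive.

Import Order.TTheory GRing.Theory Num.Theory.
Import numFieldNormedType.Exports.
Local Open Scope classical_set_scope.
Local Open Scope ring_scope.

(** * Measurability of tuple-valued expressions *)

Section tuple_measurability.
Context d d' (T : measurableType d) (T' : measurableType d').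

Lemma measurable_mktuple n (F : 'I_n -> T -> T') :
  (forall i, measurable_fun setT (F i)) ->
  measurable_fun setT (fun x => [tuple F i x | i < n]).
Proof.
move=> mF; apply/measurable_fun_tnthP => i.
by rewrite (_ : _ \o _ = F i)//; apply/funext => x /=; rewrite tnth_mktuple.
Qed.

Lemma measurable_tnth_comp n (f : T -> n.-tuple T') i :
  measurable_fun setT f -> measurable_fun setT (fun x => tnth (f x) i).
Proof. by move=> mf; apply: (measurableT_comp (measurable_tnth i) mf). Qed.

End tuple_measurability.

Section measurable_proj.
Context d d1 d2 (T : measurableType d) (T1 : measurableType d1) (T2 : measurableType d2).

Lemma measurable_fst_comp (f : T -> T1 * T2) :
  measurable_fun setT f -> measurable_fun setT (fun x => (f x).1).
Proof. exact: measurableT_comp measurable_fst. Qed.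

Lemma measurable_snd_comp (f : T -> T1 * T2) :
  measurable_fun setT f -> measurable_fun setT (fun x => (f x).2).
Proof. exact: measurableT_comp measurable_snd. Qed.

End measurable_proj.

Ltac measurable_step := match goal with
 | |- measurable_fun _ (fun _ => ?c) => exact: measurable_cst
 | |- measurable_fun _ (fun x => x) => exact: measurable_id
 | |- measurable_fun _ (@fst _ _) => exact: measurable_fst
 | |- measurable_fun _ (@snd _ _) => exact: measurable_snd
 | |- measurable_fun _ (fun x => _ + _) => apply: measurable_funD
 | |- measurable_fun _ (fun x => - _) => apply: measurable_funN
 | |- measurable_fun _ (fun x => _ * _) => apply: measurable_funM
 | |- measurable_fun _ (fun x => _ ^+ _) => apply: measurable_funX
 | |- measurable_fun _ (fun x => expR _) => apply: (measurableT_comp (@measurable_expR _))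
 | |- measurable_fun _ (fun x => \sum_(_ <- _) _) => apply: measurable_sum => ?
 | |- measurable_fun _ (fun x => tnth _ _) => apply: measurable_tnth_comp
 | |- measurable_fun _ (fun x => (_ , _)) => apply: measurable_fun_pair
 | |- measurable_fun _ (fun x => fst _) => apply: measurable_fst_comp
 | |- measurable_fun _ (fun x => snd _) => apply: measurable_snd_comp
 | |- measurable_fun _ (fun x => mktuple _) => apply: measurable_mktuple => ?
 end.
Ltac solve_measurable := repeat measurable_step.

(** * Means of real random variables *)

Section mean.
Context d (T : measurableType d) (R : realType) (P : probability T R).
Implicit Types f g : T -> R.

(** Bundling measurability, integrability and the value lets means be combined
without side conditions. *)
Definition has_mean f (v : R) :=
  [/\ measurable_fun setT f, P.-integrable setT (EFin \o f)
    & (\int[P]_x (f x)%:E = v%:E)%E].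

(** The counterpart of [has_mean] for upper bounds; nonnegativity makes the bound
imply integrability. *)
Definition mean_le f (v : R) :=
  [/\ measurable_fun setT f, forall x, 0 <= f x
    & (\int[P]_x (f x)%:E <= v%:E)%E].

Lemma ge0_has_mean f v : measurable_fun setT f -> (forall x, 0 <= f x) ->
  (\int[P]_x (f x)%:E = v%:E)%E -> has_mean f v.
Proof.
move=> mf f0 fv; split => //; apply/integrableP; split.
  exact/measurable_EFinP.
rewrite (eq_integral (fun x => (f x)%:E)) ?fv ?ltry// => x _.
by rewrite /= ger0_norm.
Qed.

Lemma mean_le_has_mean f v : mean_le f v -> exists2 w, has_mean f w & w <= v.
Proof.
move=> [mf f0 fv]; exists (fine (\int[P]_x (f x)%:E)).
  apply: ge0_has_mean => //; rewrite fineK// fin_real// (le_lt_trans fv) ?ltry//.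
  by rewrite andbT (lt_le_trans (ltNyr 0))// integral_ge0// => x _; rewrite lee_fin.
rewrite -lee_fin fineK// fin_real// (le_lt_trans fv) ?ltry//.
by rewrite andbT (lt_le_trans (ltNyr 0))// integral_ge0// => x _; rewrite lee_fin.
Qed.

Lemma has_mean_le f v w : has_mean f v -> (forall x, 0 <= f x) -> v <= w ->
  mean_le f w.
Proof. by move=> [mf _ fv] f0 vw; split => //; rewrite fv lee_fin. Qed.

Lemma has_mean_cst c : has_mean (fun=> c) c.
Proof.
split => //; first exact: finite_measure_integrable_cst.
by rewrite integral_cst//= probability_setT mule1.
Qed.

Lemma has_meanD f g v w : has_mean f v -> has_mean g w ->
  has_mean (fun x => f x + g x) (v + w).
Proof.
move=> [mf fi fv] [mg gi gw]; split; first exact: measurable_funD.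
  by rewrite (_ : _ \o _ = (EFin \o f) \+ (EFin \o g))%E//; exact: integrableD.
by under eq_integral do rewrite EFinD; rewrite integralD_EFin// fv gw.
Qed.

Lemma has_meanZ f c v : has_mean f v -> has_mean (fun x => c * f x) (c * v).
Proof.
move=> [mf fi fv]; split; first exact: measurable_funM.
  rewrite (_ : _ \o _ = (fun x => c%:E * (EFin \o f) x)%E)//.
  exact: integrableZl.
by under eq_integral do rewrite EFinM; rewrite integralZl// fv.
Qed.

Lemma has_mean_mono f g v w : has_mean f v -> has_mean g w ->
  (forall x, f x <= g x) -> v <= w.
Proof.
move=> [mf fi fv] [mg gi gw] fg; rewrite -lee_fin -fv -gw.
by apply: le_integral => // x _; rewrite lee_fin.
Qed.

Lemma has_mean_dom f g v : measurable_fun setT f ->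
  (forall x, `|f x| <= g x) -> mean_le g v -> exists w, has_mean f w.
Proof.
move=> mf fg /mean_le_has_mean[w [mg gi gw] _].
have fi : P.-integrable setT (EFin \o f).
  apply: (le_integrable measurableT _ _ gi); first exact/measurable_EFinP.
  by move=> x _ /=; rewrite lee_fin (le_trans (fg x))// ler_norm.
exists (fine (\int[P]_x (f x)%:E)); split => //.
by rewrite fineK//; exact: integrable_fin_num.
Qed.

Lemma mean_leW f v w : mean_le f v -> v <= w -> mean_le f w.
Proof. by move=> [? ? h] vw; split => //; rewrite (le_trans h)// lee_fin. Qed.

Lemma mean_le_mono f g v : measurable_fun setT f -> (forall x, 0 <= f x) ->
  (forall x, f x <= g x) -> mean_le g v -> mean_le f v.
Proof.
move=> mf f0 fg [mg g0 gv]; split => //; apply: le_trans gv.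
apply: ge0_le_integral => //.
- by move=> x _; rewrite lee_fin.
- exact/measurable_EFinP.
- exact/measurable_EFinP.
- by move=> x _; rewrite lee_fin.
Qed.

Lemma mean_le_ge0 f v : mean_le f v -> 0 <= v.
Proof.
move=> [_ f0 fv]; rewrite -lee_fin (le_trans _ fv)// integral_ge0// => x _.
by rewrite lee_fin.
Qed.

Lemma mean_leD f g v w : mean_le f v -> mean_le g w ->
  mean_le (fun x => f x + g x) (v + w).
Proof.
move=> [mf f0 fv] [mg g0 gw]; split; first exact: measurable_funD.
  by move=> x; rewrite addr_ge0.
under eq_integral do rewrite EFinD.
rewrite ge0_integralD//= ?EFinD ?leeD//; try (by move=> x _; rewrite lee_fin);
exact/measurable_EFinP.
Qed.

Lemma mean_leZ f c v : 0 <= c -> mean_le f v -> mean_le (fun x => c * f x) (c * v).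
Proof.
move=> c0 [mf f0 fv]; split; first exact: measurable_funM.
  by move=> x; rewrite mulr_ge0.
under eq_integral do rewrite EFinM.
rewrite ge0_integralZl//=; last by move=> x _; rewrite lee_fin.
  by rewrite EFinM lee_wpmul2l ?lee_fin.
exact/measurable_EFinP.
Qed.

Lemma mean_le_cst c : 0 <= c -> mean_le (fun=> c) c.
Proof. by move=> c0; apply: (has_mean_le (has_mean_cst c)). Qed.

Lemma mean_le_sum (I : Type) (s : seq I) (f : I -> T -> R) (v : I -> R) :
  (forall i, mean_le (f i) (v i)) ->
  mean_le (fun x => \sum_(i <- s) f i x) (\sum_(i <- s) v i).
Proof.
move=> h; elim: s => [|i s IH].
  rewrite big_nil; under eq_fun do rewrite big_nil; exact: mean_le_cst.
by rewrite big_cons; under eq_fun do rewrite big_cons; exact: mean_leD.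
Qed.

Lemma has_mean_sum (I : Type) (s : seq I) (f : I -> T -> R) (v : I -> R) :
  (forall i, has_mean (f i) (v i)) ->
  has_mean (fun x => \sum_(i <- s) f i x) (\sum_(i <- s) v i).
Proof.
move=> h; elim: s => [|i s IH].
  rewrite big_nil; under eq_fun do rewrite big_nil; exact: has_mean_cst.
by rewrite big_cons; under eq_fun do rewrite big_cons; exact: has_meanD.
Qed.

End mean.

Section mean_product.
Context d1 d2 (T1 : measurableType d1) (T2 : measurableType d2) (R : realType).
Context (P : probability T1 R) (Q : probability T2 R).

Lemma has_mean_prod (F : T1 * T2 -> R) (g : T1 -> R) v :
  measurable_fun setT F -> (forall x, 0 <= F x) ->
  (forall x, has_mean Q (fun y => F (x, y)) (g x)) -> has_mean P g v ->
  has_mean (P \x Q)%E F v.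
Proof.
move=> mF F0 Fg [_ _ gv]; apply: ge0_has_mean => //.
rewrite fubini_tonelli1//=; last exact/measurable_EFinP.
by rewrite -gv; apply: eq_integral => x _; have [_ _] := Fg x.
Qed.

Lemma mean_le_prod (F : T1 * T2 -> R) (g : T1 -> R) v :
  measurable_fun setT F -> (forall x, 0 <= F x) ->
  (forall x, mean_le Q (fun y => F (x, y)) (g x)) -> mean_le P g v ->
  mean_le (P \x Q)%E F v.
Proof.
move=> mF F0 Fg [mg g0 gv]; split => //; apply: le_trans gv.
have mF' : measurable_fun setT (EFin \o F) by exact/measurable_EFinP.
rewrite (fubini_tonelli1 (EFin \o F))//=.
apply: ge0_le_integral => //.
- by move=> x _; apply: integral_ge0 => y _; rewrite lee_fin.
- exact: measurable_fun_fubini_tonelli_F.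
- exact/measurable_EFinP.
- by move=> x _; have [_ _] := Fg x.
Qed.

End mean_product.

Section mean3.
Context d1 d2 d3 (T1 : measurableType d1) (T2 : measurableType d2)
  (T3 : measurableType d3) (R : realType).
Context (P1 : probability T1 R) (P2 : probability T2 R) (P3 : probability T3 R).

Lemma has_mean_prod3 (F : T1 * (T2 * T3) -> R) g h v :
  measurable_fun setT F -> (forall x, 0 <= F x) ->
  (forall a b, has_mean P3 (fun c => F (a, (b, c))) (g a b)) ->
  (forall a, has_mean P2 (g a) (h a)) -> has_mean P1 h v ->
  has_mean (P1 \x (P2 \x P3))%E F v.
Proof.
move=> mF F0 Fg gh hv.
apply: (has_mean_prod (Q := (P2 \x P3)%E) mF F0 _ hv) => a.
apply: (has_mean_prod _ _ (Fg a) (gh a)) => [|y]; last exact: F0.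
by apply: (measurableT_comp mF); exact: measurable_pair1.
Qed.

Lemma mean_le_prod3 (F : T1 * (T2 * T3) -> R) g h v :
  measurable_fun setT F -> (forall x, 0 <= F x) ->
  (forall a b, mean_le P3 (fun c => F (a, (b, c))) (g a b)) ->
  (forall a, mean_le P2 (g a) (h a)) -> mean_le P1 h v ->
  mean_le (P1 \x (P2 \x P3))%E F v.
Proof.
move=> mF F0 Fg gh hv.
apply: (mean_le_prod (Q := (P2 \x P3)%E) mF F0 _ hv) => a.
apply: (mean_le_prod _ _ (Fg a) (gh a)) => [|y]; last exact: F0.
by apply: (measurableT_comp mF); exact: measurable_pair1.
Qed.

End mean3.

(** * Means over independent families *)

Section iid_mean.
Context d (T : measurableType d) (R : realType) (P : probability T R).

Lemma ge0_integral_iidS n (F : n.+1.-tuple T -> \bar R) :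
  measurable_fun setT F -> (forall t, 0 <= F t)%E ->
  (\int[iid P n.+1]_t F t = \int[P]_x \int[iid P n]_t F [tuple of x :: t])%E.
Proof.
move=> mF F0; rewrite /= ge0_integral_distribution// fubini_tonelli1//=.
by apply: measurableT_comp => //; exact: measurable_tuple_cons.
Qed.

Lemma ge0_integral_iid0 (F : 0.-tuple T -> \bar R) :
  measurable_fun setT F -> (\int[iid P 0]_t F t = F [tuple])%E.
Proof. by move=> mF; rewrite /= integral_dirac//= diracT mul1e. Qed.

Lemma has_mean_iidS n (F : n.+1.-tuple T -> R) g v :
  measurable_fun setT F -> (forall t, 0 <= F t) ->
  (forall x, has_mean (iid P n) (fun t => F [tuple of x :: t]) (g x)) ->
  has_mean P g v -> has_mean (iid P n.+1) F v.
Proof.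
move=> mF F0 Fg [_ _ gv]; apply: ge0_has_mean => //.
rewrite ge0_integral_iidS//; last exact/measurable_EFinP.
by rewrite -gv; apply: eq_integral => x _; have [_ _] := Fg x.
Qed.

Lemma mean_le_iidS n (F : n.+1.-tuple T -> R) g v :
  measurable_fun setT F -> (forall t, 0 <= F t) ->
  (forall x, mean_le (iid P n) (fun t => F [tuple of x :: t]) (g x)) ->
  mean_le P g v -> mean_le (iid P n.+1) F v.
Proof.
move=> mF F0 Fg [mg g0 gv]; split => //; apply: le_trans gv.
have mF' : measurable_fun setT (EFin \o F \o @tuple_cons _ T n).
  apply: measurableT_comp; last exact: measurable_tuple_cons.
  exact/measurable_EFinP.
rewrite ge0_integral_iidS//; last exact/measurable_EFinP.
apply: ge0_le_integral => //.
- by move=> x _; apply: integral_ge0 => y _; rewrite lee_fin.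
- apply: (measurable_fun_fubini_tonelli_F (EFin \o F \o @tuple_cons _ T n)) => //.
  by move=> x /=; rewrite lee_fin.
- exact/measurable_EFinP.
- by move=> x _; have [_ _] := Fg x.
Qed.

Lemma has_mean_tnth n (i : 'I_n) (f : T -> R) v : (forall x, 0 <= f x) ->
  has_mean P f v -> has_mean (iid P n) (fun t => f (tnth t i)) v.
Proof.
move=> f0 fv; have mf : measurable_fun setT f by case: fv.
elim: n i => [[]//|n IHn] i.
have mF : measurable_fun [set: n.+1.-tuple T] (fun t => f (tnth t i)).
  by apply: (measurableT_comp mf); exact: measurable_tnth.
case: (unliftP ord0 i) mF => [j|] -> mF.
- apply: (has_mean_iidS mF (fun=> f0 _) _ (has_mean_cst P v)) => x.
  by under eq_fun do rewrite tnthS.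
- apply: (has_mean_iidS mF (fun=> f0 _) _ fv) => x.
  by under eq_fun do rewrite tnth0; exact: has_mean_cst.
Qed.

End iid_mean.

Section iid_products.
Context d (T : measurableType d) (R : realType) (P : probability T R).

Lemma has_mean_iid_prod n (h : 'I_n -> T -> R) (v : 'I_n -> R) :
  (forall i x, 0 <= h i x) -> (forall i, has_mean P (h i) (v i)) ->
  has_mean (iid P n) (fun t => \prod_i h i (tnth t i)) (\prod_i v i).
Proof.
elim: n h v => [|n IHn] h v h0 hv.
  rewrite big_ord0; under eq_fun do rewrite big_ord0.
  exact: has_mean_cst.
have mF : measurable_fun [set: n.+1.-tuple T] (fun t => \prod_i h i (tnth t i)).
  apply: measurable_prod => i _.
  by have [mh _ _] := hv i; exact: (measurableT_comp mh (measurable_tnth i)).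
rewrite big_ord_recl mulrC.
apply: (has_mean_iidS (g := fun x => (\prod_i v (lift ord0 i)) * h ord0 x) mF).
- by move=> t; exact: prodr_ge0.
- move=> x; under eq_fun do rewrite big_ord_recl tnth0.
  rewrite mulrC; apply: has_meanZ.
  under eq_fun do under eq_bigr do rewrite tnthS.
  exact: (IHn (fun i => h (lift ord0 i)) (fun i => v (lift ord0 i))).
- exact: has_meanZ.
Qed.

(** Restricted to nonnegative f and g, as Tonelli's theorem is. *)
Lemma has_mean_tnth2 n (i j : 'I_n) (f g : T -> R) v w : i != j ->
  (forall x, 0 <= f x) -> (forall x, 0 <= g x) ->
  has_mean P f v -> has_mean P g w ->
  has_mean (iid P n) (fun t => f (tnth t i) * g (tnth t j)) (v * w).
Proof.
move=> ij f0 g0 fv gw.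
pose h (k : 'I_n) x := if k == i then f x else if k == j then g x else 1.
pose u (k : 'I_n) := if k == i then v else if k == j then w else 1.
have prodE (F : 'I_n -> R) (a b : R) :
    F =1 (fun k => if k == i then a else if k == j then b else 1) ->
    \prod_k F k = a * b.
  move=> FE; rewrite (bigD1 i)//= (bigD1 j) ?(eq_sym j)//= big1 => [|k /andP[ki kj]].
    by rewrite mulr1 !FE eqxx eq_sym (negbTE ij) eqxx.
  by rewrite FE (negbTE ki) (negbTE kj).
have h0 k x : 0 <= h k x by rewrite /h; case: ifP => // _; case: ifP.
have hu k : has_mean P (h k) (u k).
  by rewrite /h /u; case: ifP => // _; case: ifP => // _; exact: has_mean_cst.
have := has_mean_iid_prod h0 hu; rewrite (prodE u v w)//.
rewrite (_ : (fun t => _) = fun t => f (tnth t i) * g (tnth t j))//.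
apply/funext => t; apply: prodE => k; rewrite /h.
by case: eqP => [->//|_]; case: eqP => [->|].
Qed.

Lemma mean_le_tnth n (p : 'I_n) f v :
  mean_le P f v -> mean_le (iid P n) (fun t => f (tnth t p)) v.
Proof.
move=> fv; have f0 a : 0 <= f a by case: fv.
have [w fw wv] := mean_le_has_mean fv.
exact: (has_mean_le (has_mean_tnth p f0 fw) (fun t => f0 _) wv).
Qed.

Lemma mean_le_iid_prod n (h : 'I_n -> T -> R) (v : 'I_n -> R) :
  (forall i, mean_le P (h i) (v i)) ->
  mean_le (iid P n) (fun t => \prod_i h i (tnth t i)) (\prod_i v i).
Proof.
move=> hv; have h0 i x : 0 <= h i x by have [] := hv i.
have /choice[w hw] i : exists w, has_mean P (h i) w /\ w <= v i.
  by have [w ? ?] := mean_le_has_mean (hv i); exists w.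
apply: (has_mean_le (has_mean_iid_prod h0 (fun i => (hw i).1))).
  by move=> t; exact: prodr_ge0.
apply: ler_prod => i _; rewrite (hw i).2 andbT.
exact: (mean_le_ge0 (has_mean_le (hw i).1 (h0 i) (lexx _))).
Qed.

End iid_products.

Section centered.
Context d (T : measurableType d) (R : realType) (P : probability T R).

(** K is any constant that dominates the variance and the fourth moment strongly
enough for [mean_le_affine_4] to reproduce its own form. *)
Definition centered (f : T -> R) (V K : R) :=
  [/\ has_mean P f 0, has_mean P (fun x => f x ^+ 2) V
    & exists2 k, mean_le P (fun x => f x ^+ 4) k & (0 <= K /\ 4 * V <= K) /\ 3 * k <= K ^+ 2].

Lemma has_mean_sq_ge0 f V : has_mean P (fun x => f x ^+ 2) V -> 0 <= V.
Proof. by move=> /(has_mean_mono (has_mean_cst P 0)); apply => x; exact: sqr_ge0. Qed.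

Lemma has_mean_affine_sq f V c e : has_mean P f 0 ->
  has_mean P (fun x => f x ^+ 2) V ->
  has_mean P (fun x => (c * f x + e) ^+ 2) (c ^+ 2 * V + e ^+ 2).
Proof.
move=> f1 f2.
rewrite (_ : (fun x => _) = fun x => (c ^+ 2) * f x ^+ 2 + (((2 * c * e) * f x) + e ^+ 2)); last first.
  by apply/funext => x; ring.
have -> : c ^+ 2 * V + e ^+ 2 = c ^+ 2 * V + ((2 * c * e) * 0 + e ^+ 2) by ring.
apply: has_meanD; first exact: has_meanZ.
by apply: has_meanD; [exact: has_meanZ|exact: has_mean_cst].
Qed.

(** The right-hand side has the form of the integrand, with e^2 in place of the
random square and b increased by K c^2; adding independent terms one at a time
therefore stays within this form. The third moment of f is eliminated by adding
the nonnegative function 2 c^2 f^2 (c f - e)^2. *)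
Lemma mean_le_affine_4 f V K c e b : centered f V K -> 0 <= b ->
  mean_le P (fun x => ((c * f x + e) ^+ 2 + b) ^+ 2) ((e ^+ 2 + K * c ^+ 2 + b) ^+ 2).
Proof.
move=> [f1 f2 [k /mean_le_has_mean[k' f4 k'k] [[K0 VK] kK]]] b0.
have mf : measurable_fun setT f by case: f1.
have V0 := has_mean_sq_ge0 f2.
have h : has_mean P (fun x => (4 * e ^+ 3 * c + 4 * e * c * b) * f x +
     ((8 * c ^+ 2 * e ^+ 2 + 2 * b * c ^+ 2) * f x ^+ 2 + (3 * c ^+ 4 * f x ^+ 4 + (e ^+ 2 + b) ^+ 2)))
   ((4 * e ^+ 3 * c + 4 * e * c * b) * 0 +
     ((8 * c ^+ 2 * e ^+ 2 + 2 * b * c ^+ 2) * V + (3 * c ^+ 4 * k' + (e ^+ 2 + b) ^+ 2))).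
  by do ![apply: has_meanD | apply: has_meanZ | exact: has_mean_cst].
apply: (mean_le_mono _ _ _ (has_mean_le h _ _)).
- by solve_measurable.
- by move=> x; exact: sqr_ge0.
- move=> x.
  have : 0 <= 2 * c ^+ 2 * f x ^+ 2 * (c * f x - e) ^+ 2.
    by rewrite mulr_ge0 ?sqr_ge0// mulr_ge0 ?sqr_ge0// mulr_ge0 ?sqr_ge0.
  by move=> h0; rewrite -subr_ge0 (_ : _ - _ = 2 * c ^+ 2 * f x ^+ 2 * (c * f x - e) ^+ 2)//; ring.
- move=> x; have : 0 <= 2 * c ^+ 2 * f x ^+ 2 * (c * f x - e) ^+ 2.
    by rewrite mulr_ge0 ?sqr_ge0// mulr_ge0 ?sqr_ge0// mulr_ge0 ?sqr_ge0.
  have : 0 <= ((c * f x + e) ^+ 2 + b) ^+ 2 by exact: sqr_ge0.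
  move=> /addr_ge0 h1 /h1; congr (_ <= _); ring.
- rewrite mulr0 add0r.
  have c4 : 0 <= c ^+ 4 by rewrite exprn_even_ge0.
  have e2 := sqr_ge0 e; have c2 := sqr_ge0 c.
  have h1 : 8 * c ^+ 2 * e ^+ 2 * V <= 2 * K * (c ^+ 2 * e ^+ 2).
    have KV : 0 <= K - 4 * V by rewrite subr_ge0.
    have := mulr_ge0 (mulr_ge0 c2 e2) KV; lra.
  have h2 : 2 * b * c ^+ 2 * V <= 2 * b * c ^+ 2 * K.
    have KV : 0 <= K - V by rewrite subr_ge0; lra.
    have := mulr_ge0 (mulr_ge0 b0 c2) KV; lra.
  have h3 : 3 * c ^+ 4 * k' <= K ^+ 2 * c ^+ 4.
    have KV : 0 <= K ^+ 2 - 3 * k' by rewrite subr_ge0; lra.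
    have := mulr_ge0 c4 KV; lra.
  have -> : (e ^+ 2 + K * c ^+ 2 + b) ^+ 2 = 2 * K * (c ^+ 2 * e ^+ 2) +
     2 * b * c ^+ 2 * K + K ^+ 2 * c ^+ 4 + (e ^+ 2 + b) ^+ 2 by ring.
  lra.
Qed.

Lemma has_mean_iid_sq n (f : T -> R) V (c : 'I_n -> R) e :
  has_mean P f 0 -> has_mean P (fun x => f x ^+ 2) V ->
  has_mean (iid P n) (fun t => (\sum_i c i * f (tnth t i) + e) ^+ 2)
    ((\sum_i c i ^+ 2) * V + e ^+ 2).
Proof.
move=> f1 f2; have mf : measurable_fun setT f by case: f1.
elim: n c e => [|n IHn] c e.
  rewrite !big_ord0 mul0r add0r; under eq_fun do rewrite big_ord0 add0r.
  exact: has_mean_cst.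
have mF : measurable_fun [set: n.+1.-tuple T] (fun t => (\sum_i c i * f (tnth t i) + e) ^+ 2).
  apply: measurable_funX; apply: measurable_funD => //.
  apply: measurable_sum => i; apply: measurable_funM => //.
  by apply: (measurableT_comp mf); exact: measurable_tnth.
apply: (has_mean_iidS (g := fun x => (\sum_i c (lift ord0 i) ^+ 2) * V + (c ord0 * f x + e) ^+ 2) mF).
- by move=> t; exact: sqr_ge0.
- move=> x.
  rewrite (_ : (fun t => _) = fun t => (\sum_i c (lift ord0 i) * f (tnth t i) + (c ord0 * f x + e)) ^+ 2).
    exact: IHn.
  apply/funext => t; rewrite big_ord_recl tnth0 (addrC (c _ * _)) addrA.
  by under eq_bigr do rewrite tnthS.
- rewrite big_ord_recl.
  rewrite (_ : _ * V + _ = (\sum_(i < n) c (lift ord0 i) ^+ 2) * V +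
    (c ord0 ^+ 2 * V + e ^+ 2)); last by ring.
  by apply: has_meanD; [exact: has_mean_cst|exact: has_mean_affine_sq].
Qed.

(** The fourth moment of a linear form in independent centered variables is bounded
by the square of a bound for its second moment: every coordinate moves K c_i^2
into b. *)
Lemma mean_le_iid_4 n (f : T -> R) V K (c : 'I_n -> R) e b :
  centered f V K -> 0 <= b ->
  mean_le (iid P n) (fun t => ((\sum_i c i * f (tnth t i) + e) ^+ 2 + b) ^+ 2)
    ((e ^+ 2 + K * (\sum_i c i ^+ 2) + b) ^+ 2).
Proof.
move=> fVK; have mf : measurable_fun setT f by case: fVK => -[].
have K0 : 0 <= K by case: fVK => _ _ [? ? [[]]].
elim: n c e b => [|n IHn] c e b b0.
  rewrite !big_ord0 mulr0 addr0; under eq_fun do rewrite big_ord0 add0r.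
  by apply: mean_le_cst; exact: sqr_ge0.
have mF : measurable_fun [set: n.+1.-tuple T] (fun t => ((\sum_i c i * f (tnth t i) + e) ^+ 2 + b) ^+ 2).
  apply: measurable_funX; apply: measurable_funD => //; apply: measurable_funX; apply: measurable_funD => //.
  apply: measurable_sum => i; apply: measurable_funM => //.
  by apply: (measurableT_comp mf); exact: measurable_tnth.
apply: (mean_le_iidS (g := fun x => ((c ord0 * f x + e) ^+ 2 +
  (K * (\sum_i c (lift ord0 i) ^+ 2) + b)) ^+ 2) mF).
- by move=> t; exact: sqr_ge0.
- move=> x.
  rewrite (_ : (fun t => _) = fun t =>
      ((\sum_i c (lift ord0 i) * f (tnth t i) + (c ord0 * f x + e)) ^+ 2 + b) ^+ 2).
    by rewrite addrA; exact: IHn.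
  apply/funext => t; rewrite big_ord_recl tnth0 (addrC (c _ * _)) addrA.
  by under eq_bigr do rewrite tnthS.
- have B0 : 0 <= K * (\sum_i c (lift ord0 i) ^+ 2) + b.
    by rewrite addr_ge0// mulr_ge0// sumr_ge0// => i _; exact: sqr_ge0.
  rewrite big_ord_recl (_ : e ^+ 2 + _ + b = e ^+ 2 + K * c ord0 ^+ 2 +
    (K * (\sum_i c (lift ord0 i) ^+ 2) + b)); last by ring.
  exact: (mean_le_affine_4 _ _ fVK B0).
Qed.

End centered.

Section pow4.
Context d (T : measurableType d) (R : realType) (P : probability T R).

Lemma mean_le_affine_pow4 f V K c e : centered P f V K ->
  mean_le P (fun t => (c * f t + e) ^+ 4) ((e ^+ 2 + K * c ^+ 2) ^+ 2).
Proof.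
move=> fc; have h := mean_le_affine_4 c e fc (lexx 0).
rewrite [X in mean_le _ _ (X ^+ 2)]addr0 in h.
by under eq_fun do rewrite (exprM _ 2 2) -[_ ^+ 2 in X in X ^+ 2]addr0; exact: h.
Qed.

Lemma mean_le_iid_pow4 n f V K (c : 'I_n -> R) e : centered P f V K ->
  mean_le (iid P n) (fun t => (\sum_i c i * f (tnth t i) + e) ^+ 4)
    ((e ^+ 2 + K * (\sum_i c i ^+ 2)) ^+ 2).
Proof.
move=> fc; have h := mean_le_iid_4 c e fc (lexx 0).
rewrite [X in mean_le _ _ (X ^+ 2)]addr0 in h.
by under eq_fun do rewrite (exprM _ 2 2) -[_ ^+ 2 in X in X ^+ 2]addr0; exact: h.
Qed.

End pow4.

(** * Change of measure and image laws of independent families *)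

Section iid_map.
Context d d' (T : measurableType d) (T' : measurableType d') (R : realType).
Context (P : probability T R) (P' : probability T' R).

(** The image of P' under phi has density rho with respect to P. Nonnegative
functions suffice for this and avoid all integrability conditions. *)
Definition reweights (phi : T' -> T) (rho : T -> R) :=
  forall f : T -> \bar R, measurable_fun setT f -> (forall x, 0 <= f x)%E ->
  (\int[P']_x f (phi x) = \int[P]_x (f x * (rho x)%:E))%E.

(** Densities of independent coordinates multiply; as F need not be a product, the
coordinates are integrated out one after the other. *)
Lemma iid_reweights n (phi : 'I_n -> T' -> T) (rho : 'I_n -> T -> R) :
  (forall i, measurable_fun setT (phi i)) ->
  (forall i, measurable_fun setT (rho i)) -> (forall i x, 0 <= rho i x) ->
  (forall i, reweights (phi i) (rho i)) ->
  forall F : n.-tuple T -> \bar R, measurable_fun setT F -> (forall t, 0 <= F t)%E ->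
  (\int[iid P' n]_t F [tuple phi i (tnth t i) | i < n] =
   \int[iid P n]_t (F t * (\prod_i rho i (tnth t i))%:E))%E.
Proof.
have mprod k (g : 'I_k -> T -> R) : (forall i, measurable_fun setT (g i)) ->
    measurable_fun setT (fun t : k.-tuple T => \prod_i g i (tnth t i)).
  move=> mg; apply: measurable_prod => i _.
  exact: (measurableT_comp (mg i) (measurable_tnth i)).
elim: n phi rho => [|n IHn] phi rho mphi mrho rho0 H F mF F0.
  rewrite !ge0_integral_iid0.
  - by rewrite big_ord0 mule1; congr F; apply: eq_from_tnth => -[].
  - by apply: emeasurable_funM => //; apply/measurable_EFinP; exact: mprod.
  - by apply: (measurableT_comp mF); apply: measurable_mktuple => -[].
rewrite !ge0_integral_iidS//; last 3 first.
- by apply: emeasurable_funM => //; apply/measurable_EFinP; exact: mprod.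
- by move=> t; rewrite mule_ge0// lee_fin prodr_ge0.
- apply: (measurableT_comp mF); apply: measurable_mktuple => i.
  exact: (measurableT_comp (mphi i) (measurable_tnth i)).
have mFx x : measurable_fun setT (fun t : n.-tuple T => F [tuple of x :: t]).
  by apply: (measurableT_comp mF); exact: measurable_cons.
(* The integral over the tail, as a function of the head: the hypothesis on the
   first coordinate applies to it. *)
pose Phi x := (\int[iid P n]_t (F [tuple of x :: t] *
  (\prod_i rho (lift ord0 i) (tnth t i))%:E))%E.
have mG : measurable_fun setT (fun z : T * n.-tuple T =>
   F (tuple_cons z) * (\prod_i rho (lift ord0 i) (tnth z.2 i))%:E)%E.
  apply: emeasurable_funM.
    by apply: (measurableT_comp mF); exact: measurable_tuple_cons.
  apply/measurable_EFinP; exact: (measurableT_comp (mprod n _ (fun i => mrho (lift ord0 i))) measurable_snd).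
transitivity (\int[P']_x Phi (phi ord0 x))%E.
  apply: eq_integral => x _.
  transitivity (\int[iid P' n]_t F [tuple of phi ord0 x :: [tuple phi (lift ord0 i) (tnth t i) | i < n]])%E.
    apply: eq_integral => t _; congr F; apply: eq_from_tnth => i.
    rewrite tnth_mktuple; case: (unliftP ord0 i) => [j|] ->.
      by rewrite !tnthS tnth_mktuple.
    by rewrite !tnth0.
  by apply: (IHn (fun i => phi (lift ord0 i)) (fun i => rho (lift ord0 i)) _ _ _ _
    (fun t => F [tuple of phi ord0 x :: t])).
rewrite (H ord0 Phi).
- apply: eq_integral => x _; rewrite /Phi muleC -ge0_integralZl//=.
  + apply: eq_integral => t _; rewrite big_ord_recl tnth0 EFinM muleCA.
    by under [in RHS]eq_bigr do rewrite tnthS.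
  + apply: emeasurable_funM => //; apply/measurable_EFinP.
    exact: (mprod n _ (fun i => mrho (lift ord0 i))).
  + by move=> t _; rewrite mule_ge0// lee_fin prodr_ge0.
  + by rewrite lee_fin.
- apply: (measurable_fun_fubini_tonelli_F (fun z : T * n.-tuple T =>
   F (tuple_cons z) * (\prod_i rho (lift ord0 i) (tnth z.2 i))%:E)%E) => //.
  by move=> z; rewrite mule_ge0// lee_fin prodr_ge0.
- by move=> x; apply: integral_ge0 => t _; rewrite mule_ge0// lee_fin prodr_ge0.
Qed.

End iid_map.

Section iid_zip.
Context d d' (T : measurableType d) (T' : measurableType d') (R : realType).
Context (P : probability T R) (Q : probability T' R).

Definition ziptuple n (z : n.-tuple T * n.-tuple T') : n.-tuple (T * T') :=
  [tuple (tnth z.1 i, tnth z.2 i) | i < n].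

Lemma measurable_ziptuple n : measurable_fun setT (@ziptuple n).
Proof.
apply: measurable_mktuple => i; apply: measurable_fun_pair.
  exact: measurable_tnth_comp.
exact: measurable_tnth_comp.
Qed.

(** A pair of independent i.i.d. families is an i.i.d. family of pairs; this allows
one to reason sample by sample although the model draws all matrices, then all
signals, then all noises. *)
Lemma ge0_integral_ziptuple n (F : n.-tuple (T * T') -> \bar R) :
  measurable_fun setT F -> (forall t, 0 <= F t)%E ->
  (\int[iid P n \x iid Q n]_z F (ziptuple z) = \int[iid (P \x Q)%E n]_t F t)%E.
Proof.
elim: n F => [|n IHn] F mF F0.
  have mz : measurable_fun setT (F \o @ziptuple 0).
    by apply: (measurableT_comp mF); exact: measurable_ziptuple.
  rewrite fubini_tonelli1//= integral_dirac//; last first.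
    by apply: (measurable_fun_fubini_tonelli_F (F \o @ziptuple 0)) => // z; exact: F0.
  rewrite diracT mul1e /fubini_F !integral_dirac//; last first.
    by apply: (measurableT_comp mz); exact: measurable_pair1.
  by rewrite !diracT !mul1e; congr F; apply: eq_from_tnth => -[].
have mz : measurable_fun setT (F \o @ziptuple n.+1).
  by apply: (measurableT_comp mF); exact: measurable_ziptuple.
rewrite fubini_tonelli1//= ge0_integral_iidS//; last 2 first.
- by apply: (measurable_fun_fubini_tonelli_F (F \o @ziptuple n.+1)) => // z; exact: F0.
- by move=> t; apply: integral_ge0.
rewrite (ge0_integral_iidS _ mF F0).
rewrite fubini_tonelli1//=; last 2 first.
- apply: (measurable_fun_fubini_tonelli_F (F \o @tuple_cons _ _ n)) => [|z]; last exact: F0.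
  by apply: (measurableT_comp mF); exact: measurable_tuple_cons.
- by move=> x; apply: integral_ge0.
apply: eq_integral => x _; rewrite /fubini_F.
have consE y (t : n.-tuple T) (u : n.-tuple T') :
    ziptuple ([tuple of x :: t], [tuple of y :: u]) =
    [tuple of (x, y) :: ziptuple (t, u)] :> n.+1.-tuple _.
  apply: eq_from_tnth => i; rewrite tnth_mktuple.
  case: (unliftP ord0 i) => [j|] ->; first by rewrite !tnthS tnth_mktuple.
  by rewrite !tnth0.
pose h (z : (n.-tuple T * T') * n.-tuple T') : \bar R :=
  F [tuple of (x, z.1.2) :: ziptuple (z.1.1, z.2)].
have mh : measurable_fun setT h.
  apply: (measurableT_comp mF); apply: measurable_cons.
    apply: measurable_fun_pair => //.
    exact: (measurableT_comp measurable_snd measurable_fst).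
  apply: measurableT_comp; first exact: measurable_ziptuple.
  apply: measurable_fun_pair => //.
  exact: (measurableT_comp measurable_fst measurable_fst).
(* Move the integral over the head y of the second family past the tail t of the
   first one. *)
transitivity (\int[iid P n]_t \int[Q]_y \int[iid Q n]_u h ((t, y), u))%E.
  apply: eq_integral => t _; rewrite ge0_integral_iidS//.
    by apply: eq_integral => y _; apply: eq_integral => u _; rewrite consE.
  by apply: (measurableT_comp mz); exact: measurable_pair1.
pose g (z : n.-tuple T * T') : \bar R := (\int[iid Q n]_u h (z, u))%E.
have mg : measurable_fun setT g.
  by apply: (measurable_fun_fubini_tonelli_F h) => // z; exact: F0.
rewrite (fubini_tonelli g)//; last first.
  by move=> z; apply: integral_ge0 => u _; exact: F0.
apply: eq_integral => y _.
rewrite -IHn//; last first.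
  by apply: (measurableT_comp mF); exact: measurable_cons.
rewrite fubini_tonelli1//.
apply: (measurableT_comp mF); apply: measurable_cons => //.
exact: measurable_ziptuple.
Qed.

End iid_zip.

Section pushes.
Context d1 d2 (T1 : measurableType d1) (T2 : measurableType d2) (R : realType).

(** The image of P' under phi is P. *)
Definition pushes (P' : probability T2 R) (P : probability T1 R) (phi : T2 -> T1) :=
  forall f : T1 -> \bar R, measurable_fun setT f -> (forall x, 0 <= f x)%E ->
  (\int[P']_x f (phi x) = \int[P]_x f x)%E.

End pushes.

Section iid_pushes.
Context d d1 d2 (T : measurableType d) (T1 : measurableType d1)
  (T2 : measurableType d2) (R : realType).
Context (P : probability T R) (Q1 : probability T1 R) (Q2 : probability T2 R).

Lemma pushes_fst (P1 : probability T1 R) : pushes (P1 \x Q2)%E P1 fst.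
Proof.
move=> f mf f0; rewrite fubini_tonelli1//=; last exact: measurableT_comp.
apply: eq_integral => x _; rewrite /fubini_F/=.
by rewrite integral_cst//= probability_setT mule1.
Qed.

Lemma pushes_snd (P2 : probability T2 R) : pushes (Q1 \x P2)%E P2 snd.
Proof.
move=> f mf f0; rewrite fubini_tonelli1//=; last exact: measurableT_comp.
by rewrite /fubini_F/= integral_cst//= probability_setT mule1.
Qed.

(** The case of constant density 1 in [iid_reweights]. *)
Lemma iid_pushes n (phi : 'I_n -> T1 * T2 -> T) :
  (forall j, measurable_fun setT (phi j)) -> (forall j, pushes (Q1 \x Q2)%E P (phi j)) ->
  pushes (iid Q1 n \x iid Q2 n)%E (iid P n)
    (fun z => [tuple phi j (tnth z.1 j, tnth z.2 j) | j < n]).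
Proof.
move=> mphi H F mF F0.
have mFp : measurable_fun setT
    (fun t : n.-tuple (T1 * T2) => F [tuple phi i (tnth t i) | i < n]).
  apply: (measurableT_comp mF); apply: measurable_mktuple => i.
  exact: (measurableT_comp (mphi i) (measurable_tnth i)).
rewrite -[RHS](_ : \int[iid P n]_t (F t * (\prod_(i < n) 1)%:E) = _)%E; last first.
  by apply: eq_integral => t _; rewrite big1// mule1.
rewrite -(@iid_reweights _ _ _ _ _ P (Q1 \x Q2)%E n phi (fun _ _ => 1))//; last first.
  by move=> i f mf f0; rewrite (H i f mf f0); apply: eq_integral => x _; rewrite mule1.
rewrite -(@ge0_integral_ziptuple _ _ _ _ _ Q1 Q2 n _ mFp)//.
apply: eq_integral => z _; congr F; apply: eq_from_tnth => i.
by rewrite !tnth_mktuple.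
Qed.

Lemma mean_le_prod_snd (F : T1 * T2 -> R) c : measurable_fun setT F ->
  (forall z, 0 <= F z) -> (forall y, mean_le Q1 (fun x => F (x, y)) c) ->
  mean_le (Q1 \x Q2)%E F c.
Proof.
move=> mF F0 Fc; split => //.
have mF' : measurable_fun setT (EFin \o F) by exact/measurable_EFinP.
rewrite (fubini_tonelli2 (EFin \o F))//=.
have -> : c%:E = (\int[Q2]_y (fun=> c%:E) y)%E.
  by rewrite integral_cst//= probability_setT mule1.
have c0 : 0 <= c.
  by apply: (mean_le_ge0 (Fc point)).
apply: ge0_le_integral => //.
- by move=> y _; apply: integral_ge0 => x _; rewrite lee_fin.
- exact: measurable_fun_fubini_tonelli_G.
- by move=> y _; have [_ _] := Fc y.
Qed.

(** Sampling P from a pair lets one condition on the first component: a bound that is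
uniform in it is a bound for P. *)
Lemma mean_le_pushes phi (F : T -> R) c : measurable_fun setT phi ->
  measurable_fun setT F ->
  (forall t, 0 <= F t) -> pushes (Q1 \x Q2)%E P phi ->
  (forall x, mean_le Q2 (fun y => F (phi (x, y))) c) -> mean_le P F c.
Proof.
move=> mphi mF F0 H Fc; split => //.
have mF' : measurable_fun setT (EFin \o F) by exact/measurable_EFinP.
rewrite -(H (EFin \o F) mF'); last by move=> t; rewrite lee_fin.
have c0 : 0 <= c by apply: (mean_le_ge0 (Fc point)).
have [] // := @mean_le_prod _ _ _ _ _ Q1 Q2 (F \o phi) (fun=> c) c _ _ Fc _.
- exact: measurableT_comp.
- by move=> z; exact: F0.
- exact: mean_le_cst.
Qed.

End iid_pushes.

(** * Gaussian integrals *)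

Section lebesgue_scale.
Variable R : realType.
Local Notation mu := (@lebesgue_measure R).

Section scaled_measure.
Variables (c : R) (c0 : 0 < c).

Let scale (x : measurableTypeR R) : measurableTypeR R := c * x.

Let measurable_scale : measurable_fun setT scale.
Proof. exact: measurable_funM. Qed.

Let push : {measure set (measurableTypeR R) -> \bar R} :=
  measure_function_pushforward__canonical__measure_function_Measure mu measurable_scale.

Let scaled : {measure set (measurableTypeR R) -> \bar R} :=
  mscale (NngNum (ltW c0)) push.

(** The measure A |-> c mu (A / c) gives every interval its length, so it is the
Lebesgue measure. *)
Lemma lebesgue_measure_scale (A : set R) : measurable A ->
  (c%:E * mu ((fun x => c * x)%R @^-1` A) = mu A)%E.
Proof.
move=> mA; apply/esym; rewrite -[RHS]/(scaled A).
apply: lebesgue_measure_unique => //= _ [[a b]] _ <-.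
rewrite /scaled /mscale/= /pushforward.
have -> : scale @^-1` [set` `]a, b]] = [set` `]a / c, b / c]].
  apply/seteqP; split => x /=; rewrite /scale !in_itv/= ltr_pdivrMr// ler_pdivlMr//;
  by rewrite mulrC.
rewrite !lebesgue_measure_itv/= !lte_fin ltr_pM2r ?invr_gt0//.
case: ifP => _; last by rewrite mule0.
by rewrite -!EFinB -EFinM mulrBr !(mulrC c) !divfK ?gt_eqF.
Qed.

Lemma ge0_integral_scale (f : R -> \bar R) :
  measurable_fun setT f -> (forall x, 0 <= f x)%E ->
  (\int[mu]_x f x = c%:E * \int[mu]_x f (c * x)%R)%E.
Proof.
move=> mf f0; transitivity (\int[scaled]_x f x)%E.
  by apply: eq_measure_integral => A mA _; exact/esym/lebesgue_measure_scale.
rewrite ge0_integral_mscale//=; congr (_ * _)%E.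
by rewrite ge0_integral_pushforward.
Qed.

End scaled_measure.

End lebesgue_scale.

Section gaussian_integral.
Variable R : realType.
Local Notation mu := (@lebesgue_measure R).
Local Open Scope ereal_scope.

Import Radon_Nikodym_SigmaFinite.

(** The Radon-Nikodym derivative of the normal law and its explicit density have the
same integral over every measurable set, hence agree almost everywhere. *)
Lemma ge0_integral_normal_prob (m s : R) (f : R -> \bar R) :
  measurable_fun setT f -> (forall x, 0 <= f x) ->
  \int[normal_prob m s]_x f x = \int[mu]_x (f x * (normal_pdf m s x)%:E).
Proof.
move=> mf f0.
have dom := normal_prob_dominates m s.
rewrite -(change_of_variables dom)//.
apply: ae_eq_integral => //.
- apply: emeasurable_funM => //; exact: (measurable_int mu (f_integrable _)).
- by apply: emeasurable_funM => //; apply/measurable_EFinP; exact: measurable_normal_pdf.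
- apply: ae_eqe_mul2l => /=; apply: integral_ae_eq => //=.
  + exact: f_integrable.
  + by apply/measurable_EFinP; exact: measurable_normal_pdf.
  + by move=> E _ mE; rewrite -f_integral.
Qed.

Lemma ge0_integral_normal_law (s : R) (f : R -> \bar R) : s != 0%R ->
  measurable_fun setT f -> (forall x, 0 <= f x) ->
  \int[normal_law 0 s]_x f x = \int[mu]_x (f x * (normal_pdf 0 s x)%:E).
Proof.
move=> s0 mf f0; rewrite /normal_law (negbTE s0).
rewrite ge0_integral_distribution//=.
exact: (@ge0_integral_normal_prob 0 s f).
Qed.

End gaussian_integral.

Section gaussian.
Variable R : realType.
Implicit Types (s r c x : R).
Local Notation gamma := (@normal_law R 0 1).

Lemma normal_peakE s : 0 < s -> normal_peak s = s^-1 * normal_peak 1.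
Proof.
move=> s0; rewrite /normal_peak expr1n mul1r -mulrnAr sqrtrM ?sqr_ge0//.
by rewrite sqrtr_sqr (gtr0_norm s0) invfM.
Qed.

Lemma normal_pdf_scale s x : 0 < s ->
  s * normal_pdf 0 s (s * x) = normal_pdf 0 1 x.
Proof.
move=> s0; rewrite (normal_pdfE _ (lt0r_neq0 s0)) (normal_pdfE _ (oner_neq0 R)).
rewrite (normal_peakE s0) /normal_fun !mulrA (divff (lt0r_neq0 s0)) mul1r.
have -> : - (s * x - 0) ^+ 2 / (s ^+ 2 *+ 2) = - (x - 0) ^+ 2 / (1 ^+ 2 *+ 2).
  by rewrite !subr0 exprMn expr1n !mulr2n; field; rewrite gt_eqF// addr_gt0// exprn_gt0.
by [].
Qed.

(** For s = 0 both sides are f 0, so noiseless observations need no separate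
treatment. *)
Lemma ge0_integral_normal_scale s (f : R -> \bar R) : 0 <= s ->
  measurable_fun setT f -> (forall x, 0 <= f x)%E ->
  (\int[normal_law 0 s]_x f x = \int[gamma]_x f (s * x)%R)%E.
Proof.
rewrite le_eqVlt => /predU1P[<-|s0] mf f0.
  rewrite {1}/normal_law eqxx integral_dirac//= diracT mul1e.
  under [RHS]eq_integral do rewrite mul0r.
  by rewrite integral_cst//= probability_setT mule1.
have mfs : measurable_fun setT (fun x => f (s * x)%R).
  by apply: (measurableT_comp mf); exact: measurable_funM.
rewrite [LHS](ge0_integral_normal_law (lt0r_neq0 s0) mf f0).
rewrite [RHS](ge0_integral_normal_law (oner_neq0 R) mfs (fun x => f0 _)).
rewrite (ge0_integral_scale s0)//=; last 2 first.
- by apply: emeasurable_funM => //; apply/measurable_EFinP; exact: measurable_normal_pdf.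
- by move=> x; rewrite mule_ge0// lee_fin normal_pdf_ge0.
rewrite -ge0_integralZl//=; first last.
- by rewrite lee_fin ltW.
- by move=> x _; rewrite mule_ge0// lee_fin normal_pdf_ge0.
- apply: emeasurable_funM => //; apply/measurable_EFinP.
  by apply: (measurableT_comp (measurable_normal_pdf _ _)); exact: measurable_funM.
by apply: eq_integral => x _; rewrite muleCA -EFinM normal_pdf_scale.
Qed.

(** The likelihood ratio of N(0, r^-2) with respect to N(0, 1). *)
Definition gauss_ratio r x : R := r * expR (- (x ^+ 2 / 2) * (r ^+ 2 - 1)).

Lemma measurable_gauss_ratio r : measurable_fun setT (gauss_ratio r).
Proof.
apply: measurable_funM => //; apply: measurableT_comp => //.
apply: measurable_funM => //; apply: measurableT_comp => //.
exact: measurable_funM.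
Qed.

Lemma gauss_reweights r : 0 < r ->
  reweights gamma gamma (fun x => x / r) (gauss_ratio r).
Proof.
move=> r0 f mf f0.
have ri : 0 < r^-1 by rewrite invr_gt0.
have mr := measurable_gauss_ratio r.
transitivity (\int[normal_law 0 r^-1]_x f x)%E.
  rewrite [RHS](ge0_integral_normal_scale (ltW ri) mf f0).
  by apply: eq_integral => x _; rewrite mulrC.
rewrite [LHS](ge0_integral_normal_law (lt0r_neq0 ri) mf f0).
rewrite (@ge0_integral_normal_law _ 1 (fun x => f x * (gauss_ratio r x)%:E)%E (oner_neq0 R)); last 2 first.
- by apply: emeasurable_funM => //; apply/measurable_EFinP.
- by move=> x; rewrite mule_ge0// lee_fin mulr_ge0 ?expR_ge0// ltW.
apply: eq_integral => x _; rewrite -muleA -EFinM; congr (_ * _%:E)%E.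
rewrite (normal_pdfE _ (lt0r_neq0 ri)) (normal_pdfE _ (oner_neq0 R)).
rewrite (normal_peakE ri) invrK /gauss_ratio /normal_fun.
rewrite -!mulrA; congr (r * _); rewrite [RHS]mulrCA; congr (normal_peak 1 * _).
rewrite -expRD; congr expR; rewrite !subr0 expr1n !mulr2n; field.
by rewrite gt_eqF// addr_gt0// exprn_gt0.
Qed.

Lemma has_mean_gauss_ratio r : 0 < r -> has_mean gamma (gauss_ratio r) 1.
Proof.
move=> r0; apply: ge0_has_mean => [||].
- exact: measurable_gauss_ratio.
- by move=> x; rewrite mulr_ge0 ?expR_ge0// ltW.
have := gauss_reweights r0 (f := fun=> 1%E) (measurable_cst _) (fun=> lee01).
under [in X in _ = X]eq_integral do rewrite mul1e.
by move=> <-; rewrite integral_cst//= probability_setT mule1.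
Qed.

(** Up to a factor, exp(lam x^2) is the likelihood ratio [gauss_ratio] for
r^2 = 1 - 2 lam, whose mean is 1. *)
Lemma has_mean_exp_sq lam : lam < 2^-1 ->
  has_mean gamma (fun x => expR (lam * x ^+ 2)) (Num.sqrt (1 - 2 * lam))^-1.
Proof.
move=> lam2; set r := Num.sqrt _.
have l0 : 0 < 1 - 2 * lam by lra.
have r0 : 0 < r by rewrite sqrtr_gt0.
have -> : (fun x => expR (lam * x ^+ 2)) = (fun x => r^-1 * gauss_ratio r x).
  apply/funext => x; rewrite /gauss_ratio [RHS]mulrA mulVf ?gt_eqF// mul1r; congr expR.
  by rewrite sqr_sqrtr ?ltW//; field.
by rewrite -[X in has_mean _ _ X]mulr1; apply: has_meanZ; exact: has_mean_gauss_ratio.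
Qed.

(** Completing the square: exp(c x) times the density of N(0, 1) is exp(c^2 / 2)
times the density of N(c, 1). *)
Lemma has_mean_exp_lin c : has_mean gamma (fun x => expR (c * x)) (expR (c ^+ 2 / 2)).
Proof.
have mc : measurable_fun setT (fun x => expR (c * x)).
  by apply: measurableT_comp => //; exact: measurable_funM.
apply: ge0_has_mean => //.
rewrite (@ge0_integral_normal_law _ 1 (fun x => (expR (c * x))%:E) (oner_neq0 R)).
transitivity (\int[lebesgue_measure]_x ((expR (c ^+ 2 / 2))%:E * (normal_pdf c 1 x)%:E))%E.
  apply: eq_integral => x _; rewrite -!EFinM; congr EFin.
  rewrite !normal_pdfE ?oner_eq0//= mulrCA [RHS]mulrCA; congr (_ * _).
  by rewrite /normal_fun -!expRD; congr expR; rewrite !expr1n !subr0 !mulr2n; field.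
rewrite ge0_integralZl.
- by rewrite integral_normal_pdf mule1.
- exact: measurableT.
- by apply/measurable_EFinP; exact: measurable_normal_pdf.
- by move=> x _; rewrite lee_fin normal_pdf_ge0.
- by rewrite lee_fin expR_ge0.
- exact/measurable_EFinP.
- by move=> x; rewrite lee_fin expR_ge0.
Qed.

End gaussian.

(** * Gaussian moments *)

Section gaussian_moments.
Variable R : realType.
Implicit Types (s r c x : R).
Local Notation gamma := (@normal_law R 0 1).

(** Identifies means from exponential moments: exp(u) >= 1 + u bounds
1 + l E f by an explicit function of l, and small l of both signs determine
E f. *)
Lemma eq0_of_quadratic_bound (a C del : R) : 0 < del -> 0 <= C ->
  (forall l, `|l| <= del -> l * a <= C * l ^+ 2) -> a = 0.
Proof.
move=> del0 C0 H.
have aux b : (forall l, 0 <= l <= del -> l * b <= C * l ^+ 2) -> b <= 0.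
  move=> Hb; rewrite leNgt; apply/negP => b0.
  pose l := Num.min del (b / (2 * (C + 1))).
  have l0 : 0 < l by rewrite lt_min del0/= divr_gt0//; lra.
  have : l * b <= C * l ^+ 2 by apply: Hb; rewrite (ltW l0)/= ge_min lexx.
  rewrite expr2 mulrCA ler_pM2l// => bCl.
  have lb : l <= b / (2 * (C + 1)) by rewrite ge_min lexx orbT.
  have : C * l <= C * (b / (2 * (C + 1))) by rewrite ler_wpM2l.
  have -> : C * (b / (2 * (C + 1))) = b * (C / (2 * (C + 1))) by ring.
  have : b * (C / (2 * (C + 1))) <= b * 2^-1.
    by rewrite ler_wpM2l ?(ltW b0)// ler_pdivrMr; lra.
  lra.
apply/eqP; rewrite eq_le; apply/andP; split.
  by apply: aux => l /andP[l0 l1]; apply: H; rewrite ger0_norm.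
rewrite -oppr_le0; apply: aux => l /andP[l0 l1].
by rewrite mulrN -mulNr -sqrrN; apply: H; rewrite normrN ger0_norm.
Qed.

(** The inequality u <= exp(u) at u = x^2 / 16, raised to the fourth power; the
exponent 4 u = x^2 / 4 is small enough for a finite Gaussian mean. *)
Lemma pow8_le_exp x : x ^+ 8 <= 256 ^+ 2 * expR (4^-1 * x ^+ 2).
Proof.
have := expR_ge1Dx (16^-1 * x ^+ 2); set u := _ * _ => hu.
have u0 : 0 <= u by rewrite mulr_ge0// sqr_ge0.
have -> : 4^-1 * x ^+ 2 = 4%:R * u by rewrite /u; field.
rewrite expRM_natl.
have : u ^+ 4 <= expR u ^+ 4 by rewrite lerXn2r ?nnegrE ?expR_ge0//; lra.
have -> : x ^+ 8 = 256 ^+ 2 * u ^+ 4 by rewrite /u; field.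
lra.
Qed.

Lemma gauss_moment8 : exists k, mean_le gamma (fun x => x ^+ 8) k.
Proof.
eexists; apply: (mean_le_mono _ _ pow8_le_exp).
- exact: measurable_funX.
- by move=> x; rewrite exprn_even_ge0.
apply: mean_leZ; first exact: sqr_ge0.
have l4 : 4^-1 < 2^-1 :> R by lra.
by apply: (has_mean_le (has_mean_exp_sq l4) _ (lexx _)) => x; exact: expR_ge0.
Qed.

Lemma pow4_le_pow8 x : x ^+ 4 <= 1 + x ^+ 8.
Proof.
have := sqr_ge0 (x ^+ 4 - 1); rewrite (_ : _ ^+ 2 = x ^+ 8 - 2 * x ^+ 4 + 1); last by ring.
have : 0 <= x ^+ 4 by rewrite exprn_even_ge0.
have : 0 <= x ^+ 8 by rewrite exprn_even_ge0.
lra.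
Qed.

Lemma gauss_moment4 : exists k, has_mean gamma (fun x => x ^+ 4) k.
Proof.
have [k k8] := gauss_moment8.
have : mean_le gamma (fun x => x ^+ 4) (1 + k).
  apply: (mean_le_mono _ _ pow4_le_pow8).
  - exact: measurable_funX.
  - by move=> x; rewrite exprn_even_ge0.
  by apply: mean_leD => //; exact: mean_le_cst.
by move=> /mean_le_has_mean[w ? _]; exists w.
Qed.

Lemma sqrtr_inv_le (l : R) : `|l| <= 4^-1 ->
  (Num.sqrt (1 - 2 * l))^-1 <= 1 + l + 6 * l ^+ 2.
Proof.
rewrite ler_norml => /andP[l1 l2].
have p0 : 0 < 1 + l + 6 * l ^+ 2 by nra.
have q0 : 0 < 1 - 2 * l by lra.
rewrite -[leRHS]invrK lef_pV2 ?posrE ?invr_gt0 ?sqrtr_gt0//.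
rewrite -[leLHS](ger0_norm (ltW _)) ?invr_gt0// -sqrtr_sqr (ler_sqrt _ (ltW q0)).
rewrite exprVn invf_ple ?posrE ?exprn_gt0// -[_^-1]mul1r ler_pdivrMr//.
suff : 0 <= l ^+ 2 * (9 - 14 * l + 12 * l ^+ 2 - 72 * l ^+ 3).
  rewrite -subr_ge0 => h0; rewrite -subr_ge0; move: h0; congr (_ <= _); ring.
rewrite mulr_ge0 ?sqr_ge0//.
have : l ^+ 3 <= 4^-1 * l ^+ 2 by rewrite exprS ler_wpM2r ?sqr_ge0.
nra.
Qed.

Lemma gauss_sq1 : has_mean gamma (fun x => x ^+ 2) 1.
Proof.
have [k k4] := gauss_moment4.
have mx2 : measurable_fun setT (fun x : R => x ^+ 2) by exact: measurable_funX.
have [w xw] : exists w, has_mean gamma (fun x => x ^+ 2) w.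
  apply: (@has_mean_dom _ _ _ _ _ (fun x => 1 + x ^+ 4) (1 + k)) => // [x|].
    rewrite ger0_norm ?sqr_ge0//; have := sqr_ge0 (x ^+ 2 - 1).
    rewrite (_ : (x ^+ 2 - 1) ^+ 2 = x ^+ 4 - 2 * x ^+ 2 + 1); last by ring.
    have := sqr_ge0 x; have : 0 <= x ^+ 4 by rewrite exprn_even_ge0.
    lra.
  apply: (has_mean_le (has_meanD (has_mean_cst _ _) k4)) => // x.
  by rewrite addr_ge0// exprn_even_ge0.
(* 1 + l w <= E exp(l x^2) = (1 - 2 l)^(-1/2) <= 1 + l + 6 l^2 for small l of
   either sign. *)
suff w1 : w - 1 = 0 by have w2 : w = 1; [lra | rewrite w2 in xw].
apply: (@eq0_of_quadratic_bound _ 6 4^-1) => // l l4.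
have l2 : l < 2^-1 by move: l4; rewrite ler_norml; lra.
have /has_mean_mono : has_mean gamma (fun x => 1 + l * x ^+ 2) (1 + l * w).
  by apply: has_meanD; [exact: has_mean_cst|exact: has_meanZ].
move=> /(_ _ _ (has_mean_exp_sq l2)) h.
have {}h := h (fun x => expR_ge1Dx _).
have := sqrtr_inv_le l4; lra.
Qed.

Lemma normal_law_exp s c : 0 <= s ->
  has_mean (normal_law 0 s) (fun x => expR (c * x)) (expR ((c * s) ^+ 2 / 2)).
Proof.
move=> s0; apply: ge0_has_mean => [|x|].
- by apply: measurableT_comp => //; exact: measurable_funM.
- exact: expR_ge0.
rewrite (ge0_integral_normal_scale (f := fun x => (expR (c * x))%:E))//=.
- by have [_ _ <-] := has_mean_exp_lin (c * s); under eq_integral do rewrite mulrA.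
- by apply/measurable_EFinP; apply: measurableT_comp => //; exact: measurable_funM.
Qed.

Lemma normal_law_scaled s (f : R -> R) v : 0 <= s -> (forall x, 0 <= f x) ->
  measurable_fun setT f ->
  has_mean gamma (fun x => f (s * x)) v -> has_mean (normal_law 0 s) f v.
Proof.
move=> s0 f0 mf [_ _ fv]; apply: (ge0_has_mean mf f0).
rewrite (ge0_integral_normal_scale (f := EFin \o f) s0).
- exact: fv.
- exact/measurable_EFinP.
- by move=> x; rewrite lee_fin.
Qed.

Lemma normal_law_sq s : 0 <= s -> has_mean (normal_law 0 s) (fun x => x ^+ 2) (s ^+ 2).
Proof.
move=> s0; apply: normal_law_scaled => // [x|]; first exact: sqr_ge0.
under eq_fun do rewrite exprMn.
by rewrite -[X in has_mean _ _ X]mulr1; apply: has_meanZ; exact: gauss_sq1.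
Qed.

Lemma normal_law_mean0 s : 0 <= s -> has_mean (normal_law 0 s) id 0.
Proof.
move=> s0.
have [w xw] : exists w, has_mean (normal_law 0 s) id w.
  apply: (@has_mean_dom _ _ _ _ _ (fun x => 1 + x ^+ 2) (1 + s ^+ 2)) => // [x|].
    rewrite ler_norml; have := sqr_ge0 (x - 1); have := sqr_ge0 (x + 1); nra.
  apply: (has_mean_le (has_meanD (has_mean_cst _ _) (normal_law_sq s0))) => // x.
  by rewrite addr_ge0// sqr_ge0.
(* 1 + l w <= E exp(l x) = exp((l s)^2 / 2) <= 1 + (l s)^2 for small l of either
   sign. *)
suff w0 : w = 0 by rewrite w0 in xw.
have s1 : 0 < (1 + s)^-1 by rewrite invr_gt0; lra.
apply: (@eq0_of_quadratic_bound _ (s ^+ 2) (1 + s)^-1) => // [|l ls].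
  exact: sqr_ge0.
have /has_mean_mono : has_mean (normal_law 0 s) (fun x => 1 + l * x) (1 + l * w).
  by apply: has_meanD; [exact: has_mean_cst|exact: has_meanZ].
move=> /(_ _ _ (normal_law_exp l s0)) h.
have {h} := h (fun x => expR_ge1Dx _).
have ls1 : (l * s) ^+ 2 <= 1.
  rewrite -real_normK ?num_real// expr_le1// normrM (ger0_norm s0).
  have : `|l| * s <= (1 + s)^-1 * s by rewrite ler_wpM2r.
  move=> /le_trans; apply; rewrite mulrC ler_pdivrMr; lra.
have l0 := sqr_ge0 (l * s).
set u := (l * s) ^+ 2 / 2.
have u0 : 0 <= u by rewrite /u; lra.
have u1 : u <= 2^-1 by rewrite /u; lra.
have : expR u <= 1 + 2 * u.
  have := expR_ge1Dx (- u); rewrite expRN => h.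
  rewrite -[leLHS]invrK invf_ple ?posrE ?invr_gt0 ?expR_gt0//; last lra.
  apply: le_trans h; rewrite -[_^-1]mul1r ler_pdivrMr; nra.
rewrite (_ : s ^+ 2 * _ = 2 * u); last by rewrite /u; field.
lra.
Qed.

Lemma centered_normal : exists2 K, 0 <= K & forall s, 0 <= s ->
  centered (normal_law 0 s) id (s ^+ 2) (K * s ^+ 2).
Proof.
have [k k4] := gauss_moment4.
have k0 : 0 <= k by apply: (has_mean_mono (has_mean_cst _ _) k4) => x; rewrite exprn_even_ge0.
exists (4 + 3 * k) => [|s s0]; first lra.
split; first exact: normal_law_mean0.
  exact: normal_law_sq.
exists (s ^+ 4 * k).
  apply: (has_mean_le _ _ (lexx _)) => [|x]; last by rewrite exprn_even_ge0.
  apply: normal_law_scaled => // [x|]; first by rewrite exprn_even_ge0.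
  by under eq_fun do rewrite exprMn; exact: has_meanZ.
have s2 := sqr_ge0 s.
split; first by split; [rewrite mulr_ge0//; lra|rewrite ler_wpM2r//; lra].
rewrite exprMn -exprM mulrCA [leRHS]mulrC ler_wpM2l//; first by rewrite exprn_even_ge0.
nra.
Qed.

(** Writing E g^4 = V + 1 makes V the variance of g^2, through which the fourth
moment enters the mean of the statistic of a Gaussian sample. *)
Lemma centered_gauss_sq : exists V K,
  has_mean gamma (fun x => x ^+ 4) (V + 1) /\ centered gamma (fun x => x ^+ 2 - 1) V K.
Proof.
have [k k4] := gauss_moment4; have [k8' k8] := gauss_moment8.
have m0 : has_mean gamma (fun x => x ^+ 2 - 1) 0.
  by rewrite -[X in has_mean _ _ X](subrr 1); apply: has_meanD; [exact: gauss_sq1|exact: has_mean_cst].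
have m2 : has_mean gamma (fun x => (x ^+ 2 - 1) ^+ 2) (k - 1).
  rewrite (_ : (fun x => _) = (fun x : R => x ^+ 4 + ((-2) * x ^+ 2 + 1))); last first.
    by apply/funext => x; ring.
  rewrite (_ : k - 1 = k + ((-2) * 1 + 1)); last by ring.
  apply: has_meanD => //; apply: has_meanD; last exact: has_mean_cst.
  by apply: has_meanZ; exact: gauss_sq1.
have k1 := has_mean_sq_ge0 m2.
have k80 := mean_le_ge0 k8.
exists (k - 1), (4 * (k - 1) + 3 * (8 * (k8' + 1)) + 1); split; first by rewrite subrK.
split => //; exists (8 * (k8' + 1)); last first.
  split; [split; lra|].
  set a := 8 * _; have a0 : 0 <= a by rewrite /a; lra.
  nra.
apply: (@mean_le_mono _ _ _ _ _ (fun x => 8 * (x ^+ 8 + 1))).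
- by apply: measurable_funX; apply: measurable_funB => //; exact: measurable_funX.
- by move=> x; rewrite exprn_even_ge0.
- move=> x; have -> : x ^+ 8 = (x ^+ 2) ^+ 4 by rewrite -exprM.
  set y := x ^+ 2; have y0 : 0 <= y by exact: sqr_ge0.
  have h1 : (y - 1) ^+ 2 <= 2 * (y ^+ 2 + 1) by have := sqr_ge0 (y + 1); nra.
  have -> : (y - 1) ^+ 4 = ((y - 1) ^+ 2) ^+ 2 by rewrite -exprM.
  have h2 : ((y - 1) ^+ 2) ^+ 2 <= (2 * (y ^+ 2 + 1)) ^+ 2.
    by rewrite lerXn2r ?nnegrE ?sqr_ge0//; have := sqr_ge0 y; lra.
  apply: le_trans h2 _.
  have := sqr_ge0 (y ^+ 2 - 1); nra.
- by apply: mean_leZ => //; apply: mean_leD => //; exact: mean_le_cst.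
Qed.

End gaussian_moments.

(** * Exponential of a squared Gaussian linear form *)

Section square_exponential.
Context d (T : measurableType d) (R : realType) (P : probability T R).
Local Notation gamma := (@normal_law R 0 1).

(** The square is linearized by an auxiliary Gaussian variable:
exp(lam S^2) = E exp((2 lam)^(1/2) S g), and for fixed g the exponential of the
linear form S factorizes over the coordinates. *)
Lemma has_mean_iid_exp_sq m (f : T -> R) (y : 'I_m -> R) (lam : R) :
  (forall c, has_mean P (fun x => expR (c * f x)) (expR (c ^+ 2 / 2))) ->
  measurable_fun setT f -> 0 <= lam -> lam * (\sum_p y p ^+ 2) < 2^-1 ->
  has_mean (iid P m) (fun t => expR (lam * (\sum_p y p * f (tnth t p)) ^+ 2))
    (Num.sqrt (1 - 2 * (lam * \sum_p y p ^+ 2)))^-1.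
Proof.
move=> fexp mf lam0 lam2.
set a := Num.sqrt (2 * lam).
have a2 : a ^+ 2 = 2 * lam by rewrite sqr_sqrtr//; lra.
pose S (t : m.-tuple T) := \sum_p y p * f (tnth t p).
have mS : measurable_fun setT S.
  apply: measurable_sum => p; apply: measurable_funM => //.
  exact: (measurableT_comp mf (measurable_tnth p)).
apply: ge0_has_mean.
- apply: measurableT_comp => //; apply: measurable_funM => //; exact: measurable_funX.
- by move=> t; exact: expR_ge0.
pose h (z : m.-tuple T * R) := (expR (a * S z.1 * z.2))%:E.
have mh : measurable_fun setT h.
  apply/measurable_EFinP; apply: measurableT_comp => //; apply: measurable_funM => //.
  apply: measurable_funM => //; exact: (measurableT_comp mS measurable_fst).
transitivity (\int[iid P m]_t \int[gamma]_g h (t, g))%E.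
  apply: eq_integral => t _.
  have [_ _ ->] := has_mean_exp_lin (a * S t).
  by rewrite exprMn a2 mulrAC (mulrAC 2) divff ?mul1r// pnatr_eq0.
rewrite (fubini_tonelli h mh); last by move=> z; rewrite lee_fin expR_ge0.
transitivity (\int[gamma]_g (expR ((lam * \sum_p y p ^+ 2) * g ^+ 2))%:E)%E; last first.
  by have [_ _] := has_mean_exp_sq lam2.
apply: eq_integral => g _.
pose H (p : 'I_m) x := expR ((a * g * y p) * f x).
have [_ _] := @has_mean_iid_prod _ _ _ P m H (fun p => expR ((a * g * y p) ^+ 2 / 2))
   (fun p x => expR_ge0 _) (fun p => fexp _).
rewrite -expR_sum => E; transitivity (expR (\sum_p (a * g * y p) ^+ 2 / 2))%:E; last first.
  congr (expR _)%:E; rewrite mulrAC mulr_sumr; apply: eq_bigr => p _.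
  by rewrite !exprMn a2; field.
rewrite -E; apply: eq_integral => t _; rewrite /h/= -expR_sum; congr (expR _)%:E.
rewrite /S mulr_sumr mulr_suml; apply: eq_bigr => p _; ring.
Qed.

(** The linear terms of - u and - ln(1 - 2 u) / 2 cancel, which leaves u^2 + O(u^3);
this is the exponential moment of u (g^2 - 1). *)
Lemma sqrt_inv_exp_le (u : R) : 0 <= u <= 8^-1 ->
  expR (- u) * (Num.sqrt (1 - 2 * u))^-1 <= expR (2 * u ^+ 2).
Proof.
move=> /andP[u0 u8].
have q0 : 0 < 1 - 2 * u by lra.
rewrite ler_pdivrMr ?sqrtr_gt0// mulrC -ler_pdivrMr ?expR_gt0// -expRN -expRD.
rewrite -[leLHS](ger0_norm (expR_ge0 _)) -sqrtr_sqr (ler_sqrt _ (ltW q0)).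
rewrite -expRM_natl.
set a := 2 * u.
have -> : 2%:R * (- u + - (2 * u ^+ 2)) = - (a + a ^+ 2) by rewrite /a; ring.
have a0 : 0 <= a by rewrite /a; lra.
have a4 : a <= 4^-1 by rewrite /a; lra.
rewrite expRN -[leLHS]mul1r ler_pdivrMr ?expR_gt0//.
have -> : a + a ^+ 2 = 2%:R * ((a + a ^+ 2) / 2) by field.
rewrite expRM_natl.
have := expR_ge1Dx ((a + a ^+ 2) / 2); set v := (a + a ^+ 2) / 2 => hv.
have v0 : 0 <= v by rewrite /v; nra.
have h2 : (1 + v) ^+ 2 <= expR v ^+ 2 by rewrite lerXn2r ?nnegrE ?expR_ge0//; lra.
have : 1 <= (1 - a) * (1 + v) ^+ 2.
  rewrite -subr_ge0.
  have -> : (1 - a) * (1 + v) ^+ 2 - 1 = (a ^+ 2 / 4) * ((1 + a) ^+ 2 * (1 - a) - 4 * a).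
    by rewrite /v; field.
  rewrite mulr_ge0//; first by rewrite mulr_ge0 ?sqr_ge0.
  nra.
move=> /le_trans; apply; rewrite ler_wpM2l//; lra.
Qed.

End square_exponential.

(** * Rows and Gram matrix of a Gaussian matrix *)

Section rows.
Variable R : realType.
Local Notation gamma := (@normal_law R 0 1).
Variables (V K : R).
Hypothesis gauss4 : has_mean gamma (fun x => x ^+ 4) (V + 1).
Hypothesis gauss_sqc : centered gamma (fun x => x ^+ 2 - 1) V K.

Lemma row_sq_mean n (i : 'I_n) : has_mean (gauss_vec n (1 : R)) (fun r => tnth r i ^+ 2) 1.
Proof.
have h := has_mean_tnth i (f := fun x : R => x ^+ 2) (fun x => sqr_ge0 x) (@gauss_sq1 R).
exact h.
Qed.

Lemma row_sq_centered n (i : 'I_n) :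
  centered (gauss_vec n (1 : R)) (fun r => tnth r i ^+ 2 - 1) V K.
Proof.
have [_ h2 [k h4 hK]] := gauss_sqc; split.
- rewrite -[X in has_mean _ _ X](subrr 1); apply: has_meanD; first exact: row_sq_mean.
  exact: has_mean_cst.
- have h := has_mean_tnth i (f := fun x : R => (x ^+ 2 - 1) ^+ 2) (fun x => sqr_ge0 _) h2.
  exact h.
- exists k => //; have [w hw wk] := mean_le_has_mean h4.
  have f0 x : 0 <= (x ^+ 2 - 1) ^+ 4 :> R by rewrite exprn_even_ge0.
  have h := has_mean_tnth i (f := fun x : R => (x ^+ 2 - 1) ^+ 4) f0 hw.
  by apply: (has_mean_le h _ wk) => x; exact: f0.
Qed.

(** Bounds for a product of two independent normal variables, whose variance is 1
and whose fourth moment is (V + 1)^2. *)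
Definition prod_bound := 4 + 3 * (V + 1) ^+ 2.

(** The product is obtained from the squares of r_i + r_j and r_i - r_j by
polarization. *)
Lemma row_prod_centered n (i j : 'I_n) : i != j ->
  centered (gauss_vec n (1 : R)) (fun r => tnth r i * tnth r j) 1 prod_bound.
Proof.
move=> ij.
have polar (e : R) : e ^+ 2 = 1 ->
   has_mean (gauss_vec n (1 : R)) (fun r => (tnth r i + e * tnth r j) ^+ 2) 2.
  move=> e2.
  have := has_mean_iid_sq (fun k : 'I_n => (k == i)%:R + e * (k == j)%:R) 0
    (normal_law_mean0 ler01) (normal_law_sq ler01).
  set S := (X in has_mean _ _ (X * _ + _) -> _).
  have -> : S = 2.
    rewrite /S (bigD1 i)//= (bigD1 j) ?(eq_sym j)//= big1 => [|k /andP[/negbTE-> /negbTE->]].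
      by rewrite !eqxx (negbTE ij) mulr0 mulr1 !addr0 add0r e2 expr1n; ring.
    by rewrite mulr0 addr0 expr0n.
  rewrite expr1n mulr1 expr0n addr0; congr (has_mean _ _ _); apply/funext => t.
  rewrite addr0 (bigD1 i)//= (bigD1 j) ?(eq_sym j)//= big1 => [|k /andP[/negbTE-> /negbTE->]].
    by rewrite !eqxx (negbTE ij) mulr0 mulr1 !addr0 add0r mul1r.
  by rewrite mulr0 addr0 mul0r.
split.
- rewrite (_ : (fun r => _) = (fun r => 4^-1 * (tnth r i + 1 * tnth r j) ^+ 2 +
     (- 4^-1) * (tnth r i + (-1) * tnth r j) ^+ 2)); last first.
    by apply/funext => r; field.
  rewrite (_ : 0 = 4^-1 * 2 + (- 4^-1) * 2 :> R); last by ring.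
  by apply: has_meanD; apply: has_meanZ; apply: polar; [rewrite expr1n|rewrite sqrrN expr1n].
- under eq_fun do rewrite exprMn.
  rewrite -[X in has_mean _ _ X]mulr1.
  by apply: (has_mean_tnth2 ij _ _ (@gauss_sq1 R) (@gauss_sq1 R)) => x; exact: sqr_ge0.
- exists ((V + 1) * (V + 1)).
    under eq_fun do rewrite exprMn.
    apply: (has_mean_le _ _ (lexx _)).
      by apply: (has_mean_tnth2 ij _ _ gauss4 gauss4) => x; rewrite exprn_even_ge0.
    by move=> x; rewrite mulr_ge0// exprn_even_ge0.
  have := sqr_ge0 (V + 1); rewrite /prod_bound -expr2; set q := (V + 1) ^+ 2 => q0.
  split; [split; lra|nra].
Qed.

End rows.

Section gram.
Variable R : realType.
Local Notation gamma := (@normal_law R 0 1).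
Variables (V K : R).
Hypothesis gauss4 : has_mean gamma (fun x => x ^+ 4) (V + 1).
Hypothesis gauss_sqc : centered gamma (fun x => x ^+ 2 - 1) V K.
Variables m n : nat.
Local Notation mx := (m.-tuple (n.-tuple R)).
Local Notation law := (gauss_mx R m n).
Local Notation mr := (m%:R : R).

Definition ent (A : mx) p j : R := tnth (tnth A p) j.
(** The (i, j) entry of the Gram matrix of the columns of A. *)
Definition gram i j (A : mx) : R := \sum_p ent A p i * ent A p j.

Lemma measurable_ent p j : measurable_fun setT (fun A : mx => ent A p j).
Proof. by rewrite /ent; solve_measurable. Qed.

Lemma measurable_gram i j : measurable_fun setT (gram i j).
Proof. by rewrite /gram /ent; solve_measurable. Qed.

Lemma gram_ge0 i A : 0 <= gram i i A.
Proof. by apply: sumr_ge0 => p _; rewrite -expr2 sqr_ge0. Qed.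

Lemma gram_diagE i (A : mx) :
  gram i i A = \sum_p 1 * (tnth (tnth A p) i ^+ 2 - 1) + mr.
Proof.
rewrite /gram; under [in RHS]eq_bigr do rewrite mul1r.
by rewrite sumrB sumr_const card_ord subrK; apply: eq_bigr => p _; rewrite -expr2.
Qed.

Lemma sum1sq : \sum_(p < m) (1 : R) ^+ 2 = mr.
Proof. by under eq_bigr do rewrite expr1n; rewrite sumr_const card_ord. Qed.

Lemma gram_diag_sq i : has_mean law (fun A => gram i i A ^+ 2) (mr * V + mr ^+ 2).
Proof.
have [h1 h2 _] := row_sq_centered gauss_sqc i.
have h := has_mean_iid_sq (fun p : 'I_m => 1) mr h1 h2.
by rewrite sum1sq in h; under eq_fun do rewrite gram_diagE; exact: h.
Qed.

Lemma gram_offE i j (A : mx) :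
  gram i j A = \sum_p 1 * (tnth (tnth A p) i * tnth (tnth A p) j) + 0.
Proof. by rewrite addr0; apply: eq_bigr => p _; rewrite mul1r. Qed.

Lemma gram_off_sq i j : i != j -> has_mean law (fun A => gram i j A ^+ 2) mr.
Proof.
move=> ij; have [h1 h2 _] := row_prod_centered gauss4 ij.
have h := has_mean_iid_sq (fun p : 'I_m => 1) 0 h1 h2.
rewrite sum1sq mulr1 expr0n addr0 in h.
by under eq_fun do rewrite gram_offE; exact: h.
Qed.

Lemma gram_sq i j : has_mean law (fun A => gram i j A ^+ 2)
  (mr + (j == i)%:R * (mr * V + mr ^+ 2 - mr)).
Proof.
have [->|ji] := eqVneq j i.
  by rewrite mul1r addrC subrK; exact: gram_diag_sq.
by rewrite mul0r addr0; apply: gram_off_sq; rewrite eq_sym.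
Qed.

Lemma gram_diag_4 i : mean_le law (fun A => gram i i A ^+ 4) ((mr ^+ 2 + K * mr) ^+ 2).
Proof.
have h := mean_le_iid_4 (fun p : 'I_m => 1) mr (row_sq_centered gauss_sqc i) (lexx 0).
rewrite sum1sq addr0 in h.
by under eq_fun do rewrite gram_diagE (exprM _ 2 2) -[_ ^+ 2 in X in X ^+ 2]addr0; exact: h.
Qed.

Lemma gram_off_4 i j : i != j ->
  mean_le law (fun A => gram i j A ^+ 4) ((prod_bound V * mr) ^+ 2).
Proof.
move=> ij.
have h := mean_le_iid_4 (fun p : 'I_m => 1) 0 (row_prod_centered gauss4 ij) (lexx 0).
rewrite sum1sq addr0 expr0n add0r in h.
by under eq_fun do rewrite gram_offE (exprM _ 2 2) -[_ ^+ 2 in X in X ^+ 2]addr0; exact: h.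
Qed.

Lemma ent_sq p j : has_mean law (fun A => ent A p j ^+ 2) 1.
Proof.
have h := has_mean_tnth p (f := fun r : n.-tuple R => tnth r j ^+ 2)
  (fun r => sqr_ge0 _) (row_sq_mean R j).
exact h.
Qed.

Lemma ent_4 p j : has_mean law (fun A => ent A p j ^+ 4) (V + 1).
Proof.
have x40 (x : R) : 0 <= x ^+ 4 by rewrite exprn_even_ge0.
have h := has_mean_tnth j (f := fun x : R => x ^+ 4) x40 gauss4.
have h' := has_mean_tnth p (f := fun r : n.-tuple R => tnth r j ^+ 4) (fun r => x40 _) h.
exact h'.
Qed.

Lemma gram_diag_mean i : has_mean law (gram i i) mr.
Proof.
rewrite (_ : gram i i = (fun A => \sum_p ent A p i ^+ 2)).
  have := has_mean_sum (index_enum 'I_m) (fun p => ent_sq p i).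
  by rewrite sumr_const card_ord.
by apply/funext => A; apply: eq_bigr => p _; rewrite expr2.
Qed.

End gram.

(** * Moments of one measurement *)

Lemma weighted_cauchy (R : realFieldType) (I : finType) (P : pred I) (b u : I -> R) :
  (forall i, 0 <= b i) ->
  (\sum_(i | P i) b i * u i) ^+ 2 <= (\sum_(i | P i) b i) * (\sum_(i | P i) b i * u i ^+ 2).
Proof.
move=> b0; set S := \sum_(i | P i) b i; set T := \sum_(i | P i) b i * u i.
set U := \sum_(i | P i) b i * u i ^+ 2.
have S0 : 0 <= S by exact: sumr_ge0.
have : 0 <= S * (S * U - T ^+ 2).
  have -> : S * (S * U - T ^+ 2) = \sum_(i | P i) b i * (S * u i - T) ^+ 2.
    have -> : \sum_(i | P i) b i * (S * u i - T) ^+ 2 =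
        \sum_(i | P i) (S ^+ 2 * (b i * u i ^+ 2) - (2 * S * T) * (b i * u i) + T ^+ 2 * b i).
      by apply: eq_bigr => i _; ring.
    rewrite big_split/= sumrB -!mulr_sumr -/S -/T -/U; ring.
  by apply: sumr_ge0 => i _; rewrite mulr_ge0 ?sqr_ge0.
have [S00|Spos] := eqVneq S 0.
  have b00 i : P i -> b i = 0.
    move=> Pi; apply/eqP; rewrite eq_le b0 andbT -S00 /S (bigD1 i)//= lerDl.
    exact: sumr_ge0.
  move=> _; rewrite S00 mul0r /T big1 ?expr0n// => i Pi.
  by rewrite b00// mul0r.
by rewrite pmulr_rge0 ?lt_neqAle 1?eq_sym ?Spos// subr_ge0.
Qed.

Section single_measurement.
Variable R : realType.
Local Notation gamma := (@normal_law R 0 1).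
Variables (V K Kn : R).
Hypothesis gauss4 : has_mean gamma (fun x => x ^+ 4) (V + 1).
Hypothesis gauss_sqc : centered gamma (fun x => x ^+ 2 - 1) V K.
Hypothesis Kn0 : 0 <= Kn.
Hypothesis normalc : forall s : R, 0 <= s ->
  centered (normal_law 0 s) id (s ^+ 2) (Kn * s ^+ 2).
Variables m n : nat.
Local Notation mx := (m.-tuple (n.-tuple R)).
Variables (sz : R) (sz0 : 0 <= sz) (x : 'I_n -> R).
Local Notation mr := (m%:R : R).

(** The law of the triple (A_l, w_l, z_l) of a single sample. *)
Definition meas_law : probability (mx * (n.-tuple R * m.-tuple R))%type R :=
  (gauss_mx R m n \x (gauss_vec n (1 : R) \x gauss_vec m sz))%E.

Definition meas (A : mx) (w : n.-tuple R) (z : m.-tuple R) : m.-tuple R :=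
  [tuple \sum_j ent A p j * (x j * tnth w j) + tnth z p | p < m].

Definition corr i (A : mx) (y : m.-tuple R) := \sum_p ent A p i * tnth y p.
Definition sqn (y : m.-tuple R) := \sum_p tnth y p ^+ 2.

Definition ymeas (o : mx * (n.-tuple R * m.-tuple R)) := meas o.1 o.2.1 o.2.2.

Lemma measurable_ymeas : measurable_fun setT ymeas.
Proof. by rewrite /ymeas /meas /ent; solve_measurable. Qed.

Lemma measurable_sqn : measurable_fun setT sqn.
Proof. by rewrite /sqn; solve_measurable. Qed.

Definition ycorr i o := corr i o.1 (ymeas o).

Lemma measurable_ycorr i : measurable_fun setT (ycorr i).
Proof. by rewrite /ycorr /corr /ymeas /meas /ent; solve_measurable. Qed.

Let s2 := \sum_j x j ^+ 2.

(** For fixed A this is a linear form in the Gaussian vectors z and w, with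
coefficients the i-th column of A and the products x_j gram i j. Moments are
computed by integrating z, then w, then A. *)
Lemma ycorrE i (A : mx) w z : ycorr i (A, (w, z)) =
  \sum_p ent A p i * tnth z p +
  (\sum_j (x j * gram i j A) * tnth w j + 0).
Proof.
rewrite addr0 /ycorr /corr /ymeas/= /meas.
under eq_bigr do rewrite tnth_mktuple mulrDr mulr_sumr.
rewrite big_split/= addrC; congr (_ + _); rewrite exchange_big/=.
apply: eq_bigr => j _; rewrite /gram mulr_sumr mulr_suml.
by apply: eq_bigr => p _; ring.
Qed.

Lemma sum_ent_sq i (A : mx) : \sum_p ent A p i ^+ 2 = gram i i A :> R.
Proof. by apply: eq_bigr => p _; rewrite expr2. Qed.

Lemma ycorr_sq i : has_mean meas_law (fun o => ycorr i o ^+ 2)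
  (mr * (s2 + sz ^+ 2) + x i ^+ 2 * (mr * V + mr ^+ 2 - mr)).
Proof.
apply: (has_mean_prod3
  (g := fun A w => gram i i A * sz ^+ 2 + (\sum_j (x j * gram i j A) * tnth w j + 0) ^+ 2)
  (h := fun A => gram i i A * sz ^+ 2 + \sum_j x j ^+ 2 * gram i j A ^+ 2)).
- by apply: measurable_funX; exact: measurable_ycorr.
- by move=> o; exact: sqr_ge0.
- move=> A w; under eq_fun do rewrite ycorrE.
  rewrite -sum_ent_sq.
  exact: (has_mean_iid_sq _ _ (normal_law_mean0 sz0) (normal_law_sq sz0)).
- move=> A; apply: has_meanD; first exact: has_mean_cst.
  have h := has_mean_iid_sq (fun j => x j * gram i j A) 0
    (normal_law_mean0 (@ler01 R)) (normal_law_sq (@ler01 R)).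
  rewrite expr1n mulr1 expr0n addr0 in h.
  by under [X in has_mean _ _ X]eq_bigr do rewrite -exprMn; exact: h.
- have -> : mr * (s2 + sz ^+ 2) + x i ^+ 2 * (mr * V + mr ^+ 2 - mr) =
    sz ^+ 2 * mr + \sum_j x j ^+ 2 * (mr + (j == i)%:R * (mr * V + mr ^+ 2 - mr)).
    under eq_bigr do rewrite mulrDr.
    rewrite big_split/= -mulr_suml -/s2 (bigD1 i)//= [X in _ + (_ + (_ + X))]big1 => [|j ji].
      by rewrite eqxx mul1r addr0; ring.
    by rewrite (negbTE ji) mul0r mulr0.
  under eq_fun do rewrite mulrC.
  apply: has_meanD; first by apply: has_meanZ; exact: gram_diag_mean.
  by apply: has_mean_sum => j; apply: has_meanZ; exact: (gram_sq gauss4 gauss_sqc).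
Qed.

Lemma tnth_ymeas p (A : mx) w z : tnth (ymeas (A, (w, z))) p =
  1 * tnth z p + (\sum_j (ent A p j * x j) * tnth w j + 0).
Proof.
rewrite addr0 mul1r addrC tnth_mktuple; congr (_ + _).
by apply: eq_bigr => j _; rewrite mulrA.
Qed.

Lemma ymeas_sq p : has_mean meas_law (fun o => tnth (ymeas o) p ^+ 2) (s2 + sz ^+ 2).
Proof.
apply: (has_mean_prod3
  (g := fun A w => 1 ^+ 2 * sz ^+ 2 + (\sum_j (ent A p j * x j) * tnth w j + 0) ^+ 2)
  (h := fun A => 1 ^+ 2 * sz ^+ 2 + \sum_j x j ^+ 2 * ent A p j ^+ 2)).
- apply: measurable_funX; apply: measurable_tnth_comp; exact: measurable_ymeas.
- by move=> o; exact: sqr_ge0.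
- move=> A w; under eq_fun do rewrite tnth_ymeas.
  set e := _ + 0.
  have h := has_mean_affine_sq 1 e (normal_law_mean0 sz0) (normal_law_sq sz0).
  have h' := has_mean_tnth p (f := fun a : R => (1 * a + e) ^+ 2) (fun a => sqr_ge0 _) h.
  exact h'.
- move=> A; apply: has_meanD; first exact: has_mean_cst.
  have h := has_mean_iid_sq (fun j => ent A p j * x j) 0
    (normal_law_mean0 (@ler01 R)) (normal_law_sq (@ler01 R)).
  rewrite expr1n mulr1 expr0n addr0 in h.
  by under [X in has_mean _ _ X]eq_bigr do rewrite -exprMn mulrC; exact: h.
- rewrite expr1n mul1r addrC; apply: has_meanD; first exact: has_mean_cst.
  rewrite /s2; under [X in has_mean _ _ X]eq_bigr do rewrite -[_ ^+ 2]mulr1.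
  by apply: has_mean_sum => j; apply: has_meanZ; exact: ent_sq.
Qed.

Lemma sqn_mean : has_mean meas_law (fun o => sqn (ymeas o)) (mr * (s2 + sz ^+ 2)).
Proof.
have := has_mean_sum (index_enum 'I_m) ymeas_sq.
by rewrite sumr_const card_ord mulr_natl.
Qed.

Lemma sqn_ge0 y : 0 <= sqn y.
Proof. by apply: sumr_ge0 => p _; exact: sqr_ge0. Qed.

Lemma s2_ge0 : 0 <= s2.
Proof. by apply: sumr_ge0 => p _; exact: sqr_ge0. Qed.

Lemma V_ge0 : 0 <= V.
Proof. by case: gauss_sqc => _ /has_mean_sq_ge0. Qed.

(** Gram entries are of order m on the diagonal but only m^(1/2) off it, so this is
O(m^4) even when the squared norm of x is as large as m. *)
Lemma ycorr_4 i : mean_le meas_law (fun o => ycorr i o ^+ 4)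
  (3 * Kn ^+ 2 * (x i ^+ 4 * (mr ^+ 2 + K * mr) ^+ 2 +
     s2 * (s2 * (prod_bound V * mr) ^+ 2) + sz ^+ 4 * (mr * V + mr ^+ 2))).
Proof.
have Ks0 : 0 <= Kn * sz ^+ 2 by rewrite mulr_ge0 ?sqr_ge0.
have mycorr : measurable_fun setT (fun o => ycorr i o ^+ 4).
  by apply: measurable_funX; exact: measurable_ycorr.
have y40 o : 0 <= ycorr i o ^+ 4 by rewrite exprn_even_ge0.
apply: (mean_le_prod3
  (g := fun A w => ((\sum_j (x j * gram i j A) * tnth w j + 0) ^+ 2 + Kn * sz ^+ 2 * gram i i A) ^+ 2)
  (h := fun A => (0 ^+ 2 + Kn * 1 ^+ 2 * (\sum_j (x j * gram i j A) ^+ 2) +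
    Kn * sz ^+ 2 * gram i i A) ^+ 2)) => //.
- move=> A w; under eq_fun do rewrite ycorrE.
  rewrite -sum_ent_sq.
  exact: (mean_le_iid_pow4 _ _ (normalc sz0)).
- move=> A.
  have b0 : 0 <= Kn * sz ^+ 2 * gram i i A by rewrite mulr_ge0// gram_ge0.
  by have h := mean_le_iid_4 (fun j => x j * gram i j A) 0 (normalc (@ler01 R)) b0; exact: h.
have mg j : measurable_fun setT (gram i j : mx -> R) by exact: measurable_gram.
(* The diagonal term, the off-diagonal terms and the noise are separated by
   (a + b + c)^2 <= 3 (a^2 + b^2 + c^2). *)
apply: (@mean_le_mono _ _ _ _ _ (fun A => 3 * Kn ^+ 2 * (x i ^+ 4 * gram i i A ^+ 4 +
     s2 * (\sum_(j | j != i) x j ^+ 2 * gram i j A ^+ 4) + sz ^+ 4 * gram i i A ^+ 2))).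
- by solve_measurable => //.
- by move=> A; exact: sqr_ge0.
- move=> A; rewrite expr0n add0r expr1n mulr1.
  under eq_bigr do rewrite exprMn.
  rewrite (bigD1 i)//=.
  set a := x i ^+ 2 * gram i i A ^+ 2; set b := \sum_(j | j != i) _.
  set c := sz ^+ 2 * gram i i A.
  have -> : Kn * (a + b) + Kn * sz ^+ 2 * gram i i A = Kn * (a + b + c) by rewrite /c; ring.
  have -> : x i ^+ 4 * gram i i A ^+ 4 = a ^+ 2 by rewrite /a; ring.
  have -> : sz ^+ 4 * gram i i A ^+ 2 = c ^+ 2 by rewrite /c; ring.
  have hb : b ^+ 2 <= s2 * (\sum_(j | j != i) x j ^+ 2 * gram i j A ^+ 4).
    have := weighted_cauchy (fun j => j != i) (fun j => gram i j A ^+ 2) (fun j => sqr_ge0 (x j)).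
    rewrite [X in _ <= _ * X](eq_bigr (fun j => x j ^+ 2 * gram i j A ^+ 4)); last first.
      by move=> j _; rewrite -exprM.
    move=> /le_trans; apply; rewrite ler_wpM2r//.
      by apply: sumr_ge0 => j _; rewrite mulr_ge0 ?sqr_ge0 ?exprn_even_ge0.
    by rewrite /s2 [leRHS](bigD1 i)//= lerDr sqr_ge0.
  apply: (@le_trans _ _ (Kn ^+ 2 * (3 * (a ^+ 2 + b ^+ 2 + c ^+ 2)))).
    rewrite exprMn ler_wpM2l ?sqr_ge0//.
    have := sqr_ge0 (a - b); have := sqr_ge0 (a - c); have := sqr_ge0 (b - c); nra.
  have -> : Kn ^+ 2 * (3 * (a ^+ 2 + b ^+ 2 + c ^+ 2)) =
    3 * Kn ^+ 2 * (a ^+ 2 + b ^+ 2 + c ^+ 2) by ring.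
  rewrite ler_wpM2l//; first by rewrite mulr_ge0 ?sqr_ge0.
  lra.
apply: mean_leZ; first by rewrite mulr_ge0 ?sqr_ge0.
apply: mean_leD; last first.
  apply: mean_leZ; first by rewrite exprn_even_ge0.
  apply: (has_mean_le _ _ (lexx _)) => [|A]; last exact: sqr_ge0.
  exact: (gram_diag_sq gauss_sqc).
apply: mean_leD.
  apply: mean_leZ; first by rewrite exprn_even_ge0.
  exact: (gram_diag_4 gauss_sqc).
apply: mean_leZ; first exact: s2_ge0.
apply: (@mean_leW _ _ _ _ _ (\sum_j (if j != i then x j ^+ 2 * (prod_bound V * mr) ^+ 2 else 0))).
  under eq_fun do rewrite big_mkcond/=.
  apply: mean_le_sum => j; case: ifP => ji; last exact: mean_le_cst.
  apply: mean_leZ; first exact: sqr_ge0.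
  by apply: (gram_off_4 gauss4); rewrite eq_sym.
rewrite -big_mkcond/= -mulr_suml ler_wpM2r ?sqr_ge0//.
by rewrite /s2 [leRHS](bigD1 i)//= lerDr sqr_ge0.
Qed.

Lemma ymeas_4 p : mean_le meas_law (fun o => tnth (ymeas o) p ^+ 4)
  (2 * Kn ^+ 2 * (V + 1) * (s2 + sz ^+ 2) ^+ 2).
Proof.
have Ks0 : 0 <= Kn * sz ^+ 2 by rewrite mulr_ge0 ?sqr_ge0.
have me j : measurable_fun setT (fun A : mx => ent A p j) by exact: measurable_ent.
apply: (mean_le_prod3
  (g := fun A w => ((\sum_j (ent A p j * x j) * tnth w j + 0) ^+ 2 + Kn * sz ^+ 2 * 1 ^+ 2) ^+ 2)
  (h := fun A => (0 ^+ 2 + Kn * 1 ^+ 2 * (\sum_j (ent A p j * x j) ^+ 2) + Kn * sz ^+ 2) ^+ 2)).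
- apply: measurable_funX; apply: measurable_tnth_comp; exact: measurable_ymeas.
- by move=> o; rewrite exprn_even_ge0.
- move=> A w; under eq_fun do rewrite tnth_ymeas.
  set e := _ + 0.
  by have h := mean_le_tnth p (mean_le_affine_pow4 1 e (normalc sz0)); exact: h.
- move=> A; under eq_fun do rewrite expr1n mulr1.
  by have h := mean_le_iid_4 (fun j => ent A p j * x j) 0 (normalc (@ler01 R)) Ks0; exact: h.
apply: (@mean_leW _ _ _ _ _ (2 * Kn ^+ 2 * (s2 * (s2 * (V + 1)) + sz ^+ 4))); last first.
  rewrite -[leRHS]mulrA ler_wpM2l// ?mulr_ge0 ?sqr_ge0//.
  have := V_ge0; have := s2_ge0; have := sqr_ge0 sz; set q := sz ^+ 2 => q0 s0 V0.
  have -> : sz ^+ 4 = q ^+ 2 by rewrite /q -exprM.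
  have h1 : 0 <= s2 * q * (V + 1) by rewrite mulr_ge0 ?mulr_ge0//; lra.
  have h2 : 0 <= q ^+ 2 * V by rewrite mulr_ge0 ?sqr_ge0.
  lra.
apply: (@mean_le_mono _ _ _ _ _ (fun A => 2 * Kn ^+ 2 * (
     s2 * (\sum_j x j ^+ 2 * ent A p j ^+ 4) + sz ^+ 4))).
- by rewrite /ent; solve_measurable.
- by move=> A; exact: sqr_ge0.
- move=> A; rewrite expr0n add0r expr1n mulr1 -mulrDr exprMn.
  rewrite (_ : 2 * Kn ^+ 2 * _ = Kn ^+ 2 * (2 *
    (s2 * (\sum_j x j ^+ 2 * ent A p j ^+ 4) + sz ^+ 4))); last by ring.
  rewrite ler_wpM2l ?sqr_ge0//.
  rewrite (eq_bigr (fun j => x j ^+ 2 * ent A p j ^+ 2)); last by move=> j _; ring.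
  set b := \sum_j x j ^+ 2 * ent A p j ^+ 2.
  have hb : b ^+ 2 <= s2 * (\sum_j x j ^+ 2 * ent A p j ^+ 4).
    have := weighted_cauchy xpredT (fun j => ent A p j ^+ 2) (fun j => sqr_ge0 (x j)).
    rewrite [X in _ <= _ * X](eq_bigr (fun j => x j ^+ 2 * ent A p j ^+ 4))//.
    by move=> j _; rewrite -exprM.
  have -> : sz ^+ 4 = (sz ^+ 2) ^+ 2 by rewrite -exprM.
  have := sqr_ge0 (b - sz ^+ 2); nra.
apply: mean_leZ; first by rewrite mulr_ge0 ?sqr_ge0.
apply: mean_leD; last by apply: mean_le_cst; rewrite exprn_even_ge0.
apply: mean_leZ; first exact: s2_ge0.
rewrite [X in mean_le _ _ X]mulr_suml; apply: mean_le_sum => j.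
apply: mean_leZ; first exact: sqr_ge0.
apply: (has_mean_le _ _ (lexx _)) => [|A]; last by rewrite exprn_even_ge0.
exact: (ent_4 gauss4).
Qed.

Lemma sqn_sq : mean_le meas_law (fun o => sqn (ymeas o) ^+ 2)
  (2 * Kn ^+ 2 * (V + 1) * (mr * (s2 + sz ^+ 2)) ^+ 2).
Proof.
apply: (@mean_le_mono _ _ _ _ _ (fun o => mr * \sum_p tnth (ymeas o) p ^+ 4)).
- by apply: measurable_funX; apply: measurableT_comp; [exact: measurable_sqn|exact: measurable_ymeas].
- by move=> o; exact: sqr_ge0.
- move=> o; have := weighted_cauchy xpredT (fun p => tnth (ymeas o) p ^+ 2) (fun p : 'I_m => @ler01 R).
  rewrite sumr_const card_ord; under eq_bigr do rewrite mul1r.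
  rewrite [X in _ <= _ * X](eq_bigr (fun p => tnth (ymeas o) p ^+ 4))//.
  by move=> p _; rewrite mul1r -exprM.
have -> : 2 * Kn ^+ 2 * (V + 1) * (mr * (s2 + sz ^+ 2)) ^+ 2 =
  mr * \sum_(p < m) (2 * Kn ^+ 2 * (V + 1) * (s2 + sz ^+ 2) ^+ 2).
  by rewrite sumr_const card_ord -[_ *+ m]mulr_natl; ring.
by apply: mean_leZ => //; apply: mean_le_sum => p; exact: ymeas_4.
Qed.

End single_measurement.

(** * The statistic at a zero coordinate *)

Section null_coordinate.
Variable R : realType.
Local Notation gamma := (@normal_law R 0 1).
Variables m n : nat.
Local Notation mx := (m.-tuple (n.-tuple R)).
Variables (sz : R) (x : 'I_n -> R) (i : 'I_n).

(** Subtracting the squared norm cancels the contribution of the noise and of the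
other coordinates to the mean of the squared correlation. *)
Definition stat (A : mx) (y : m.-tuple R) := corr i A y ^+ 2 - sqn y.

(** The square of a Gaussian form of unbounded variance has no uniform exponential
moments; on sqn y <= B the conditional variance is at most B. *)
Definition trunc_stat (B : R) (A : mx) (y : m.-tuple R) :=
  if sqn y <= B then stat A y else 0.

Lemma measurable_stat : measurable_fun setT (fun z : mx * m.-tuple R => stat z.1 z.2).
Proof. by rewrite /stat /sqn /corr /ent; solve_measurable. Qed.

Lemma measurable_trunc_stat B : measurable_fun setT (fun z : mx * m.-tuple R => trunc_stat B z.1 z.2).
Proof.
apply: measurable_fun_ifT => //; last exact: measurable_stat.
apply: measurable_fun_ler => //.
by apply: (measurableT_comp (@measurable_sqn R m)).
Qed.

(** Resampling the i-th column keeps the law of the matrix. It also keeps the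
observation when x_i = 0, which expresses that the column is independent of it. *)
Definition swap_col (z : mx * mx) : mx :=
  [tuple [tuple (if j == i then tnth (tnth z.2 p) j else tnth (tnth z.1 p) j) | j < n] | p < m].

Lemma pushes_swap_col : pushes (gauss_mx R m n \x gauss_mx R m n)%E (gauss_mx R m n) swap_col.
Proof.
pose phi (j : 'I_n) (z : R * R) := if j == i then z.2 else z.1.
have mphi j : measurable_fun setT (phi j) by rewrite /phi; case: (j == i); solve_measurable.
have pphi j : pushes (gamma \x gamma)%E gamma (phi j).
  rewrite /phi; case: (j == i); [exact: pushes_snd|exact: pushes_fst].
have h1 := iid_pushes mphi pphi.
pose psi (z : n.-tuple R * n.-tuple R) : n.-tuple R :=
  [tuple phi j (tnth z.1 j, tnth z.2 j) | j < n].
have mpsi : measurable_fun setT psi.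
  apply: measurable_mktuple => j; apply: (measurableT_comp (mphi j)); solve_measurable.
have h2 := @iid_pushes _ _ _ _ _ _ _ _ _ _ m (fun=> psi) (fun=> mpsi) (fun=> h1).
exact: h2.
Qed.

Lemma measurable_swap_col : measurable_fun setT swap_col.
Proof.
apply: measurable_mktuple => p; apply: measurable_mktuple => j.
by case: (j == i); solve_measurable.
Qed.

Hypothesis xi0 : x i = 0.

Lemma meas_swap_col A A' w z : meas x (swap_col (A, A')) w z = meas x A w z.
Proof.
apply: eq_from_tnth => p; rewrite !tnth_mktuple; congr (_ + _).
apply: eq_bigr => j _; rewrite /ent !tnth_mktuple /=.
by case: eqP => [->|//]; rewrite xi0 mul0r !mulr0.
Qed.

Lemma corr_swap_col A A' y : corr i (swap_col (A, A')) y =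
  \sum_p tnth y p * tnth (tnth A' p) i.
Proof.
by apply: eq_bigr => p _; rewrite /ent !tnth_mktuple eqxx mulrC.
Qed.

(** Given y, the correlation with the resampled column is N(0, sqn y). With
u = s0 sqn y / B <= s0 the conditional exponential moment is
exp(- u) (1 - 2 u)^(-1/2) <= exp(2 u^2). *)
Lemma trunc_stat_mgf (B s0 : R) : 0 < B -> 0 <= s0 <= 8^-1 ->
  mean_le (meas_law m n sz) (fun o => expR (s0 / B * trunc_stat B o.1 (ymeas x o)))
    (expR (2 * s0 ^+ 2)).
Proof.
move=> B0 /andP[s00 s08].
have mF : measurable_fun setT (fun o => expR (s0 / B * trunc_stat B o.1 (@ymeas R m n x o))).
  apply: (measurableT_comp (@measurable_expR _)); apply: measurable_funM => //.
  have mp : measurable_fun setT (fun o => (o.1, @ymeas R m n x o)).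
    by apply: measurable_fun_pair => //; exact: measurable_ymeas.
  exact: (measurableT_comp (measurable_trunc_stat B) mp).
apply: mean_le_prod_snd => [||[w z] ]; [exact: mF|by move=> o; exact: expR_ge0|].
apply: (mean_le_pushes measurable_swap_col _ _ pushes_swap_col) => [|A|A].
- by apply: (measurableT_comp mF); exact: measurable_pair2.
- exact: expR_ge0.
set y := meas x A w z.
have l0 : 0 <= s0 / B by rewrite divr_ge0// ltW.
have fun_eq A' : expR (s0 / B * trunc_stat B (swap_col (A, A')) (ymeas x (swap_col (A, A'), (w, z)))) =
   if sqn y <= B then expR (- (s0 / B * sqn y)) *
     expR (s0 / B * (\sum_p tnth y p * tnth (tnth A' p) i) ^+ 2) else 1.
  rewrite /ymeas/= meas_swap_col -/y /trunc_stat; case: ifP => _; last by rewrite mulr0 expR0.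
  by rewrite /stat corr_swap_col -expRD; congr expR; ring.
under eq_fun do rewrite fun_eq.
have [yB|_] := leP (sqn y) B; last first.
  by apply: (mean_leW (mean_le_cst _ ler01)); rewrite -[leLHS]expR0 ler_expR mulr_ge0 ?sqr_ge0.
set u := s0 / B * sqn y.
have u0 : 0 <= u by rewrite mulr_ge0// sqn_ge0.
have us0 : u <= s0.
  by rewrite /u mulrAC ler_pdivrMr// ler_wpM2l.
have u8 : 0 <= u <= 8^-1 by rewrite u0 (le_trans us0).
have fexp c : has_mean (gauss_vec n (1 : R)) (fun r => expR (c * tnth r i)) (expR (c ^+ 2 / 2)).
  have h := has_mean_tnth i (f := fun a : R => expR (c * a)) (fun a => expR_ge0 _)
    (has_mean_exp_lin c).
  exact h.
have u2 : s0 / B * (\sum_p tnth y p ^+ 2) < 2^-1 by apply: (@le_lt_trans _ _ 8^-1); [case/andP: u8|lra].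
have h := has_mean_iid_exp_sq fexp (measurable_tnth i) l0 u2.
apply: (@mean_leW _ _ _ _ _ (expR (- u) * (Num.sqrt (1 - 2 * u))^-1)).
  apply: mean_leZ; first exact: expR_ge0.
  by apply: (has_mean_le h _ (lexx _)) => A'; exact: expR_ge0.
apply: (le_trans (sqrt_inv_exp_le u8)); rewrite ler_expR ler_wpM2l//.
by rewrite lerXn2r ?nnegrE.
Qed.

End null_coordinate.

(** * The statistic at a general coordinate *)

Lemma has_mean_center_sq d (T : measurableType d) (R : realType) (P : probability T R)
    f (mu c : R) :
  has_mean P f mu -> mean_le P (fun x => f x ^+ 2) c ->
  has_mean P (fun x => f x - mu) 0 /\
  exists2 v, has_mean P (fun x => (f x - mu) ^+ 2) v & v <= c.
Proof.
move=> fm /mean_le_has_mean[w fw wc]; split.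
  by rewrite -[X in has_mean _ _ X](subrr mu); apply: has_meanD => //; exact: has_mean_cst.
exists (w + ((- 2 * mu) * mu + mu ^+ 2)); last by have := sqr_ge0 mu; nra.
rewrite (_ : (fun x => _) = (fun x => f x ^+ 2 + ((- 2 * mu) * f x + mu ^+ 2))).
  by apply: has_meanD => //; apply: has_meanD; [exact: has_meanZ|exact: has_mean_cst].
by apply/funext => x; ring.
Qed.

Section stat_moments.
Variable R : realType.
Local Notation gamma := (@normal_law R 0 1).
Variables (V K Kn : R).
Hypothesis gauss4 : has_mean gamma (fun x => x ^+ 4) (V + 1).
Hypothesis gauss_sqc : centered gamma (fun x => x ^+ 2 - 1) V K.
Hypothesis Kn0 : 0 <= Kn.
Hypothesis normalc : forall s : R, 0 <= s ->
  centered (normal_law 0 s) id (s ^+ 2) (Kn * s ^+ 2).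
Variables (xmin X tau : R).
Hypothesis xmin0 : 0 < xmin.
Hypothesis X0 : 0 <= X.
Hypothesis tau0 : 0 <= tau.

(* C4, C2 and Cq bound the moments of the statistic in units of m^4. The
   truncation level is M m W: eta and M make each of the two losses due to
   truncation at most m^2 xmin^2 / 8, whereas the untruncated mean is at least
   m^2 xmin^2 / 2. *)
Let C4 := 3 * Kn ^+ 2 * (X ^+ 2 * (1 + K) ^+ 2 + tau ^+ 2 * prod_bound V ^+ 2 + tau ^+ 2 * (V + 1)).
Let C2 := 2 * Kn ^+ 2 * (V + 1).
Let Cq := 2 * C4 + 2 * (C2 * tau ^+ 2).
Let eta := xmin ^+ 2 / (4 * (Cq + 1)).
Let M := C2 / (2 * eta) * (8 / xmin ^+ 2) + 1.

Variables m n : nat.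
Hypothesis m1 : (1 < m)%N.
Local Notation mr := (m%:R : R).
Variables (sz : R) (sz0 : 0 <= sz) (x : 'I_n -> R) (W : R).
Hypothesis sW : \sum_j x j ^+ 2 + sz ^+ 2 <= W.
Hypothesis W0 : 0 < W.
Hypothesis Wtau : W <= tau * mr.
Variable i : 'I_n.
Hypothesis xiX : x i ^+ 2 <= X.

Local Notation P1 := (meas_law m n sz).
Local Notation st := (fun o => stat i o.1 (@ymeas R m n x o)).
Let N := mr * V + mr ^+ 2 - mr.

Let V0 : 0 <= V. Proof. exact: V_ge0 gauss_sqc. Qed.
Let K0 : 0 <= K. Proof. by case: gauss_sqc => _ _ [? _ [[]]]. Qed.
Let mr1 : 2 <= mr. Proof. by rewrite ler_nat. Qed.
Let C20 : 0 <= C2.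
Proof. by apply: mulr_ge0; [rewrite mulr_ge0 ?sqr_ge0|rewrite addr_ge0]. Qed.
Let C40 : 0 <= C4.
Proof.
apply: mulr_ge0; first by rewrite mulr_ge0 ?sqr_ge0.
by rewrite !addr_ge0// mulr_ge0 ?sqr_ge0// addr_ge0.
Qed.
Lemma Cq_ge0 : 0 <= Cq.
Proof. by rewrite addr_ge0// mulr_ge0// mulr_ge0 ?sqr_ge0. Qed.
Let Cq0 : 0 <= Cq. Proof. exact: Cq_ge0. Qed.
Let eta0 : 0 < eta.
Proof. by rewrite divr_gt0 ?exprn_gt0// mulr_gt0// ltr_wpDl. Qed.
Lemma M_ge1 : 1 <= M.
Proof.
rewrite /M lerDr mulr_ge0//; first by rewrite divr_ge0// mulr_ge0// ltW.
by rewrite divr_ge0// sqr_ge0.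
Qed.

Let M1 : 1 <= M. Proof. exact: M_ge1. Qed.

Lemma N_ge : mr ^+ 2 / 2 <= N.
Proof.
rewrite /N; have : 0 <= mr * V by rewrite mulr_ge0.
have := mr1; nra.
Qed.

Lemma measurable_st : measurable_fun setT st.
Proof.
have mp : measurable_fun setT (fun o => (o.1, @ymeas R m n x o)).
  by apply: measurable_fun_pair => //; exact: measurable_ymeas.
exact: (measurableT_comp (measurable_stat i) mp).
Qed.

Lemma measurable_tst B : measurable_fun setT (fun o => trunc_stat i B o.1 (@ymeas R m n x o)).
Proof.
have mp : measurable_fun setT (fun o => (o.1, @ymeas R m n x o)).
  by apply: measurable_fun_pair => //; exact: measurable_ymeas.
exact: (measurableT_comp (measurable_trunc_stat i B) mp).
Qed.

Lemma stat_mean : has_mean P1 st (N * x i ^+ 2).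
Proof.
rewrite (_ : st = (fun o => ycorr x i o ^+ 2 + (-1) * sqn (ymeas x o))); last first.
  by apply/funext => o; rewrite mulN1r.
rewrite (_ : N * x i ^+ 2 = mr * (\sum_j x j ^+ 2 + sz ^+ 2) + x i ^+ 2 * N +
   (-1) * (mr * (\sum_j x j ^+ 2 + sz ^+ 2))); last by ring.
apply: has_meanD; first exact: (ycorr_sq gauss4 gauss_sqc m sz0 x i).
by apply: has_meanZ; exact: sqn_mean.
Qed.

Lemma sum_sq_le : 0 <= \sum_j x j ^+ 2 <= tau * mr.
Proof.
rewrite sumr_ge0/=; last by move=> j _; exact: sqr_ge0.
have := sW; have := Wtau; have := sqr_ge0 sz; lra.
Qed.

Lemma noise_sq_le : 0 <= sz ^+ 2 <= tau * mr.
Proof.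
rewrite sqr_ge0/=.
have : 0 <= \sum_j x j ^+ 2 by rewrite sumr_ge0// => j _; exact: sqr_ge0.
have := sW; have := Wtau; lra.
Qed.

Lemma sqn_sq_le : mean_le P1 (fun o => sqn (ymeas x o) ^+ 2) (C2 * (mr * W) ^+ 2).
Proof.
apply: (mean_leW (sqn_sq gauss4 gauss_sqc Kn0 normalc m sz0 x)).
have [/andP[s0 _] /andP[z0 _]] := conj sum_sq_le noise_sq_le.
have h : mr * (\sum_j x j ^+ 2 + sz ^+ 2) <= mr * W by rewrite ler_wpM2l.
have h0 : 0 <= mr * (\sum_j x j ^+ 2 + sz ^+ 2) by rewrite mulr_ge0// addr_ge0.
apply: ler_wpM2l; first exact: C20.
by rewrite lerXn2r ?nnegrE// (le_trans h0).
Qed.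

Lemma ycorr_4_le : mean_le P1 (fun o => ycorr x i o ^+ 4) (C4 * mr ^+ 4).
Proof.
apply: (mean_leW (ycorr_4 gauss4 gauss_sqc Kn0 normalc m sz0 x i)).
rewrite /C4 -(mulrA (3 * Kn ^+ 2)) ler_wpM2l//; first by rewrite mulr_ge0 ?sqr_ge0.
have /andP[s0 s1] := sum_sq_le; have /andP[z0 z1] := noise_sq_le.
have [mr2 V00 K00] := And3 mr1 V0 K0.
set s := \sum_j x j ^+ 2 in s0 s1 *; set z := sz ^+ 2 in z0 z1.
have -> : sz ^+ 4 = z ^+ 2 by rewrite /z -exprM.
have -> : x i ^+ 4 = (x i ^+ 2) ^+ 2 by rewrite -exprM.
have xi0 := sqr_ge0 (x i); have m2 := sqr_ge0 mr.
have tm0 : 0 <= tau * mr by rewrite mulr_ge0//; lra.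
have h1 : (x i ^+ 2) ^+ 2 <= X ^+ 2 by rewrite lerXn2r.
have h2 : (mr ^+ 2 + K * mr) ^+ 2 <= ((1 + K) * mr ^+ 2) ^+ 2.
  rewrite lerXn2r ?nnegrE//; last 2 first.
  - by rewrite mulr_ge0//; lra.
  - by rewrite mulrDl mul1r lerD2l ler_wpM2l//; nra.
  by rewrite addr_ge0// mulr_ge0//; lra.
have h3 : (x i ^+ 2) ^+ 2 * (mr ^+ 2 + K * mr) ^+ 2 <= X ^+ 2 * ((1 + K) * mr ^+ 2) ^+ 2.
  by rewrite ler_pM ?sqr_ge0.
have h4 : s * (s * (prod_bound V * mr) ^+ 2) <= (tau * mr) ^+ 2 * (prod_bound V * mr) ^+ 2.
  by rewrite mulrA -expr2 ler_wpM2r ?sqr_ge0// lerXn2r.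
have h5 : z ^+ 2 * (mr * V + mr ^+ 2) <= (tau * mr) ^+ 2 * ((V + 1) * mr ^+ 2).
  rewrite ler_pM ?sqr_ge0 ?addr_ge0 ?mulr_ge0//; try lra.
    by rewrite lerXn2r.
  have : 0 <= V * mr * (mr - 1) by rewrite mulr_ge0 ?mulr_ge0//; lra.
  nra.
apply: le_trans (lerD (lerD h3 h4) h5) _.
rewrite le_eqVlt; apply/orP; left; apply/eqP; ring.
Qed.

Lemma stat_sq : mean_le P1 (fun o => st o ^+ 2) (Cq * mr ^+ 4).
Proof.
apply: (@mean_le_mono _ _ _ _ _ (fun o => 2 * ycorr x i o ^+ 4 + 2 * sqn (ymeas x o) ^+ 2)).
- by apply: measurable_funX; exact: measurable_st.
- by move=> o; exact: sqr_ge0.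
- move=> o; rewrite -[stat i _ _]/(ycorr x i o ^+ 2 - _).
  rewrite (_ : ycorr x i o ^+ 4 = (ycorr x i o ^+ 2) ^+ 2) -?exprM//.
  rewrite (exprM _ 2 2).
  have := sqr_ge0 (ycorr x i o ^+ 2 + sqn (ymeas x o)); nra.
have -> : Cq * mr ^+ 4 = 2 * (C4 * mr ^+ 4) + 2 * (C2 * (tau ^+ 2 * mr ^+ 4)).
  by rewrite /Cq; ring.
apply: mean_leD; apply: mean_leZ => //; first exact: ycorr_4_le.
apply: (mean_leW sqn_sq_le); apply: ler_wpM2l => //.
rewrite (_ : tau ^+ 2 * mr ^+ 4 = (mr * (tau * mr)) ^+ 2); last by ring.
have mr0 : 0 <= mr by [].
have tm0 : 0 <= tau * mr by rewrite mulr_ge0.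
by rewrite lerXn2r ?nnegrE ?(mulr_ge0 mr0) ?(ltW W0)// ler_wpM2l.
Qed.

Lemma stat_var : has_mean P1 (fun o => st o - N * x i ^+ 2) 0 /\
  exists2 v, has_mean P1 (fun o => (st o - N * x i ^+ 2) ^+ 2) v & v <= Cq * mr ^+ 4.
Proof. exact: has_mean_center_sq stat_mean stat_sq. Qed.

Local Notation tst := (fun o => trunc_stat i (M * mr * W) o.1 (@ymeas R m n x o)).

Lemma trunc_stat_sq : mean_le P1 (fun o => tst o ^+ 2) (Cq * mr ^+ 4).
Proof.
apply: (mean_le_mono _ _ _ stat_sq).
- by apply: measurable_funX; exact: measurable_tst.
- by move=> o; exact: sqr_ge0.
- move=> o; rewrite /trunc_stat; case: ifP => // _.
  by rewrite expr0n sqr_ge0.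
Qed.

(** Truncation costs at most half of the lower bound m^2 xmin^2 / 2 for the mean. *)
Lemma trunc_stat_mean : xmin <= x i -> exists2 mu, has_mean P1 tst mu &
  mr ^+ 2 * (xmin ^+ 2 / 4) <= mu.
Proof.
move=> xi.
have [mu hmu] : exists mu, has_mean P1 tst mu.
  apply: (@has_mean_dom _ _ _ _ _ (fun o => 1 + tst o ^+ 2) (1 + Cq * mr ^+ 4)).
  - exact: measurable_tst.
  - move=> o; rewrite ler_norml; have := sqr_ge0 (tst o - 1); have := sqr_ge0 (tst o + 1); nra.
  - by apply: mean_leD; [exact: mean_le_cst|exact: trunc_stat_sq].
exists mu => //.
have [mr2 V00 K00] := And3 mr1 V0 K0.
have [C200 Cq00 M11] := And3 C20 Cq0 M1.
have mr0 : 0 < mr by lra.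
set B := M * mr * W; have B0 : 0 < B by rewrite /B !mulr_gt0//; lra.
have [c1 hc1 c1le] := mean_le_has_mean stat_sq.
have [c2 hc2 c2le] := mean_le_has_mean sqn_sq_le.
(* Where sqn > B, the arithmetic-geometric mean inequality gives
   st <= a1 st^2 + m^2 / (2 eta) <= a1 st^2 + a2 sqn^2. Hence
   st - a1 st^2 - a2 sqn^2 <= tst everywhere. *)
pose a1 := eta / (2 * mr ^+ 2); pose a2 := mr ^+ 2 / (2 * eta) / B ^+ 2.
have a10 : 0 <= a1 by rewrite /a1 divr_ge0 ?(ltW eta0)// mulr_ge0// sqr_ge0.
have a20 : 0 <= a2.
  by rewrite /a2 divr_ge0 ?sqr_ge0// divr_ge0 ?sqr_ge0// mulr_ge0// ltW.
have low : has_mean P1 (fun o => st o + ((- a1) * st o ^+ 2 + (- a2) * sqn (ymeas x o) ^+ 2))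
    (N * x i ^+ 2 + ((- a1) * c1 + (- a2) * c2)).
  apply: has_meanD; first exact: stat_mean.
  by apply: has_meanD; apply: has_meanZ.
have lowmu : N * x i ^+ 2 + ((- a1) * c1 + (- a2) * c2) <= mu.
  apply: (has_mean_mono low hmu) => o; rewrite /trunc_stat -/B; case: ifP => [_|/negbT].
    have : 0 <= a1 * st o ^+ 2 by rewrite mulr_ge0// sqr_ge0.
    have : 0 <= a2 * sqn (ymeas x o) ^+ 2 by rewrite mulr_ge0// sqr_ge0.
    lra.
  rewrite -ltNge => Bs.
  have h1 : mr ^+ 2 / (2 * eta) <= a2 * sqn (ymeas x o) ^+ 2.
    rewrite /a2 [leRHS]mulrAC ler_pdivlMr ?exprn_gt0// ler_wpM2l//.
      by rewrite divr_ge0 ?sqr_ge0// mulr_ge0// ltW.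
    by rewrite lerXn2r ?nnegrE ?(ltW B0) ?(ltW Bs)// (le_trans (ltW B0) (ltW Bs)).
  have h2 : st o <= a1 * st o ^+ 2 + mr ^+ 2 / (2 * eta).
    have m2 : 0 < mr ^+ 2 by rewrite exprn_gt0.
    have : 0 <= (eta * st o - mr ^+ 2) ^+ 2 / (2 * eta * mr ^+ 2).
      by rewrite divr_ge0 ?sqr_ge0// mulr_ge0 ?(ltW m2)// mulr_ge0 ?(ltW eta0).
    suff -> : (eta * st o - mr ^+ 2) ^+ 2 / (2 * eta * mr ^+ 2) =
       a1 * st o ^+ 2 + mr ^+ 2 / (2 * eta) - st o by lra.
    by rewrite /a1; field; rewrite !gt_eqF.
  lra.
have m4 : 0 < mr ^+ 4 by rewrite exprn_gt0.
have e1 : a1 * c1 <= mr ^+ 2 * (xmin ^+ 2 / 8).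
  apply: (le_trans (ler_wpM2l a10 c1le)).
  have -> : a1 * (Cq * mr ^+ 4) = mr ^+ 2 * (xmin ^+ 2 / 8) * (Cq / (Cq + 1)).
    rewrite /a1 /eta; field; rewrite !gt_eqF//; lra.
  apply: ler_piMr; first by rewrite mulr_ge0 ?sqr_ge0// divr_ge0 ?sqr_ge0.
  by rewrite ler_pdivrMr; lra.
have e2 : a2 * c2 <= mr ^+ 2 * (xmin ^+ 2 / 8).
  apply: (le_trans (ler_wpM2l a20 c2le)).
  have -> : a2 * (C2 * (mr * W) ^+ 2) = mr ^+ 2 * (C2 / (2 * eta) / M ^+ 2).
    rewrite /a2 /B; field; rewrite !gt_eqF//; lra.
  rewrite ler_wpM2l ?sqr_ge0// ler_pdivrMr; last by rewrite exprn_gt0//; lra.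
  set c := C2 / (2 * eta).
  have xm2 : 0 < xmin ^+ 2 / 8 by rewrite divr_gt0 ?exprn_gt0.
  have -> : c = (xmin ^+ 2 / 8) * (M - 1).
    by rewrite /M addrK -/c; field; rewrite gt_eqF.
  rewrite ler_wpM2l ?(ltW xm2)//; nra.
have e3 : mr ^+ 2 * (xmin ^+ 2 / 2) <= N * x i ^+ 2.
  have -> : mr ^+ 2 * (xmin ^+ 2 / 2) = mr ^+ 2 / 2 * xmin ^+ 2 by ring.
  apply: ler_pM; [by rewrite divr_ge0 ?sqr_ge0|exact: sqr_ge0|exact: N_ge|].
  by rewrite lerXn2r ?nnegrE ?(ltW xmin0)// (le_trans (ltW xmin0)).
have -> : mr ^+ 2 * (xmin ^+ 2 / 4) = mr ^+ 2 * (xmin ^+ 2 / 2) -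
  (mr ^+ 2 * (xmin ^+ 2 / 8) + mr ^+ 2 * (xmin ^+ 2 / 8)) by field.
apply: le_trans lowmu; lra.
Qed.

End stat_moments.

(** The constants depend only on xmin, X and tau. Variances are of order m^4 and
means of order m^2, so each sample has a bounded signal-to-noise ratio. *)
Lemma stat_moment_bounds (R : realType) (xmin X tau : R) : 0 < xmin -> 0 <= X -> 0 <= tau ->
  exists C M V : R, [/\ 0 <= C, 1 <= M, 0 <= V &
  forall (m n : nat) (sz : R) (x : 'I_n -> R) (W : R) (i : 'I_n),
    (1 < m)%N -> 0 <= sz -> \sum_j x j ^+ 2 + sz ^+ 2 <= W -> 0 < W ->
    W <= tau * m%:R -> x i ^+ 2 <= X ->
    let P1 := meas_law m n sz in
    let N := m%:R * V + m%:R ^+ 2 - m%:R in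
    let st := fun o => stat i o.1 (@ymeas R m n x o) in
    let tst := fun o => trunc_stat i (M * m%:R * W) o.1 (@ymeas R m n x o) in
    [/\ m%:R ^+ 2 / 2 <= N,
      has_mean P1 (fun o => st o - N * x i ^+ 2) 0 /\
      (exists2 v, has_mean P1 (fun o => (st o - N * x i ^+ 2) ^+ 2) v & v <= C * m%:R ^+ 4)
      & xmin <= x i -> exists2 mu, m%:R ^+ 2 * (xmin ^+ 2 / 4) <= mu &
        has_mean P1 (fun o => tst o - mu) 0 /\
        (exists2 v, has_mean P1 (fun o => (tst o - mu) ^+ 2) v & v <= C * m%:R ^+ 4)]].
Proof.
move=> xmin0 X0 tau0.
have [V [K [gauss4 gaussc]]] := centered_gauss_sq R.
have [Kn Kn0 normalc] := centered_normal R.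
have V0 := V_ge0 gaussc.
do 3 eexists; split; last first.
  move=> m n sz x W i m1 sz0 sW W0 Wtau xiX /=; split.
  - exact: (N_ge gaussc m1).
  - exact: (stat_var gauss4 gaussc Kn0 normalc X0 tau0 m1 sz0 sW W0 Wtau xiX).
  - move=> xi.
    have [mu hmu mule] := trunc_stat_mean gauss4 gaussc Kn0 normalc xmin0 X0 tau0 m1 sz0 sW W0 Wtau xiX xi.
    exists mu => //.
    exact: (has_mean_center_sq hmu (trunc_stat_sq gauss4 gaussc Kn0 normalc xmin X0 tau0 m1 sz0 sW W0 Wtau xiX)).
- exact: V0.
- exact: (M_ge1 Kn gaussc X tau xmin0).
- exact: (Cq_ge0 Kn gaussc X tau).
Qed.

(** * The thresholding estimator *)

Section zip_model.
Variables (R : realType) (L m n : nat) (sz : R).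
Local Notation mx := (m.-tuple (n.-tuple R)).

(** Regroups the three families of the model into one family of samples. *)
Definition samples (o : L.-tuple mx * (L.-tuple (n.-tuple R) * L.-tuple (m.-tuple R))) :
  L.-tuple (mx * (n.-tuple R * m.-tuple R)) := ziptuple (o.1, ziptuple o.2).

Lemma measurable_samples : measurable_fun setT samples.
Proof.
apply: (measurableT_comp (@measurable_ziptuple _ _ _ _ L)).
apply: measurable_fun_pair => //.
apply: (measurableT_comp (@measurable_ziptuple _ _ _ _ L)) => //.
Qed.

Lemma pushes_samples : pushes (model_law L m n sz) (iid (meas_law m n sz) L) samples.
Proof.
move=> F mF F0.
have mFs : measurable_fun setT (F \o samples).
  exact: (measurableT_comp mF measurable_samples).
rewrite (fubini_tonelli1 (F \o samples))//; last by move=> o; exact: F0.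
rewrite -(@ge0_integral_ziptuple _ _ _ _ _ (gauss_mx R m n)
  (gauss_vec n (1 : R) \x gauss_vec m sz)%E L F mF F0).
have mz : measurable_fun setT (F \o @ziptuple _ _ mx (n.-tuple R * m.-tuple R)%type L).
  exact: (measurableT_comp mF (@measurable_ziptuple _ _ _ _ L)).
rewrite (fubini_tonelli1 (F \o @ziptuple _ _ mx _ L))//; last by move=> o; exact: F0.
apply: eq_integral => A _; rewrite /fubini_F.
have mA : measurable_fun setT (fun u : L.-tuple (n.-tuple R * m.-tuple R) => F (ziptuple (A, u))).
  by apply: (measurableT_comp mz); exact: measurable_pair1.
exact: (@ge0_integral_ziptuple _ _ _ _ _ (gauss_vec n (1 : R)) (gauss_vec m sz) L _ mA).
Qed.

Lemma observationE (xo : 'cV[R]_n) A w z :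
  observation xo A w z = [tuple ymeas (fun j => xo j ord0) (tnth (samples (A, (w, z))) l) | l < L].
Proof.
apply: eq_from_tnth => l; rewrite !tnth_mktuple; apply: eq_from_tnth => p.
rewrite !tnth_mktuple /= mul_mx_diag !mxE; congr (_ + _).
by apply: eq_bigr => j _; rewrite !mxE /ent mulrA.
Qed.

End zip_model.

Lemma measurable_sqrtr (R : realType) : measurable_fun setT (@Num.sqrt R).
Proof. by apply: continuous_measurable_fun; exact: sqrt_continuous. Qed.

Section estimate_error.
Variable R : realType.
Implicit Types theta D thr mu x xmin xmax lam : R.

Definition shrink xmax theta D thr : R :=
  if D < thr then 0 else Num.min (Num.sqrt theta) xmax.

(** If D misses the coordinate, the error is at most xmax^2 while
(D - mu)^2 >= thr^2. Otherwise clipping at xmax only helps, and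
|theta^(1/2) - x| <= |theta - x^2| / xmin. *)
Lemma shrink_signal xmin xmax theta D thr mu x :
  0 < xmin -> xmin <= x <= xmax -> 0 < thr -> 2 * thr <= mu ->
  (shrink xmax theta D thr - x) ^+ 2 <=
    xmin ^- 2 * (theta - x ^+ 2) ^+ 2 + xmax ^+ 2 / thr ^+ 2 * (D - mu) ^+ 2.
Proof.
move=> xmin0 /andP[xmx xxM] thr0 thrmu; rewrite /shrink.
have x0 : 0 < x by apply: lt_le_trans xmx.
have [Dt|_] := ltP D thr.
  rewrite sub0r sqrrN.
  apply: (@le_trans _ _ (xmax ^+ 2 / thr ^+ 2 * (D - mu) ^+ 2)); last first.
    by rewrite lerDr mulr_ge0 ?sqr_ge0// invr_ge0 sqr_ge0.
  have h1 : x ^+ 2 <= xmax ^+ 2 by rewrite lerXn2r ?nnegrE ?(ltW x0)// (le_trans (ltW x0)).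
  have h2 : 1 <= (D - mu) ^+ 2 / thr ^+ 2.
    by rewrite ler_pdivlMr ?exprn_gt0// mul1r -[leRHS]sqrrN lerXn2r ?nnegrE; lra.
  rewrite mulrAC -mulrA; apply: le_trans h1 _.
  by rewrite ler_peMr ?sqr_ge0.
apply: (@le_trans _ _ (xmin ^- 2 * (theta - x ^+ 2) ^+ 2)); last first.
  by rewrite lerDl mulr_ge0 ?sqr_ge0// divr_ge0 ?sqr_ge0.
rewrite mulrC ler_pdivlMr ?exprn_gt0// -exprMn.
have q0 : 0 <= Num.sqrt theta by exact: sqrtr_ge0.
set q := Num.sqrt theta in q0 *.
have h1 : `|Num.min q xmax - x| <= `|q - x|.
  rewrite minEle; case: ifP => // /negbT; rewrite -ltNge => xq.
  by rewrite !ger0_norm; lra.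
have h2 : `|q - x| * xmin <= `|theta - x ^+ 2|.
  have [t0|t0] := leP 0 theta.
    rewrite -(sqr_sqrtr t0) -/q subr_sqr normrM ler_wpM2l//.
    by rewrite ger0_norm; lra.
  rewrite /q ler0_sqrtr ?ltW// sub0r normrN (gtr0_norm x0) ltr0_norm.
    by nra.
  by have := sqr_ge0 x; lra.
rewrite -[leLHS]real_normK ?num_real// -[leRHS]real_normK ?num_real// lerXn2r ?nnegrE//.
rewrite normrM (gtr0_norm xmin0); apply: le_trans h2.
by rewrite ler_wpM2r// ltW.
Qed.

(** Chernoff's bound, before taking means: the indicator of D >= thr is at most
exp(lam (D - thr)). *)
Lemma shrink_null xmax theta D thr lam : 0 < xmax -> 0 <= lam ->
  shrink xmax theta D thr ^+ 2 <= xmax ^+ 2 * (expR (- (lam * thr)) * expR (lam * D)).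
Proof.
move=> xM lam0; rewrite /shrink -expRD; case: ltP => Dt.
  by rewrite expr0n mulr_ge0 ?sqr_ge0// expR_ge0.
rewrite -[leLHS]mulr1; apply: ler_pM => //; first exact: sqr_ge0.
  rewrite lerXn2r ?nnegrE ?(ltW xM)//; last by rewrite ge_min lexx orbT.
  by rewrite le_min sqrtr_ge0 ltW.
rewrite -[leLHS]expR0 ler_expR addrC subr_ge0 ler_wpM2l//.
Qed.

End estimate_error.

Section estimator_construction.
Variables (R : realType) (L m n : nat).
Local Notation mx := (m.-tuple (n.-tuple R)).
Variables (xmax B thr scale : R).

Definition est_theta i (Y : L.-tuple (m.-tuple R)) (A : L.-tuple mx) : R :=
  (\sum_l stat i (tnth A l) (tnth Y l)) / scale.

Definition est_detect i (Y : L.-tuple (m.-tuple R)) (A : L.-tuple mx) : R :=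
  \sum_l trunc_stat i B (tnth A l) (tnth Y l).

Definition est_fun (YA : L.-tuple (m.-tuple R) * L.-tuple mx) : n.-tuple R :=
  [tuple shrink xmax (est_theta i YA.1 YA.2) (est_detect i YA.1 YA.2) thr | i < n].

Lemma measurable_shrink d (T : measurableType d) (f g : T -> R) :
  measurable_fun setT f -> measurable_fun setT g ->
  measurable_fun setT (fun x => shrink xmax (f x) (g x) thr).
Proof.
move=> mf mg; apply: measurable_fun_ifT => //.
  exact: measurable_fun_ltr.
apply: measurable_minr => //.
exact: (measurableT_comp (@measurable_sqrtr R) mf).
Qed.

Lemma measurable_est_fun : measurable_fun setT est_fun.
Proof.
apply: measurable_mktuple => i; apply: measurable_shrink.
  apply: measurable_funM => //; apply: measurable_sum => l.
  apply: (measurableT_comp (@measurable_stat R m n i)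
    (g := fun YA : L.-tuple (m.-tuple R) * L.-tuple mx => (tnth YA.2 l, tnth YA.1 l))).
  by solve_measurable.
apply: measurable_sum => l.
apply: (measurableT_comp (@measurable_trunc_stat R m n i B)
    (g := fun YA : L.-tuple (m.-tuple R) * L.-tuple mx => (tnth YA.2 l, tnth YA.1 l))).
by solve_measurable.
Qed.

Definition est : estimator R L m n :=
  HB.pack est_fun (isMeasurableFun.Build _ _ _ _ est_fun measurable_est_fun).

End estimator_construction.

Section upper.
Variables (R : realType) (xmin xmax : R).
Hypothesis xmin0 : 0 < xmin.
Hypothesis xminmax : xmin < xmax.

Let xmax0 : 0 < xmax. Proof. exact: lt_trans xminmax. Qed.

Lemma mean_le_iid_sum_sq d (T : measurableType d) (P : probability T R) L (f : T -> R) mu v c :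
  has_mean P (fun o => f o - mu) 0 -> has_mean P (fun o => (f o - mu) ^+ 2) v -> v <= c ->
  mean_le (iid P L) (fun t => (\sum_l f (tnth t l) - L%:R * mu) ^+ 2) (L%:R * c).
Proof.
move=> f1 f2 vc.
have h := has_mean_iid_sq (fun l : 'I_L => 1) 0 f1 f2.
apply: (has_mean_le (v := L%:R * v)); last 2 first.
- by move=> t; exact: sqr_ge0.
- by rewrite ler_wpM2l.
rewrite sum1sq expr0n addr0 in h.
rewrite (_ : (fun t => _) =
  (fun t => (\sum_i 1 * (f (tnth t i) - mu) + 0) ^+ 2)); first exact: h.
apply/funext => t; rewrite addr0; congr (_ ^+ 2).
under [RHS]eq_bigr do rewrite mul1r.
by rewrite sumrB sumr_const card_ord mulr_natl.
Qed.

Section coordinate.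
Variables (m n L : nat) (sz : R) (x : 'I_n -> R) (i : 'I_n).
Variables (B N C mu t : R).
Hypothesis L0 : (0 < L)%N.
Hypothesis m0 : (0 < m)%N.
Local Notation mr := (m%:R : R).
Local Notation Lr := (L%:R : R).
Local Notation mx := (m.-tuple (n.-tuple R)).
Local Notation smp := (mx * (n.-tuple R * m.-tuple R))%type.
Local Notation P1 := (meas_law m n sz).
Local Notation st := (fun o : smp => stat i o.1 (ymeas x o)).
Local Notation tst := (fun o : smp => trunc_stat i B o.1 (ymeas x o)).

Let thr := Lr * (mr ^+ 2 * t).

(** The i-th entry of the estimator [est], as a function of the samples. *)
Definition coord_est (s : L.-tuple smp) : R :=
  shrink xmax ((\sum_l st (tnth s l)) / (Lr * N)) (\sum_l tst (tnth s l)) thr.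

Lemma measurable_coord_est : measurable_fun setT coord_est.
Proof.
have mp : measurable_fun setT (fun o => (o.1, @ymeas R m n x o)).
  by apply: measurable_fun_pair => //; exact: measurable_ymeas.
apply: measurable_shrink.
  apply: measurable_funM => //; apply: measurable_sum => l.
  exact: (measurableT_comp (measurableT_comp (measurable_stat i) mp) (measurable_tnth l)).
apply: measurable_sum => l.
exact: (measurableT_comp (measurableT_comp (measurable_trunc_stat i B) mp) (measurable_tnth l)).
Qed.

Lemma coord_signal v v' : xmin <= x i <= xmax -> 0 < t -> 0 <= C ->
  mr ^+ 2 / 2 <= N -> 2 * (mr ^+ 2 * t) <= mu ->
  has_mean P1 (fun o => st o - N * x i ^+ 2) 0 ->
  has_mean P1 (fun o => (st o - N * x i ^+ 2) ^+ 2) v -> v <= C * mr ^+ 4 ->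
  has_mean P1 (fun o => tst o - mu) 0 ->
  has_mean P1 (fun o => (tst o - mu) ^+ 2) v' -> v' <= C * mr ^+ 4 ->
  mean_le (iid P1 L) (fun s => (coord_est s - x i) ^+ 2)
    ((4 * C / xmin ^+ 2 + xmax ^+ 2 * C / t ^+ 2) / Lr).
Proof.
move=> xi t0 C0 hN hmu s1 s2 vC u1 u2 vC'.
have Lr0 : 0 < Lr by rewrite ltr0n.
have mr0 : 0 < mr by rewrite ltr0n.
have m2 : 0 < mr ^+ 2 by rewrite exprn_gt0.
have N0 : 0 < N by apply: lt_le_trans hN; rewrite divr_gt0.
have thr0 : 0 < thr by rewrite /thr !mulr_gt0.
have hs := mean_le_iid_sum_sq L s1 s2 vC.
have hu := mean_le_iid_sum_sq L u1 u2 vC'.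
pose a := (xmin * (Lr * N)) ^- 2.
pose b := xmax ^+ 2 / thr ^+ 2.
have a0 : 0 <= a by rewrite invr_ge0 sqr_ge0.
have b0 : 0 <= b by rewrite divr_ge0 ?sqr_ge0.
apply: (@mean_leW _ _ _ _ _ (a * (Lr * (C * mr ^+ 4)) + b * (Lr * (C * mr ^+ 4)))); last first.
  rewrite mulrDl; apply: lerD.
    have -> : 4 * C / xmin ^+ 2 / Lr = (xmin * (Lr * (mr ^+ 2 / 2))) ^- 2 * (Lr * (C * mr ^+ 4)).
      by field; rewrite !gt_eqF.
    apply: ler_wpM2r; first by rewrite !mulr_ge0 ?exprn_even_ge0// ltW.
    have p0 : 0 < xmin * (Lr * (mr ^+ 2 / 2)) by rewrite !mulr_gt0// invr_gt0.
    have q0 : 0 < xmin * (Lr * N) by rewrite !mulr_gt0.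
    rewrite lef_pV2 ?posrE ?exprn_gt0// lerXn2r ?nnegrE ?(ltW p0) ?(ltW q0)//.
    by rewrite ler_pM2l// ler_pM2l.
  by rewrite le_eqVlt; apply/orP; left; apply/eqP; rewrite /b /thr; field; rewrite !gt_eqF.
apply: (mean_le_mono _ _ _ (mean_leD (mean_leZ a0 hs) (mean_leZ b0 hu))).
- by apply: measurable_funX; apply: measurable_funB => //; exact: measurable_coord_est.
- by move=> s; exact: sqr_ge0.
move=> s; have hmu' : 2 * thr <= Lr * mu.
  by rewrite /thr mulrCA ler_wpM2l// ltW.
apply: (le_trans (shrink_signal _ _ xmin0 xi thr0 hmu')).
rewrite lerD2r le_eqVlt; apply/orP; left; apply/eqP.
rewrite /a; field; rewrite !gt_eqF//.
Qed.

Lemma coord_null s0 : x i = 0 -> 0 < B -> 0 <= s0 <= 8^-1 ->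
  mean_le (iid P1 L) (fun s => (coord_est s - x i) ^+ 2)
    (xmax ^+ 2 * expR (Lr * (2 * s0 ^+ 2 - s0 / B * (mr ^+ 2 * t)))).
Proof.
move=> xi B0 s08; have l0 : 0 <= s0 / B by rewrite divr_ge0 ?(ltW B0)//; case/andP: s08.
have h := mean_le_iid_prod (fun l : 'I_L => trunc_stat_mgf m sz xi B0 s08).
rewrite prodr_const card_ord in h.
apply: (@mean_leW _ _ _ _ _ (xmax ^+ 2 * (expR (- (s0 / B * thr)) * expR (2 * s0 ^+ 2) ^+ L))); last first.
  rewrite ler_wpM2l ?sqr_ge0// -expRM_natl -expRD ler_expR /thr.
  rewrite le_eqVlt; apply/orP; left; apply/eqP; ring.
apply: (mean_le_mono _ _ _ (mean_leZ (sqr_ge0 xmax) (mean_leZ (expR_ge0 _) h))).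
- by apply: measurable_funX; apply: measurable_funB => //; exact: measurable_coord_est.
- by move=> s; exact: sqr_ge0.
move=> s; rewrite xi subr0 -expR_sum -mulr_sumr.
exact: shrink_null.
Qed.

End coordinate.

Lemma mse_est_le (m n L : nat) (sz : R) (xo : 'cV[R]_n) (B N t : R) (v : 'I_n -> R) :
  (forall i, mean_le (iid (meas_law m n sz) L)
     (fun s => (@coord_est m n L (fun j => xo j ord0) i B N t s - xo i ord0) ^+ 2) (v i)) ->
  (mse sz (est L m n xmax B (L%:R * (m%:R ^+ 2 * t)) (L%:R * N)) xo <=
    ((\sum_i v i) / n%:R)%:E)%E.
Proof.
move=> hv; rewrite /mse unlock.
pose F (s : L.-tuple (m.-tuple (n.-tuple R) * (n.-tuple R * m.-tuple R))) : R := 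
  n%:R^-1 * \sum_i (@coord_est m n L (fun j => xo j ord0) i B N t s - xo i ord0) ^+ 2.
have [mF F0 hF] : mean_le (iid (meas_law m n sz) L) F (n%:R^-1 * \sum_i v i).
  by apply: mean_leZ; [rewrite invr_ge0|exact: mean_le_sum].
rewrite [X in (_ <= X%:E)%E]mulrC; apply: le_trans hF.
rewrite -(@pushes_samples R L m n sz (EFin \o F)); last 2 first.
- exact/measurable_EFinP.
- by move=> s; rewrite lee_fin.
rewrite le_eqVlt; apply/orP; left; apply/eqP; apply: eq_integral => -[A [w z]] _ /=.
congr EFin; rewrite /F mulrC; congr (_ * _); apply: eq_bigr => i _.
rewrite !mxE observationE tnth_mktuple /coord_est; congr ((shrink _ _ _ _ - _) ^+ 2).
  congr (_ / _); apply: eq_bigr => l _; congr stat; last by rewrite tnth_mktuple.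
  by rewrite tnth_mktuple.
apply: eq_bigr => l _; congr trunc_stat; last by rewrite tnth_mktuple.
by rewrite tnth_mktuple.
Qed.

Definition zero_fun (m n L : nat) (YA : L.-tuple (m.-tuple R) * L.-tuple (m.-tuple (n.-tuple R))) :
  n.-tuple R := [tuple 0 | i < n].

Definition zero_est (m n L : nat) : estimator R L m n :=
  HB.pack (@zero_fun m n L) (isMeasurableFun.Build _ _ _ _ (@zero_fun m n L) (measurable_cst _)).

Lemma mse_zero (m n L : nat) (sz : R) (xo : 'cV[R]_n) :
  mse sz (zero_est m n L) xo = ((\sum_i xo i ord0 ^+ 2) / n%:R)%:E.
Proof.
rewrite /mse unlock; set c := (_ / _).
have [_ _ <-] := has_mean_cst (model_law L m n sz) c.
apply: eq_integral => -[A [w z]] _; congr (_ / _)%:E.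
by apply: eq_bigr => i _; rewrite !mxE tnth_mktuple sub0r sqrrN.
Qed.

Lemma sparse_sum_le n k (xo : 'cV[R]_n) (c : R) (v : 'I_n -> R) (c0 : R) :
  sparse_bdd k xmin xmax xo -> 0 <= c -> 0 <= c0 ->
  (forall i, v i <= (if xo i ord0 == 0 then c0 else c)) ->
  \sum_i v i <= k%:R * c + n%:R * c0.
Proof.
move=> [kx _] cge c0ge hv; apply: (@le_trans _ _ (\sum_i ((if xo i ord0 != 0 then c else 0) + c0))).
  by apply: ler_sum => i _; apply: (le_trans (hv i)); case: eqP => _; rewrite ?add0r// lerDl.
rewrite big_split/= [X in _ + X]sumr_const card_ord -[c0 *+ n]mulr_natl lerD2r.
rewrite -big_mkcond/= sumr_const -[c *+ _]mulr_natl ler_wpM2r// ler_nat.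
by apply: leq_trans kx; rewrite /l0norm cardsE.
Qed.

Lemma sparse_sqnorm n k (xo : 'cV[R]_n) :
  sparse_bdd k xmin xmax xo -> \sum_i xo i ord0 ^+ 2 <= k%:R * xmax ^+ 2.
Proof.
move=> hx; have := @sparse_sum_le n k xo (xmax ^+ 2) (fun i => xo i ord0 ^+ 2) 0 hx.
rewrite mulr0 addr0; apply => //; first exact: sqr_ge0.
move=> i; case: eqP => [->|/eqP xi]; first by rewrite expr0n.
have [_ /(_ i)[x0|/andP[x1 x2]]] := hx; first by rewrite x0 eqxx in xi.
by rewrite lerXn2r ?nnegrE ?(ltW xmax0)// (le_trans (ltW xmin0)).
Qed.

End upper.

(** * Upper bound on the minimax risk *)

Section log_facts.
Variable R : realType.

Lemma ln2_gt0 : 0 < ln 2 :> R.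
Proof. by rewrite ln_gt0// ltr1n. Qed.

Lemma ln_ratio_facts (n k : nat) : (0 < k)%N -> k%:R <= n%:R / 2 :> R ->
  [/\ 0 < n%:R :> R, ln 2 <= ln (n%:R / k%:R) :> R,
      ln (expR 1 * n%:R / k%:R) = 1 + ln (n%:R / k%:R) :> R
    & expR (- ln (n%:R / k%:R)) = k%:R / n%:R :> R].
Proof.
move=> k0 kn; have kr0 : 0 < k%:R :> R by rewrite ltr0n.
have n0 : 0 < n%:R :> R by lra.
have r0 : 0 < n%:R / k%:R :> R by rewrite divr_gt0.
split => //.
- by rewrite ler_ln ?posrE// ler_pdivlMr//; lra.
- by rewrite -mulrA lnM ?posrE ?expR_gt0// expRK.
- by rewrite expRN lnK ?posrE// invf_div.
Qed.

End log_facts.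

Lemma minimax_risk_le (R : realType) L n (D : set 'cV[R]_n) m sz (xhat : estimator R L m n) (c : R) :
  (forall xo, D xo -> (mse sz xhat xo <= c%:E)%E) ->
  (minimax_risk L D m sz <= c%:E)%E.
Proof.
move=> h; apply: (@le_trans _ _ (ereal_sup [set mse sz xhat xo | xo in D])).
  by apply: ereal_inf_lbound; exists xhat.
by apply: ge_ereal_sup => _ [xo Dxo <-]; exact: h.
Qed.

(** Here q stands for m^2 / B. Half of the gain s t q pays for the term 2 s^2; the
other half is al (1 + lam), and l al >= 1 turns l al lam into at least lam. *)
Lemma chernoff_exponent (R : realFieldType) (s t c al lam l q : R) :
  0 <= s -> 0 <= t -> s <= c * t / 4 -> al = s * c * t / 2 ->
  0 <= lam -> c * (1 + lam) <= q -> 1 <= l * al ->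
  l * (2 * s ^+ 2 - s * t * q) <= - lam + - (l * al).
Proof.
move=> s0 t0 sc alE lam0 cq lal1.
have h1 : s * t * (c * (1 + lam)) <= s * t * q by rewrite ler_wpM2l// mulr_ge0.
have h2 : s * s <= s * (c * t / 4) by rewrite ler_wpM2l.
have al0 : 0 <= al by rewrite alE; have := sqr_ge0 s; nra.
have l0 : 0 <= l by rewrite leNgt; apply/negP => /ltW l0; have := mulr_le0_ge0 l0 al0; lra.
have h3 : 2 * s ^+ 2 - s * t * q <= - (al * (1 + lam)).
  have : 0 <= al * lam by rewrite mulr_ge0.
  rewrite alE; lra.
apply: (le_trans (ler_wpM2l l0 h3)).
have : 0 <= (l * al - 1) * lam by rewrite mulr_ge0// subr_ge0.
lra.
Qed.

(** For [est], each coordinate of the support costs a constant over L, and the zero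
coordinates together cost n exp(- ln (n / k) - L al) <= k / (L al). *)
Lemma minimax_upper (R : realType) (xmin xmax : R) : 0 < xmin -> xmin < xmax ->
  exists2 C : R, 0 < C & forall (m n L k : nat) (sz : R),
    (0 < L)%N -> (0 < k)%N -> k%:R <= n%:R / 2 :> R ->
    k%:R * ln (expR 1 * n%:R / k%:R) <= m%:R :> R -> 0 <= sz ->
    (minimax_risk L (@sparse_bdd R n k xmin xmax) m sz <=
     (C * (k%:R / (n%:R * L%:R) + sz ^+ 2 * k%:R * ln (n%:R / k%:R) / (m%:R * n%:R)))%:E)%E.
Proof.
move=> xmin0 xminmax; have xmax0 : 0 < xmax by exact: lt_trans xminmax.
have l20 := ln2_gt0 R.
(* Chosen so that W (1 + ln (n / k)) <= tau m, see Wlam. *)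
pose tau : R := xmax ^+ 2 + (ln 2)^-1 + 1.
have xm2 : 0 < xmax ^+ 2 by rewrite exprn_gt0.
have il2 : 0 < (ln 2)^-1 :> R by rewrite invr_gt0.
have tau0 : 0 < tau by rewrite /tau !addr_gt0.
have [C0 [M [V [C00 M1 V0 pack]]]] := stat_moment_bounds xmin0 (ltW xm2) (ltW tau0).
have M0 : 0 < M by lra.
pose t := xmin ^+ 2 / 8.
have t0 : 0 < t by rewrite divr_gt0// exprn_gt0.
pose c1 := (M * tau)^-1.
have c10 : 0 < c1 by rewrite invr_gt0 mulr_gt0.
(* Small enough for the quadratic term of the exponent to be at most half of the
   linear one. *)
pose s0 := Num.min 8^-1 (c1 * t / 4).
have s00 : 0 < s0.
  rewrite /s0 lt_min; apply/andP; split; first by rewrite invr_gt0.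
  by rewrite divr_gt0// mulr_gt0.
have s08 : 0 <= s0 <= 8^-1 by rewrite (ltW s00)/= ge_min lexx.
have s0c : s0 <= c1 * t / 4 by rewrite ge_min lexx orbT.
pose al := s0 * c1 * t / 2.
have al0 : 0 < al by rewrite divr_gt0// !mulr_gt0.
pose K1 := 4 * C0 / xmin ^+ 2 + xmax ^+ 2 * C0 / t ^+ 2.
have K10 : 0 <= K1 by rewrite addr_ge0// divr_ge0 ?sqr_ge0// mulr_ge0// sqr_ge0.
pose C := K1 + xmax ^+ 2 / al + xmax ^+ 2.
have xal0 : 0 < xmax ^+ 2 / al by rewrite divr_gt0.
have K1C : K1 <= C by rewrite /C -addrA lerDl addr_ge0 ?(ltW xal0) ?(ltW xm2).
have alC : xmax ^+ 2 / al <= C by rewrite /C addrAC lerDr addr_ge0 ?(ltW xm2).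
have xmC : xmax ^+ 2 <= C by rewrite /C lerDr addr_ge0 ?(ltW xal0).
have C_gt0 : 0 < C by exact: lt_le_trans xm2 xmC.
exists C => // m n L k sz L0 k0 kn km sz0.
have [nr0 lam2 lne expl] := ln_ratio_facts k0 kn.
rewrite lne in km; move: lam2 km expl; set lam := ln (n%:R / k%:R) => lam2 km expl.
have kr1 : 1 <= k%:R :> R by rewrite ler1n.
have kr0 : 0 < k%:R :> R by exact: lt_le_trans kr1.
have lam0 : 0 < lam by exact: lt_le_trans lam2.
have Lr0 : 0 < L%:R :> R by rewrite ltr0n.
have mgt1 : 1 < m%:R :> R.
  apply: lt_le_trans km; apply: (@lt_le_trans _ _ (1 + lam)); first by rewrite ltrDl.
  by rewrite ler_peMl// addr_ge0// ltW.
have m1 : (1 < m)%N by rewrite -(ltr1n R).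
have mr0 : 0 < m%:R :> R by exact: lt_trans mgt1.
have m0 : (0 < m)%N by exact: ltnW.
have sz2 := sqr_ge0 sz.
pose noise := sz ^+ 2 * lam / m%:R.
have noise0 : 0 <= noise by rewrite divr_ge0 ?mulr_ge0// ltW.
have targetE : C * (k%:R / (n%:R * L%:R) + sz ^+ 2 * k%:R * lam / (m%:R * n%:R)) =
   k%:R / n%:R * (C * (L%:R^-1 + noise)).
  by rewrite /noise; field; rewrite !gt_eqF.
rewrite targetE.
have kn0 : 0 <= k%:R / n%:R :> R by rewrite divr_ge0// ltW.
have iL0 : 0 < L%:R^-1 :> R by rewrite invr_gt0.
have zero_case : xmax ^+ 2 <= C * (L%:R^-1 + noise) ->
    (minimax_risk L (@sparse_bdd R n k xmin xmax) m sz <=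
     (k%:R / n%:R * (C * (L%:R^-1 + noise)))%:E)%E.
  move=> h; apply: (minimax_risk_le (xhat := zero_est R m n L)) => xo hxo.
  rewrite mse_zero lee_fin; apply: le_trans (ler_wpM2l kn0 h).
  by rewrite mulrAC ler_wpM2r ?invr_ge0//; exact: (sparse_sqnorm xmin0 xminmax).
(* Too few samples, or too much noise: the target is at least of order k / n. *)
have [Lal|Lal] := ltP (L%:R * al) 1.
  apply: zero_case.
  apply: (@le_trans _ _ (xmax ^+ 2 / al * L%:R^-1)).
    rewrite -[leLHS]mulr1 -mulrA ler_wpM2l ?(ltW xm2)//.
    by rewrite -invfM -[leLHS]invr1 lef_pV2 ?posrE ?mulr_gt0// mulrC ltW.
  by apply: ler_pM; [exact: ltW|exact: ltW|exact: alC|rewrite lerDl].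
have [szm|szm] := ltP m%:R (sz ^+ 2 * lam).
  apply: zero_case.
  have n1 : 1 <= noise by rewrite /noise ler_pdivlMr// mul1r ltW.
  by rewrite -[leLHS]mulr1; apply: ler_pM => //; [exact: ltW|rewrite ler_wpDl ?(ltW iL0)].
pose W := k%:R * xmax ^+ 2 + sz ^+ 2.
have W0 : 0 < W by rewrite /W ltr_pwDl// mulr_gt0.
have Wlam : W * (1 + lam) <= tau * m%:R.
  have h1 : k%:R * xmax ^+ 2 * (1 + lam) <= xmax ^+ 2 * m%:R.
    by rewrite mulrAC mulrC ler_wpM2l// ltW.
  have h2 : sz ^+ 2 <= (ln 2)^-1 * m%:R.
    rewrite mulrC ler_pdivlMr//; apply: le_trans szm.
    by rewrite ler_wpM2l.
  have -> : W * (1 + lam) = k%:R * xmax ^+ 2 * (1 + lam) + sz ^+ 2 + sz ^+ 2 * lam.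
    by rewrite /W; ring.
  have -> : tau * m%:R = xmax ^+ 2 * m%:R + (ln 2)^-1 * m%:R + m%:R by rewrite /tau; ring.
  by apply: lerD => //; apply: lerD.
have Wtau : W <= tau * m%:R.
  apply: le_trans Wlam; by rewrite ler_peMr ?(ltW W0)// lerDl ltW.
pose B := M * m%:R * W.
have B0 : 0 < B by rewrite !mulr_gt0.
pose N : R := m%:R * V + m%:R ^+ 2 - m%:R.
pose v1 := K1 / L%:R.
pose v0 := xmax ^+ 2 * expR (L%:R * (2 * s0 ^+ 2 - s0 / B * (m%:R ^+ 2 * t))).
have v10 : 0 <= v1 by rewrite divr_ge0.
have v00 : 0 <= v0 by rewrite mulr_ge0 ?expR_ge0// ltW.
have nv0 : n%:R * v0 <= k%:R * (xmax ^+ 2 / al / L%:R).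
  have mB : c1 * (1 + lam) <= m%:R ^+ 2 / B.
    have -> : m%:R ^+ 2 / B = m%:R / (M * W).
      by rewrite /B; field; rewrite !gt_eqF.
    rewrite /c1 ler_pdivlMr ?mulr_gt0//.
    have -> : (M * tau)^-1 * (1 + lam) * (M * W) = W * (1 + lam) / tau.
      by field; rewrite !gt_eqF.
    by rewrite ler_pdivrMr// [leRHS]mulrC.
  have expo : L%:R * (2 * s0 ^+ 2 - s0 / B * (m%:R ^+ 2 * t)) <= - lam + - (L%:R * al).
    have -> : s0 / B * (m%:R ^+ 2 * t) = s0 * t * (m%:R ^+ 2 / B) by field; rewrite gt_eqF.
    exact: (chernoff_exponent (ltW s00) (ltW t0) s0c _ (ltW lam0) mB Lal).
  have Lal0 : 0 < L%:R * al by rewrite mulr_gt0.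
  have e1 : expR (- (L%:R * al)) <= (L%:R * al)^-1.
    rewrite expRN lef_pV2 ?posrE ?expR_gt0//.
    by apply: le_trans (expR_ge1Dx _); rewrite lerDr.
  have e2 : expR (L%:R * (2 * s0 ^+ 2 - s0 / B * (m%:R ^+ 2 * t))) <=
      k%:R / n%:R * (L%:R * al)^-1.
    apply: (@le_trans _ _ (expR (- lam + - (L%:R * al)))); first by rewrite ler_expR.
    by rewrite expRD expl ler_wpM2l.
  have -> : k%:R * (xmax ^+ 2 / al / L%:R) = n%:R * (xmax ^+ 2 * (k%:R / n%:R * (L%:R * al)^-1)).
    by field; rewrite !gt_eqF.
  by rewrite ler_wpM2l ?(ltW nr0)// ler_wpM2l// ltW.
apply: (minimax_risk_le (xhat := est L m n xmax B (L%:R * (m%:R ^+ 2 * t)) (L%:R * N))) => xo hxo.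
have sqx := sparse_sqnorm xmin0 xminmax hxo.
have [_ xoi] := hxo.
apply: (le_trans (mse_est_le (v := fun i => if xo i ord0 == 0 then v0 else v1) _)).
  move=> i.
  have xi2 : xo i ord0 ^+ 2 <= xmax ^+ 2.
    case: (xoi i) => [->|/andP[xi1 xi2]]; first by rewrite expr0n ltW.
    by rewrite lerXn2r ?nnegrE ?(ltW xmax0)// (le_trans (ltW xmin0)).
  have sW : \sum_j xo j ord0 ^+ 2 + sz ^+ 2 <= W by rewrite lerD2r.
  have /= [hN [s1 [vs s2 vsC]] hdet] := pack m n sz (fun j => xo j ord0) W i m1 sz0 sW W0 Wtau xi2.
  case: eqP => [xi0|/eqP xi0].
    exact: (coord_null xmin0 xminmax m L sz (x := fun j => xo j ord0) N t xi0 B0 s08).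
  have xi : xmin <= xo i ord0 <= xmax.
    by case: (xoi i) => // x0; rewrite x0 eqxx in xi0.
  have [mu hmu [u1 [vu u2 vuC]]] := hdet (andP xi).1.
  have hmu' : 2 * (m%:R ^+ 2 * t) <= mu.
    apply: le_trans hmu; rewrite mulrCA ler_wpM2l ?sqr_ge0//.
    by rewrite le_eqVlt; apply/orP; left; apply/eqP; rewrite /t; field.
  exact: (coord_signal (x := fun j => xo j ord0) (i := i) (B := B) (N := N)
    xmin0 L0 m0 xi t0 C00 hN hmu' s1 s2 vsC u1 u2 vuC).
rewrite lee_fin mulrAC ler_wpM2r ?invr_ge0 ?(ltW nr0)//.
have := @sparse_sum_le R xmin xmax n k xo v1
  (fun i => if xo i ord0 == 0 then v0 else v1) v0 hxo v10 v00 (fun i => lexx _).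
move=> /le_trans; apply.
apply: (le_trans (lerD (lexx _) nv0)).
rewrite -mulrDr ler_wpM2l ?(ltW kr0)// /v1 -mulrDl.
apply: ler_pM; [exact: addr_ge0 (ltW xal0)|exact: ltW| |by rewrite lerDl].
by rewrite /C lerDl ltW.
Qed.

(** * Two-point comparison along one coordinate *)

Section reweights_product.
Context d1 d2 d3 (T : measurableType d1) (T' : measurableType d2)
  (U : measurableType d3) (R : realType).
Context (P : probability T R) (P' : probability T' R) (Q : probability U R).
Context (phi : T' -> T) (rho : T -> R).
Hypothesis mphi : measurable_fun setT phi.
Hypothesis mrho : measurable_fun setT rho.
Hypothesis rho0 : forall x, 0 <= rho x.
Hypothesis H : reweights P P' phi rho.

Lemma reweights_prodr : reweights (Q \x P)%E (Q \x P')%E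
  (fun z => (z.1, phi z.2)) (fun z => rho z.2).
Proof.
move=> f mf f0.
have mg : measurable_fun setT (fun z : U * T' => f (z.1, phi z.2)).
  apply: (measurableT_comp mf); apply: measurable_fun_pair => //.
  exact: (measurableT_comp mphi measurable_snd).
have mr : measurable_fun setT (fun z : U * T => (f z * (rho z.2)%:E)%E).
  apply: emeasurable_funM => //; apply/measurable_EFinP.
  exact: (measurableT_comp mrho measurable_snd).
rewrite (fubini_tonelli1 (fun z : U * T' => f (z.1, phi z.2)) mg); last by move=> z; exact: f0.
rewrite (fubini_tonelli1 (fun z : U * T => (f z * (rho z.2)%:E)%E) mr); last first.
  by move=> z; rewrite mule_ge0// lee_fin.
apply: eq_integral => x _; rewrite /fubini_F /=.
apply: (H (f := fun y => f (x, y))) => // .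
by apply: (measurableT_comp mf); exact: measurable_pair1.
Qed.

Lemma reweights_prodl : reweights (P \x Q)%E (P' \x Q)%E
  (fun z => (phi z.1, z.2)) (fun z => rho z.1).
Proof.
move=> f mf f0.
have mg : measurable_fun setT (fun z : T' * U => f (phi z.1, z.2)).
  apply: (measurableT_comp mf); apply: measurable_fun_pair => //.
  exact: (measurableT_comp mphi measurable_fst).
have mr : measurable_fun setT (fun z : T * U => (f z * (rho z.1)%:E)%E).
  apply: emeasurable_funM => //; apply/measurable_EFinP.
  exact: (measurableT_comp mrho measurable_fst).
rewrite (fubini_tonelli2 (fun z : T' * U => f (phi z.1, z.2)) mg); last by move=> z; exact: f0.
rewrite (fubini_tonelli2 (fun z : T * U => (f z * (rho z.1)%:E)%E) mr); last first.
  by move=> z; rewrite mule_ge0// lee_fin.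
apply: eq_integral => x _; rewrite /fubini_G /=.
apply: (H (f := fun y => f (y, x))) => // .
by apply: (measurableT_comp mf); exact: measurable_pair2.
Qed.

End reweights_product.

Section scale_coordinate.
Variables (R : realType) (L n : nat) (i : 'I_n) (r : R).
Hypothesis r0 : 0 < r.
Local Notation gamma := (@normal_law R 0 1).

(** Dividing the i-th coordinate of the unknown vector by r has the same effect on
the observation as dividing the i-th coordinate of w by r. *)
Definition scale_row (w : n.-tuple R) : n.-tuple R :=
  [tuple (if j == i then tnth w j / r else tnth w j) | j < n].

Definition scale_rows (W : L.-tuple (n.-tuple R)) : L.-tuple (n.-tuple R) :=
  [tuple scale_row (tnth W l) | l < L].

Definition ratio (W : L.-tuple (n.-tuple R)) : R :=
  \prod_l gauss_ratio r (tnth (tnth W l) i).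

Lemma gauss_ratio_ge0 x : 0 <= gauss_ratio r x.
Proof. by rewrite mulr_ge0 ?expR_ge0// ltW. Qed.

Lemma ratio_ge0 W : 0 <= ratio W.
Proof. by apply: prodr_ge0 => l _; exact: gauss_ratio_ge0. Qed.

Lemma measurable_scale_row : measurable_fun setT scale_row.
Proof. by apply: measurable_mktuple => j; case: (j == i); solve_measurable. Qed.

Lemma measurable_scale_rows : measurable_fun setT scale_rows.
Proof.
apply: measurable_mktuple => l.
exact: (measurableT_comp measurable_scale_row (measurable_tnth l)).
Qed.

Lemma measurable_ratio : measurable_fun setT ratio.
Proof.
apply: measurable_prod => l _.
apply: (measurableT_comp (measurable_gauss_ratio r)).
exact: (measurableT_comp (measurable_tnth i) (measurable_tnth l)).
Qed.

Lemma scale_row_reweights : reweights (gauss_vec n (1 : R)) (gauss_vec n (1 : R))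
  scale_row (fun w => gauss_ratio r (tnth w i)).
Proof.
pose phi (j : 'I_n) (x : R) := if j == i then x / r else x.
pose rho (j : 'I_n) (x : R) := if j == i then gauss_ratio r x else 1.
have mphi j : measurable_fun setT (phi j) by rewrite /phi; case: (j == i); solve_measurable.
have mrho j : measurable_fun setT (rho j).
  by rewrite /rho; case: (j == i) => //; exact: measurable_gauss_ratio.
have rho0 j x : 0 <= rho j x.
  by rewrite /rho; case: (j == i) => //; exact: gauss_ratio_ge0.
have hj j : reweights gamma gamma (phi j) (rho j).
  rewrite /phi /rho; case: (j == i); first exact: gauss_reweights.
  by move=> f mf f0; apply: eq_integral => x _; rewrite mule1.
move=> F mF F0; have h := iid_reweights mphi mrho rho0 hj mF F0.
apply: (eq_trans h); apply: eq_integral => w _; congr (_ * _%:E)%E.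
rewrite (bigD1 i)//= big1 ?mulr1 /rho ?eqxx// => j ji.
by rewrite (negbTE ji).
Qed.

Lemma scale_rows_reweights :
  reweights (iid (gauss_vec n (1 : R)) L) (iid (gauss_vec n (1 : R)) L) scale_rows ratio.
Proof.
move=> F mF F0.
have mg : measurable_fun setT (fun w : n.-tuple R => gauss_ratio r (tnth w i)).
  exact: (measurableT_comp (measurable_gauss_ratio r) (measurable_tnth i)).
exact: (iid_reweights (phi := fun=> scale_row) (fun _ => measurable_scale_row)
  (fun _ => mg) (fun _ _ => gauss_ratio_ge0 _) (fun _ => scale_row_reweights) mF F0).
Qed.

Lemma ratio_mean : has_mean (iid (gauss_vec n (1 : R)) L) ratio 1.
Proof.
have h1 : has_mean (gauss_vec n (1 : R)) (fun w => gauss_ratio r (tnth w i)) 1.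
  by have h := has_mean_tnth i (f := gauss_ratio r) gauss_ratio_ge0 (has_mean_gauss_ratio r0); exact h.
have := has_mean_iid_prod (fun (l : 'I_L) (w : n.-tuple R) => gauss_ratio_ge0 (tnth w i)) (fun _ => h1).
by rewrite big1.
Qed.

(** With h = r^2 - 1 the second moment is (1 + h) (1 + 2 h)^(-1/2) = 1 + O(h^2). *)
Lemma gauss_ratio_sq : 1 <= r -> r ^+ 2 <= 2 ->
  mean_le gamma (fun x => gauss_ratio r x ^+ 2) (expR ((r ^+ 2 - 1) ^+ 2 / 2)).
Proof.
move=> r1 r2; set h := r ^+ 2 - 1.
have h0 : 0 <= h by rewrite /h subr_ge0 -[leLHS](expr1n _ 2) lerXn2r ?nnegrE// ltW.
have l2 : - h < 2^-1 by lra.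
have ee x : gauss_ratio r x ^+ 2 <= r ^+ 2 * expR (- h * x ^+ 2).
  rewrite /gauss_ratio exprMn -expRM_natl ler_wpM2l ?sqr_ge0// ler_expR -/h.
  by rewrite le_eqVlt; apply/orP; left; apply/eqP; field.
apply: (mean_le_mono _ _ ee) => [|x|].
- by apply: measurable_funX; exact: measurable_gauss_ratio.
- exact: sqr_ge0.
have q0 : 0 < 1 + 2 * h by lra.
apply: (has_mean_le (has_meanZ (r ^+ 2) (has_mean_exp_sq l2))) => [x|].
  by rewrite mulr_ge0 ?sqr_ge0// expR_ge0.
have -> : 1 - 2 * - h = 1 + 2 * h by ring.
have -> : r ^+ 2 = 1 + h by rewrite /h; ring.
rewrite ler_pdivrMr ?sqrtr_gt0//.
apply: (@le_trans _ _ ((1 + h ^+ 2 / 2) * Num.sqrt (1 + 2 * h))); last first.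
  by rewrite ler_wpM2r ?sqrtr_ge0// expR_ge1Dx.
have a0 : 0 <= 1 + h ^+ 2 / 2 by have := sqr_ge0 h; lra.
rewrite -(ler_pXn2r (n := 2))// ?nnegrE; last 2 first.
- lra.
- by rewrite mulr_ge0// sqrtr_ge0.
rewrite exprMn sqr_sqrtr; last exact: ltW.
have h2 := sqr_ge0 h; have h3 : 0 <= h * h ^+ 2 by rewrite mulr_ge0.
have h4 : 0 <= h ^+ 2 * h ^+ 2 by rewrite mulr_ge0.
have h5 : 0 <= h * (h ^+ 2 * h ^+ 2) by rewrite mulr_ge0.
lra.
Qed.

Lemma ratio_sq : 1 <= r -> r ^+ 2 <= 2 -> L%:R * (r ^+ 2 - 1) ^+ 2 <= 1 ->
  mean_le (iid (gauss_vec n (1 : R)) L) (fun W => ratio W ^+ 2) (expR 1).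
Proof.
move=> r1 r2 hL.
have h1 : mean_le (gauss_vec n (1 : R)) (fun w => gauss_ratio r (tnth w i) ^+ 2)
    (expR ((r ^+ 2 - 1) ^+ 2 / 2)).
  have [v hv vle] := mean_le_has_mean (gauss_ratio_sq r1 r2).
  have h := has_mean_tnth i (f := fun x : R => gauss_ratio r x ^+ 2) (fun x => sqr_ge0 _) hv.
  by apply: (has_mean_le h _ vle) => w; exact: sqr_ge0.
have := mean_le_iid_prod (fun l : 'I_L => h1).
rewrite prodr_const card_ord -expRM_natl => h.
under eq_fun do rewrite /ratio -prodrXl.
apply: (mean_leW h); rewrite ler_expR; lra.
Qed.

End scale_coordinate.

(** The minimum over g of the quadratic losses is (a - b)^2 rho / (1 + rho), and
rho / (1 + rho) lies above the quadratic polynomial in rho that touches it at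
rho = s. Taking means then only requires the first two moments of rho. *)
Lemma two_point_loss (R : realFieldType) (g a b rho s : R) : 0 <= rho -> 0 <= s ->
  (a - b) ^+ 2 * (1 + 2 * s) / (1 + s) ^+ 2 * rho <=
  (g - a) ^+ 2 + (g - b) ^+ 2 * rho + (a - b) ^+ 2 / (1 + s) ^+ 2 * rho ^+ 2.
Proof.
move=> rho0 s0.
have s1 : 0 < (1 + s) ^+ 2 by rewrite exprn_gt0//; lra.
have r1 : 0 < 1 + rho by lra.
have h1 : (a - b) ^+ 2 * rho <= ((g - a) ^+ 2 + (g - b) ^+ 2 * rho) * (1 + rho).
  rewrite -subr_ge0.
  have -> : ((g - a) ^+ 2 + (g - b) ^+ 2 * rho) * (1 + rho) - (a - b) ^+ 2 * rho =
    ((g - a) + (g - b) * rho) ^+ 2 by ring.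
  exact: sqr_ge0.
have h2 : (1 + 2 * s - rho) * (1 + rho) <= (1 + s) ^+ 2.
  by have := sqr_ge0 (s - rho); nra.
rewrite -subr_ge0.
set c := (a - b) ^+ 2 in h1 *.
have c0 : 0 <= c by exact: sqr_ge0.
set X := (g - a) ^+ 2 + (g - b) ^+ 2 * rho in h1 *.
have -> : X + c / (1 + s) ^+ 2 * rho ^+ 2 - c * (1 + 2 * s) / (1 + s) ^+ 2 * rho =
  X - c * rho * (1 + 2 * s - rho) / (1 + s) ^+ 2.
  by field; rewrite gt_eqF//; lra.
rewrite subr_ge0 ler_pdivrMr//.
have h3 : c * rho * ((1 + 2 * s - rho) * (1 + rho)) <= X * (1 + rho) * (1 + s) ^+ 2.
  apply: (@le_trans _ _ (c * rho * (1 + s) ^+ 2)).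
    by rewrite ler_wpM2l// mulr_ge0.
  by rewrite ler_wpM2r// ltW.
rewrite -(ler_pM2r r1); apply: le_trans (le_trans h3 _) => //.
  by rewrite mulrA.
by rewrite mulrAC.
Qed.

Section two_point.
Variables (R : realType) (L m n : nat) (sz : R) (xhat : estimator R L m n).
Local Notation law := (model_law L m n sz).
Local Notation mx := (m.-tuple (n.-tuple R)).
Local Notation omega := (L.-tuple mx * (L.-tuple (n.-tuple R) * L.-tuple (m.-tuple R)))%type.

Definition est_coord (xo : 'cV[R]_n) i (o : omega) : R :=
  tnth (xhat (observation xo o.1 o.2.1 o.2.2, o.1)) i.

Lemma measurable_est_coord xo i : measurable_fun setT (est_coord xo i).
Proof.
have mo : measurable_fun setT (fun o : omega => observation xo o.1 o.2.1 o.2.2).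
  rewrite (_ : (fun o => _) = (fun o : omega =>
    [tuple ymeas (fun j => xo j ord0) (tnth (samples o) l) | l < L])); last first.
    by apply/funext => -[A [w z]]; rewrite observationE.
  apply: measurable_mktuple => l.
  apply: (measurableT_comp (@measurable_ymeas _ _ _ _)).
  exact: (measurableT_comp (measurable_tnth l) (@measurable_samples R L m n)).
apply: measurable_tnth_comp.
by apply: (measurableT_comp (measurable_funPT xhat)); exact: measurable_fun_pair.
Qed.

Definition coord_risk (xo : 'cV[R]_n) i : \bar R :=
  (\int[law]_o ((est_coord xo i o - xo i ord0) ^+ 2)%:E)%E.

Lemma coord_risk_ge0 xo i : (0 <= coord_risk xo i)%E.
Proof. by apply: integral_ge0 => o _; rewrite lee_fin sqr_ge0. Qed.

Lemma mseE xo : mse sz xhat xo = (n%:R^-1%:E * \sum_i coord_risk xo i)%E.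
Proof.
have mc i : measurable_fun setT (fun o : omega => ((est_coord xo i o - xo i ord0) ^+ 2)%:E).
  apply/measurable_EFinP; apply: measurable_funX; apply: measurable_funB => //.
  exact: measurable_est_coord.
rewrite /mse unlock.
transitivity (\int[law]_o (n%:R^-1%:E * \sum_(i < n) ((est_coord xo i o - xo i ord0) ^+ 2)%:E))%E.
  apply: eq_integral => -[A [w z]] _; rewrite sumEFin -EFinM; congr EFin.
  rewrite mulrC /sqnorm2; congr (_ * _); apply: eq_bigr => i _.
  by rewrite /est_coord 2!mxE [in (- xo) i ord0]mxE.
rewrite ge0_integralZl//; last 2 first.
- exact: emeasurable_sum.
- by move=> o _; apply: sume_ge0 => i _; rewrite lee_fin sqr_ge0.
by rewrite ge0_integral_sum// => i o _; rewrite lee_fin sqr_ge0.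
Qed.

(** The risk at xo' is the risk at xo weighted by the likelihood ratio rho, for which
E rho = 1 and E rho^2 <= s; then [two_point_loss] applies pointwise. *)
Lemma two_point (xo xo' : 'cV[R]_n) i r s : 1 <= r -> r ^+ 2 <= 2 ->
  L%:R * (r ^+ 2 - 1) ^+ 2 <= 1 ->
  (forall j, j != i -> xo' j ord0 = xo j ord0) -> xo' i ord0 = xo i ord0 / r ->
  s = expR 1 ->
  (((xo i ord0 - xo' i ord0) ^+ 2 / (1 + s))%:E <= coord_risk xo i + coord_risk xo' i)%E.
Proof.
move=> r1 r2 hL xj xi sE.
have r0 : 0 < r by lra.
have s0 : 0 <= s by rewrite sE expR_ge0.
pose G := est_coord xo i.
have mG : measurable_fun setT G by exact: measurable_est_coord.
set a := xo i ord0; set b := xo' i ord0.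
pose rho (o : omega) := ratio i r o.2.1.
have mrho : measurable_fun setT rho.
  apply: (measurableT_comp (@measurable_ratio R L n i r)).
  exact: (measurableT_comp measurable_fst measurable_snd).
have rho0 o : 0 <= rho o by exact: ratio_ge0.
(* Observing xo' at o is observing xo at psi o. *)
pose psi (o : omega) : omega := (o.1, (scale_rows i r o.2.1, o.2.2)).
have hpsi : reweights law law psi rho.
  have h1 := @reweights_prodl _ _ _ _ _ (L.-tuple (m.-tuple R)) R _ _ (iid (gauss_vec m sz) L) _ _
     (@measurable_scale_rows R L n i r) (@measurable_ratio R L n i r)
     (fun W => ratio_ge0 i r0 W) (@scale_rows_reweights R L n i r r0).
  have h2 := @reweights_prodr _ _ _ _ _ (L.-tuple mx) R _ _ (iid (gauss_mx R m n) L) _ _ _ _ _ h1.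
  apply: h2.
  - apply: measurable_fun_pair => //.
    exact: (measurableT_comp (@measurable_scale_rows R L n i r) measurable_fst).
  - exact: (measurableT_comp (@measurable_ratio R L n i r) measurable_fst).
  - by move=> z; exact: ratio_ge0.
have obsE o : est_coord xo' i o = G (psi o).
  rewrite /G /est_coord /psi/=; congr (tnth (xhat (_, _)) _).
  case: o => A [w z] /=; rewrite !observationE.
  apply: eq_from_tnth => l; rewrite !tnth_mktuple; apply: eq_from_tnth => p.
  rewrite /ymeas/= /meas [LHS]tnth_mktuple [RHS]tnth_mktuple; congr (_ + _).
  apply: eq_bigr => j _; congr (_ * _).
  rewrite [in RHS]tnth_mktuple; have [->|ji] := eqVneq j i; last by rewrite xj.
  by rewrite xi mulrAC mulrA.
have E2 : coord_risk xo' i = (\int[law]_o ((G o - b) ^+ 2 * rho o)%:E)%E.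
  rewrite /coord_risk; under eq_integral do rewrite obsE -/b.
  rewrite (hpsi (fun o => ((G o - b) ^+ 2)%:E)) //.
  - by apply/measurable_EFinP; apply: measurable_funX; exact: measurable_funB.
  - by move=> o; rewrite lee_fin sqr_ge0.
pose c := (a - b) ^+ 2.
have c0 : 0 <= c by exact: sqr_ge0.
have s1 : 0 < (1 + s) ^+ 2 by rewrite exprn_gt0//; lra.
have marg f v : (forall x, 0 <= f x) -> has_mean (iid (gauss_vec n (1 : R)) L) f v ->
    has_mean law (fun o => f o.2.1) v.
  move=> f0 fv; have mf : measurable_fun setT f by case: fv.
  apply: (@has_mean_prod3 _ _ _ _ _ _ _ _ _ _ _ (fun _ W => f W) (fun _ => v)) => //.
  - exact: (measurableT_comp mf (measurableT_comp measurable_fst measurable_snd)).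
  - by move=> A W; have h := has_mean_cst (iid (gauss_vec m sz) L) (f W); exact h.
  - have h := has_mean_cst (iid (gauss_mx R m n) L) v; exact h.
have rho1 := marg _ _ (fun W => ratio_ge0 i r0 W) (@ratio_mean R L n i r r0).
have [v hv vs] := mean_le_has_mean (@ratio_sq R L n i r r0 r1 r2 hL).
have rho2 := marg _ _ (fun W => sqr_ge0 _) hv.
have [_ _ I1] := has_meanZ (c * (1 + 2 * s) / (1 + s) ^+ 2) rho1.
have [_ _ I2] := has_meanZ (c / (1 + s) ^+ 2) rho2.
have mx1 : measurable_fun setT (fun o => (G o - a) ^+ 2).
  by apply: measurable_funX; exact: measurable_funB.
have mx2 : measurable_fun setT (fun o => (G o - b) ^+ 2 * rho o).
  by apply: measurable_funM => //; apply: measurable_funX; exact: measurable_funB.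
have mx3 : measurable_fun setT (fun o => c / (1 + s) ^+ 2 * rho o ^+ 2).
  by apply: measurable_funM => //; exact: measurable_funX.
have cs0 : 0 <= c / (1 + s) ^+ 2 by rewrite divr_ge0// ltW.
have key : ((c * (1 + 2 * s) / (1 + s) ^+ 2 * 1)%:E <=
    (coord_risk xo i + coord_risk xo' i) + (c / (1 + s) ^+ 2 * v)%:E)%E.
  rewrite E2 -I1 -I2 /coord_risk -/G -/a.
  rewrite -ge0_integralD//; last 4 first.
  - by move=> o _; rewrite lee_fin sqr_ge0.
  - exact/measurable_EFinP.
  - by move=> o _; rewrite lee_fin mulr_ge0 ?sqr_ge0.
  - exact/measurable_EFinP.
  rewrite -ge0_integralD//; last 4 first.
  - by move=> o _; rewrite -EFinD lee_fin; exact: (addr_ge0 (sqr_ge0 _) (mulr_ge0 (sqr_ge0 _) (rho0 _))).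
  - by apply: emeasurable_funD; exact/measurable_EFinP.
  - by move=> o _; rewrite lee_fin; exact: (mulr_ge0 cs0 (sqr_ge0 _)).
  - exact/measurable_EFinP.
  apply: ge0_le_integral => //.
  - move=> o _; rewrite lee_fin mulr_ge0//; last exact: rho0.
    by rewrite divr_ge0 ?(ltW s1)// mulr_ge0//; lra.
  - by apply/measurable_EFinP; apply: measurable_funM.
  - by apply: emeasurable_funD; [apply: emeasurable_funD|]; exact/measurable_EFinP.
  - by move=> o _; rewrite -!EFinD lee_fin; exact: (two_point_loss _ _ _ (rho0 o) s0).
have -> : c / (1 + s) = c * (1 + 2 * s) / (1 + s) ^+ 2 * 1 - c / (1 + s) ^+ 2 * s.
  by field; rewrite gt_eqF//; lra.
rewrite EFinB leeBlDr//; apply: (le_trans key).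
rewrite leeD2l// lee_fin ler_wpM2l// sE.
exact: vs.
Qed.

End two_point.

(** * Lower bound on the minimax risk *)

(** Assouad's argument: summed over all t, the two members of every pair
(t, flip i t) contribute at least beta at i, so the average over t of the sum over S
is at least |S| beta / 2. *)
Lemma flip_average (R : realFieldType) (T I : finType) (S : {set I}) (flip : I -> T -> T)
    (e : T -> I -> R) (beta : R) : (0 < #|T|)%N ->
  (forall i, involutive (flip i)) ->
  (forall i, i \in S -> forall t, beta <= e t i + e (flip i t) i) ->
  exists t, #|S|%:R * beta / 2 <= \sum_(i in S) e t i.
Proof.
move=> T0 flipK pair; apply: contrapT => /forallNP H.
have [t0 _] : exists t0 : T, t0 \in T by case/card_gt0P: T0 => t0 ?; exists t0.
have lt1 : \sum_t \sum_(i in S) e t i < \sum_(t : T) #|S|%:R * beta / 2.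
  apply: ltr_sum; first by apply/hasP; exists t0; rewrite ?mem_index_enum.
  by move=> t _; rewrite ltNge; apply/negP; exact: H.
move: lt1; rewrite exchange_big/= sumr_const; apply/negP; rewrite -leNgt.
have per i : i \in S -> #|T|%:R * beta / 2 <= \sum_t e t i.
  move=> iS.
  have -> : \sum_t e t i = (\sum_t (e t i + e (flip i t) i)) / 2.
    have -> : \sum_t (e t i + e (flip i t) i) = \sum_t e t i + \sum_t e t i.
      by rewrite big_split/=; congr (_ + _); rewrite [RHS](reindex_inj (inv_inj (flipK i))).
    by field.
  rewrite ler_wpM2r ?invr_ge0// mulr_natl -sumr_const.
  by apply: ler_sum => t _; exact: pair.
have h : \sum_(i in S) (#|T|%:R * beta / 2) <= \sum_(i in S) \sum_t e t i.
  by apply: ler_sum => i iS; exact: per.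
apply: le_trans h; rewrite sumr_const -[leLHS]mulr_natr -[leRHS]mulr_natr.
by rewrite le_eqVlt; apply/orP; left; apply/eqP; ring.
Qed.

Section hypercube.
Variables (R : realType) (n k : nat) (lo hi : R).

Definition vertex (t : {ffun 'I_n -> bool}) : 'cV[R]_n :=
  \col_j if (j < k)%N then (if t j then hi else lo) else 0.

Definition flip (i : 'I_n) (t : {ffun 'I_n -> bool}) : {ffun 'I_n -> bool} :=
  [ffun j => if j == i then ~~ t j else t j].

Lemma flipK i : involutive (flip i).
Proof.
by move=> t; apply/ffunP => j; rewrite !ffunE; case: eqP => // _; rewrite negbK.
Qed.

Lemma card_ord_lt : (k <= n)%N -> #|[set i : 'I_n | (i < k)%N]%SET| = k.
Proof.
move=> kn; rewrite -sum1_card; under eq_bigl do rewrite inE.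
by rewrite (big_ord_narrow kn) sum1_card card_ord.
Qed.

Lemma vertex_sparse xmin xmax t : (k <= n)%N -> xmin <= lo <= xmax -> xmin <= hi <= xmax ->
  sparse_bdd k xmin xmax (vertex t).
Proof.
move=> kn hlo hhi; split.
  rewrite -[leqRHS](card_ord_lt kn); apply: subset_leq_card; apply/fintype.subsetP => i.
  by rewrite !inE mxE; case: ifP => //; rewrite eqxx.
move=> i; rewrite mxE; case: ifP => _; last by left.
by right; case: (t i).
Qed.

End hypercube.

(** With h = h0 / L^(1/2) the likelihood ratios have bounded second moments, and two
values of a coordinate differ by a multiple of h. Every estimator therefore
loses a constant over L at each of the first k coordinates, on average over the
vertices. *)
Lemma minimax_lower (R : realType) (xmin xmax : R) : 0 < xmin -> xmin < xmax ->
  exists2 c : R, 0 < c & forall (m n L k : nat) (sz : R),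
    (0 < n)%N -> (0 < L)%N -> (k <= n)%N ->
    ((c * (k%:R / (n%:R * L%:R)))%:E <= minimax_risk L (@sparse_bdd R n k xmin xmax) m sz)%E.
Proof.
move=> xmin0 xminmax; have xmax0 := lt_trans xmin0 xminmax.
(* Small enough for xmin (1 + h0)^(1/2) <= xmax and for the likelihood ratio to
   have a bounded second moment. *)
pose h0 := Num.min 1 (xmax ^+ 2 / xmin ^+ 2 - 1).
have xm2 : 0 < xmin ^+ 2 by rewrite exprn_gt0.
have h00 : 0 < h0.
  rewrite /h0 lt_min ltr01/= subr_gt0 ltr_pdivlMr// mul1r.
  by rewrite ltrXn2r ?nnegrE ?ltW.
have h01 : h0 <= 1 by rewrite ge_min lexx.
have h0x : xmin ^+ 2 * (1 + h0) <= xmax ^+ 2.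
  have : h0 <= xmax ^+ 2 / xmin ^+ 2 - 1 by rewrite ge_min lexx orbT.
  by rewrite lerBrDl ler_pdivlMr// mulrC.
pose s : R := expR 1.
have s0 : 0 < s by exact: expR_gt0.
exists (xmin ^+ 2 * h0 ^+ 2 / (18 * (1 + s))).
  by rewrite divr_gt0 ?mulr_gt0 ?exprn_gt0//; lra.
move=> m n L k sz n0 L0 kn.
have nr0 : 0 < n%:R :> R by rewrite ltr0n.
have Lr1 : 1 <= L%:R :> R by rewrite ler1n.
have Lr0 : 0 < L%:R :> R by lra.
pose q : R := Num.sqrt L%:R.
have q2 : q ^+ 2 = L%:R by rewrite sqr_sqrtr// ltW.
have q1 : 1 <= q by rewrite -sqrtr1 ler_sqrt.
have q0 : 0 < q by lra.
pose h := h0 / q.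
have hpos : 0 < h by rewrite divr_gt0.
have hh0 : h <= h0 by rewrite /h ler_pdivrMr// ler_peMr// ltW.
pose r := Num.sqrt (1 + h).
have r2 : r ^+ 2 = 1 + h by rewrite sqr_sqrtr//; lra.
have r1 : 1 <= r by rewrite -[leLHS]sqrtr1 ler_sqrt//; lra.
have r0 : 0 < r by lra.
pose hi := xmin * r.
have hi2 : hi ^+ 2 <= xmax ^+ 2.
  by apply: le_trans h0x; rewrite /hi exprMn r2 ler_wpM2l ?(ltW xm2)// lerD2l.
have hi_le : hi <= xmax.
  rewrite -(ler_pXn2r (n := 2))// nnegrE; last exact: ltW.
  by rewrite mulr_ge0// ltW.
have hi_ge : xmin <= hi by rewrite /hi ler_peMr// ltW.
pose beta := (hi - xmin) ^+ 2 / (1 + s).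
have s1 : 0 < 1 + s by lra.
have beta_ge : xmin ^+ 2 * h0 ^+ 2 / (9 * (1 + s)) / L%:R <= beta.
  have rle : r <= 2.
    by rewrite -(ler_pXn2r (n := 2)) ?nnegrE ?(ltW r0)// r2; lra.
  have hr : h / 3 <= r - 1.
    have -> : h = (r - 1) * (r + 1) by rewrite -[LHS](addrK 1) (addrC h) -r2; ring.
    have : 0 <= (r - 1) * (2 - r) by rewrite mulr_ge0 ?subr_ge0.
    lra.
  have hr2 : (h / 3) ^+ 2 <= (r - 1) ^+ 2.
    by rewrite lerXn2r ?nnegrE ?subr_ge0// divr_ge0// ltW.
  have -> : xmin ^+ 2 * h0 ^+ 2 / (9 * (1 + s)) / L%:R = xmin ^+ 2 * (h / 3) ^+ 2 / (1 + s).
    by rewrite /h -q2; field; rewrite !gt_eqF.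
  have -> : beta = xmin ^+ 2 * (r - 1) ^+ 2 / (1 + s).
    by rewrite /beta /hi; field; rewrite gt_eqF.
  by rewrite ler_wpM2r ?invr_ge0 ?(ltW s1)// ler_wpM2l// ltW.
apply: le_ereal_inf_tmp => _ [xhat _ <-].
have vsp t : sparse_bdd k xmin xmax (@vertex R n k xmin hi t).
  by apply: vertex_sparse => //; [rewrite lexx ltW|rewrite hi_ge].
suff [t ht] : exists t, ((xmin ^+ 2 * h0 ^+ 2 / (18 * (1 + s)) * (k%:R / (n%:R * L%:R)))%:E <=
    mse sz xhat (@vertex R n k xmin hi t))%E.
  by apply: (le_trans ht); apply: ereal_sup_ubound; exists (vertex k xmin hi t).
pose risk t i := coord_risk sz xhat (@vertex R n k xmin hi t) i.
have risk0 t i : (0 <= risk t i)%E by exact: coord_risk_ge0.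
have [allfin|/existsNP[t /existsNP[i /negP nfin]]] :=
  pselect (forall t i, risk t i \is a fin_num); last first.
  exists t; rewrite mseE.
  have roo : risk t i = +oo%E.
    by move: nfin (risk0 t i); case: (risk t i).
  rewrite (bigD1 i)//= -/(risk t i) roo addye ?gt0_muley ?leey//.
    by rewrite lte_fin invr_gt0.
  by rewrite -ltNye (lt_le_trans (ltNyr 0))// sume_ge0// => j _; exact: risk0.
pose e t i := fine (risk t i).
pose S := [set i : 'I_n | (i < k)%N]%SET.
have pair i : i \in S -> forall t : {ffun 'I_n -> bool}, beta <= e t i + e (flip i t) i.
  rewrite inE => ik.
  have aux (t : {ffun 'I_n -> bool}) : t i -> beta <= e t i + e (flip i t) i.
    move=> ti; rewrite -lee_fin EFinD !fineK//.
    have vi : vertex k xmin hi t i ord0 = hi by rewrite mxE ik ti.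
    have vi' : vertex k xmin hi (flip i t) i ord0 = xmin by rewrite mxE ik ffunE eqxx ti.
    have := @two_point R L m n sz xhat (vertex k xmin hi t) (vertex k xmin hi (flip i t)) i r s.
    rewrite vi vi'; apply => //.
    - by rewrite r2; lra.
    - have -> : r ^+ 2 - 1 = h by rewrite r2; ring.
      have -> : L%:R * h ^+ 2 = h0 ^+ 2 by rewrite /h -q2; field; rewrite gt_eqF.
      by rewrite expr_le1// ltW.
    - by move=> j ji; rewrite !mxE ffunE (negbTE ji).
    - by rewrite /hi mulfK// gt_eqF.
  move=> t; have [ti|ti] := boolP (t i); first exact: aux.
  have := aux (flip i t); rewrite flipK addrC; apply.
  by rewrite ffunE eqxx.
have T0 : (0 < #|{ffun 'I_n -> bool}|)%N by apply/card_gt0P; exists [ffun=> true].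
have [t ht] := @flip_average R _ _ S (@flip n) e beta T0 (@flipK n) pair.
exists t; rewrite mseE.
have -> : (\sum_i coord_risk sz xhat (vertex k xmin hi t) i = (\sum_i e t i)%:E)%E.
  by rewrite -sumEFin; apply: eq_bigr => i _; rewrite fineK//; exact: allfin.
rewrite -EFinM lee_fin.
have e0 i : 0 <= e t i by rewrite fine_ge0.
have sumS : \sum_(i in S) e t i <= \sum_i e t i.
  rewrite [leRHS](bigID (fun i => i \in S))/= lerDl.
  by apply: sumr_ge0.
apply: (@le_trans _ _ (n%:R^-1 * (k%:R * beta / 2))); last first.
  rewrite ler_wpM2l ?invr_ge0 ?(ltW nr0)//; apply: le_trans sumS.
  by rewrite card_ord_lt in ht.
have -> : xmin ^+ 2 * h0 ^+ 2 / (18 * (1 + s)) * (k%:R / (n%:R * L%:R)) =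
  n%:R^-1 * (k%:R * (xmin ^+ 2 * h0 ^+ 2 / (9 * (1 + s)) / L%:R) / 2).
  by field; rewrite !gt_eqF.
rewrite ler_wpM2l ?invr_ge0 ?(ltW nr0)// ler_wpM2r ?invr_ge0//.
by rewrite ler_wpM2l.
Qed.

(** * The minimax rate *)

Theorem theorem2p10 (R : realType) (xmin xmax : R)
    (xmin_gt0 : 0 < xmin) (xmin_lt_xmax : xmin < xmax) :
  exists c C C' : R, [/\ 0 < c, 0 < C, 0 < C' &
    forall (m n L k : nat) (sz : R),
      (0 < m)%N -> (0 < n)%N -> (0 < L)%N -> (0 < k)%N ->
      k%:R <= n%:R / 2 :> R ->
      k%:R * ln (expR 1 * n%:R / k%:R) <= m%:R :> R ->
      0 <= sz ->
      let risk := minimax_risk L (@sparse_bdd R n k xmin xmax) m sz in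
      let rate : R := k%:R / (n%:R * L%:R) in
      let lower := c * rate in
      let upper := C * (rate + sz ^+ 2 * k%:R * ln (n%:R / k%:R)
                                 / (m%:R * n%:R)) in
      (lower%:E <= risk <= upper%:E)%E /\
      (sz ^+ 2 * L%:R * ln (n%:R / k%:R) <= m%:R ->
         c * rate <= upper <= C' * rate)].
Proof.
have [C0 C00 up] := minimax_upper xmin_gt0 xmin_lt_xmax.
have [c0 c00 lo] := minimax_lower xmin_gt0 xmin_lt_xmax.
exists (Num.min c0 C0), C0, (2 * C0); split=> //.
- by rewrite lt_min c00.
- by rewrite mulr_gt0.
move=> m n L k sz m0 n0 L0 k0 kn km sz0 risk rate lower upper.
have kr0 : 0 < k%:R :> R by rewrite ltr0n.
have nr0 : 0 < n%:R :> R by rewrite ltr0n.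
have Lr0 : 0 < L%:R :> R by rewrite ltr0n.
have mr0 : 0 < m%:R :> R by rewrite ltr0n.
have len : (k <= n)%N by rewrite -(ler_nat R); apply: (le_trans kn); lra.
have rate0 : 0 <= rate by rewrite /rate divr_ge0 ?mulr_ge0// ltW.
have ln0 : 0 <= ln (n%:R / k%:R : R).
  by rewrite ln_ge0// ler_pdivlMr// mul1r ler_nat.
split.
  apply/andP; split; last exact: up.
  apply: le_trans (lo m n L k sz n0 L0 len).
  by rewrite lee_fin /lower ler_wpM2r// ge_min lexx.
move=> small; pose noise : R := sz ^+ 2 * k%:R * ln (n%:R / k%:R) / (m%:R * n%:R).
have noise0 : 0 <= noise.
  by rewrite divr_ge0 ?mulr_ge0 ?sqr_ge0// ltW.
have noise1 : noise <= rate.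
  have -> : noise = sz ^+ 2 * L%:R * ln (n%:R / k%:R) / m%:R * rate.
    by rewrite /noise /rate; field; rewrite !gt_eqF.
  by rewrite ler_piMl// ler_pdivrMr// mul1r.
apply/andP; split; last first.
  by rewrite /upper -/noise (mulrC 2) -mulrA ler_wpM2l ?(ltW C00)//; lra.
apply: (@le_trans _ _ (C0 * rate)); first by rewrite ler_wpM2r// ge_min lexx orbT.
by rewrite /upper -/noise ler_wpM2l ?(ltW C00)// lerDl.
Qed.
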